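(* Let $K$ be an algebraically closed field of characteristic $p=0$, and let $X\subset\mathbb{P}^{n+1}$ be a hypersurface of dimension $n\ge 1$ and degree $d\ge 4$ with $s(X)\le n-2$. If the set $\Delta(X)\cup\Delta'(X)$ is infinite, then $X$ is a cone. Furthermore, there exist linear spaces $M_1,M_2\subset\mathbb{P}^{n+1}$ with $M_1\cap M_2=\emptyset$ and an irreducible hypersurface $Y\subset M_1$ satisfying the following conditions: (i) $X=Y\,\sharp\,M_2$; (ii) $M_2$ has the maximal dimension as a vertex of $X$; (iii) the set $\Delta(Y)\cup\Delta'(Y)$ is finite; and (iv) $\Delta(X)=(\Delta(Y)\,\sharp\,M_2)\setminus M_2$ and $\Delta'(X)=(\Delta'(Y)\,\sharp\,M_2)\setminus M_2$.
   Context: A hypersurface in a projective space is irreducible and reduced. $s(X):=\dim\mathrm{Sing}(X)$, with $\dim\emptyset=-1$. For a hypersurface $X\subset\mathbb{P}^{n+1}$, a point $P\in X_{\rm sm}\cup(\mathbb{P}^{n+1}\setminus X)$ ($X_{\rm sm}$ the smooth locus) is a Galois point for $X$ if the function field extension $K(X)/K(\mathbb{P}^n)$ induced by the projection $\pi_P:X\dashrightarrow\mathbb{P}^n$ from $P$ is Galois. $\Delta(X)$ (resp. $\Delta'(X)$) is the set of all Galois points contained in $X_{\rm sm}$ (resp. in $\mathbb{P}^{n+1}\setminus X$). For $Y\subset M_1$, the sets $\Delta(Y),\Delta'(Y)\subset M_1$ are defined in the same way, with the projective space $M_1$ as ambient space. For $A\subset M_1$, $A\,\sharp\,M_2$ denotes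 the linear join, i.e. the union of the linear spans of $P$ and $M_2$ over $P\in A$ (so $(A\,\sharp\,M_2)\setminus M_2=\emptyset$ if $A=\emptyset$). $X$ is a cone if there is a nonempty linear space $M\subset X$ (a vertex of $X$) such that for every $v\in M$ and every $x\in X\setminus\{v\}$ the line $\overline{vx}$ is contained in $X$. *)

(* Defs.v *)
(* MathComp with multinomials, and the classical sets of MathComp-Analysis. *)
From HB Require Import structures.
From mathcomp Require Import all_boot all_order all_algebra all_field.
From mathcomp Require Import generic_quotient ring_quotient fraction.
From mathcomp Require Import boolp classical_sets cardinality.
From mathcomp Require Import mpoly.

Set Implicit Arguments.
Unset Strict Implicit.
Unset Printing Implicit Defensive.

Import Order.TTheory GRing.Theory Num.Theory.

Local Open Scope classical_set_scope.
Local Open Scope ring_scope.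
Local Open Scope quotient_scope.

(* The projective space P(V) of a finite dimensional K-vector space V has
   projective dimension \dim {:V} - 1.  Its points are the lines of V, its
   linear subspaces are the subspaces of V (0%VS is the empty linear space),
   and a subset of P(V) is a set of lines of V. *)
Definition points (K : fieldType) (V : vectType K) (M : {vspace V}) :
    set {vspace V} :=
  [set P | \dim P = 1%N /\ (P <= M)%VS].

(* Coordinates of V; a polynomial function on V is an element of
   {mpoly K[\dim {:V}]} evaluated at them. *)
Definition coords (K : fieldType) (V : vectType K) (v : V) :
    'I_(\dim {:V}) -> K :=
  fun i => coord (vbasis {:V}) i v.

Definition vanish (K : fieldType) (V : vectType K) (f : {mpoly K[\dim {:V}]})
    (P : {vspace V}) : Prop :=
  forall v, v \in P -> f.@[coords v] = 0.

Definition zclosed (K : fieldType) (V : vectType K) (Z : set {vspace V}) :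
    Prop :=
  exists2 I : set {mpoly K[\dim {:V}]},
    forall f, I f -> exists m : nat, f \is m.-homog &
    Z = [set P | points fullv P /\ forall f, I f -> vanish f P].

Definition zirreducible (K : fieldType) (V : vectType K)
    (Z : set {vspace V}) : Prop :=
  [/\ zclosed Z, Z !=set0 &
      forall A B, zclosed A -> zclosed B -> Z `<=` A `|` B ->
        Z `<=` A \/ Z `<=` B].

(* dim S <= k for a closed subset S of P(V): Krull dimension, the supremum of
   the lengths m of the chains Z_0 < ... < Z_m of irreducible closed subsets
   of S, with dim set0 = -1. *)
Definition zdim_le (K : fieldType) (V : vectType K) (S : set {vspace V})
    (k : int) : Prop :=
  -1 <= k /\
  forall (m : nat) (Z : nat -> set {vspace V}),
    (forall i, (i <= m)%N -> zirreducible (Z i) /\ Z i `<=` S) ->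
    (forall i, (i < m)%N -> Z i `<` Z i.+1) ->
    m%:Z <= k.

(* The ideal (F), as a boolean predicate. *)
Definition pideal (R : comUnitRingType) (F : R) : {pred R} :=
  fun g => `[< exists q, g = q * F >].

(* An irreducible and reduced hypersurface of P(V): the integral scheme cut
   out by a nonzero homogeneous polynomial generating a (proper) prime ideal. *)
Record hypersurface (K : fieldType) (V : vectType K) := Hypersurface {
  hpoly : {mpoly K[\dim {:V}]};
  degree : nat;
  hpoly_homog : hpoly \is degree.-homog;
  hpoly_neq0 : hpoly != 0;
  hpoly_nunit : hpoly \isn't a GRing.unit;
  hpoly_prime : prime_idealr_closed (pideal hpoly)
}.

Definition hideal (K : fieldType) (V : vectType K) (X : hypersurface V) :
    {mpoly K[\dim {:V}]} -> bool :=
  pideal (hpoly X).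

Fact hideal_idealr (K : fieldType) (V : vectType K) (X : hypersurface V) :
  idealr_closed (hideal X).
Proof.
split.
- by apply/asboolP; exists 0; rewrite mul0r.
- apply/asboolP => -[q q1]; have /negP := hpoly_nunit X; apply.
  by apply/unitrPr; exists q; rewrite mulrC -q1.
- move=> a u v /asboolP[p ->] /asboolP[q ->]; apply/asboolP.
  by exists (a * p + q); rewrite mulrDl mulrA.
Qed.

HB.instance Definition _ (K : fieldType) (V : vectType K)
    (X : hypersurface V) :=
  isIdealr.Build {mpoly K[\dim {:V}]} (hideal X) (hideal_idealr X).

HB.instance Definition _ (K : fieldType) (V : vectType K)
    (X : hypersurface V) :=
  isPrimeIdealrClosed.Build {mpoly K[\dim {:V}]} (hideal X) (@hpoly_prime K V X).

Definition vanishing_ideal (K : fieldType) (V : vectType K)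
    (X : hypersurface V) : prime_idealr {mpoly K[\dim {:V}]} :=
  hideal X.

Definition coordinate_ring (K : fieldType) (V : vectType K)
    (X : hypersurface V) : Type :=
  {ideal_quot (vanishing_ideal X)}.

HB.instance Definition _ (K : fieldType) (V : vectType K)
    (X : hypersurface V) :=
  GRing.ComNzRing.on (coordinate_ring X).

(* {fraction _} needs an integral domain with an explicit, here classical,
   partial inverse. *)
Definition cunit (R : comNzRingType) : pred R :=
  fun x => `[< exists y : R, y * x = 1 >].

Definition cinv (R : comNzRingType) (x : R) : R :=
  if pselect (exists y : R, y * x = 1) is left ux then projT1 (cid ux) else x.

Fact cmulVx (R : comNzRingType) : {in @cunit R, left_inverse 1 (@cinv R) *%R}.
Proof.
move=> x /asboolP ux; rewrite /cinv; case: pselect => // ux'.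
exact: (projT2 (cid ux')).
Qed.

Fact cunitPl (R : comNzRingType) (x y : R) : y * x = 1 -> cunit x.
Proof. by move=> yx; apply/asboolP; exists y. Qed.

Fact cinv_out (R : comNzRingType) : {in [predC @cunit R], @cinv R =1 id}.
Proof.
by move=> x /asboolP nux; rewrite /cinv; case: pselect => // ux; case: nux.
Qed.

HB.instance Definition _ (K : fieldType) (V : vectType K)
    (X : hypersurface V) :=
  GRing.ComNzRing_hasMulInverse.Build (coordinate_ring X)
    (@cmulVx (coordinate_ring X)) (@cunitPl (coordinate_ring X))
    (@cinv_out (coordinate_ring X)).

HB.instance Definition _ (K : fieldType) (V : vectType K)
    (X : hypersurface V) :=
  GRing.ComUnitRing_isIntegral.Build (coordinate_ring X)
    (@Quotient.rquot_IdomainAxiom _ (vanishing_ideal X)).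

Definition locus (K : fieldType) (V : vectType K) (X : hypersurface V) :
    set {vspace V} :=
  [set P | points fullv P /\ vanish (hpoly X) P].

(* Jacobian criterion. *)
Definition sing (K : fieldType) (V : vectType K) (X : hypersurface V) :
    set {vspace V} :=
  [set P | locus X P /\ forall i, vanish (hpoly X)^`M(i) P].

Definition smooth_locus (K : fieldType) (V : vectType K)
    (X : hypersurface V) : set {vspace V} :=
  locus X `\` sing X.

(* Fraction field of the homogeneous coordinate ring of X; it contains the
   function field of X as its subfield of fractions of degree 0. *)
Definition fraction_field (K : fieldType) (V : vectType K)
    (X : hypersurface V) : fieldType :=
  {fraction coordinate_ring X}.

(* The class of a / b in the fraction field, for b outside (hpoly X). *)
Definition ratfun (K : fieldType) (V : vectType K) (X : hypersurface V)
    (a b : {mpoly K[\dim {:V}]}) : fraction_field X :=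
  let cl (f : {mpoly K[\dim {:V}]}) : coordinate_ring X :=
    \pi_({ideal_quot (vanishing_ideal X)}) f in
  tofrac (cl a) / tofrac (cl b).

Definition function_field (K : fieldType) (V : vectType K)
    (X : hypersurface V) : set (fraction_field X) :=
  [set x | exists (m : nat) (a b : {mpoly K[\dim {:V}]}),
    [/\ a \is m.-homog, b \is m.-homog, ~~ hideal X b & x = ratfun X a b]].

(* The projection from the point P, v |-> (l_0(v) : ... : l_n(v)) with
   n + 1 = \dim {:V} - 1, where the l_i are linear forms whose only common zero
   in P(V) is P. *)
Definition projection_from (K : fieldType) (V : vectType K) (P : {vspace V})
    (l : (\dim {:V}).-1.-tuple {mpoly K[\dim {:V}]}) : Prop :=
  (forall i, tnth l i \is 1.-homog) /\
  (forall v : V, v \in P <-> forall i, (tnth l i).@[coords v] = 0).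

(* The image in K(X) of the function field K(P^n) of the target of the
   rational map (l_0 : ... : l_n), under pullback of rational functions. *)
Definition pullback_field (K : fieldType) (V : vectType K)
    (X : hypersurface V) (l : (\dim {:V}).-1.-tuple {mpoly K[\dim {:V}]}) :
    set (fraction_field X) :=
  [set x | exists (m : nat) (g h : {mpoly K[(\dim {:V}).-1]}),
    [/\ g \is m.-homog, h \is m.-homog, ~~ hideal X (h \mPo l) &
        x = ratfun X (g \mPo l) (h \mPo l)]].

Arguments ratfun {K V} X a b.
Arguments function_field {K V} X.
Arguments pullback_field {K V} X l.

(* For subfields k and L of E: L / k is a finite Galois extension, i.e. it is
   isomorphic to a Galois extension L0 / k0 in the sense of the library. *)
Definition galois_extension (E : fieldType) (k L : set E) : Prop :=
  exists (k0 : fieldType) (L0 : splittingFieldType k0)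
         (f : {rmorphism L0 -> E}),
    [/\ range f = L, range (fun a : k0 => f a%:A) = k &
        galois 1%AS {:L0}%AS].

Definition galois_projection (K : fieldType) (V : vectType K)
    (X : hypersurface V) (P : {vspace V}) : Prop :=
  exists2 l : (\dim {:V}).-1.-tuple {mpoly K[\dim {:V}]},
    projection_from P l &
    galois_extension (pullback_field X l) (function_field X).

(* Delta(X) and Delta'(X). *)
Definition inner_galois (K : fieldType) (V : vectType K)
    (X : hypersurface V) : set {vspace V} :=
  [set P | smooth_locus X P /\ galois_projection X P].

Definition outer_galois (K : fieldType) (V : vectType K)
    (X : hypersurface V) : set {vspace V} :=
  [set P | (points fullv `\` locus X) P /\ galois_projection X P].

Definition linear_join (K : fieldType) (V : vectType K)
    (A : set {vspace V}) (M : {vspace V}) : set {vspace V} :=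
  [set Q | exists2 P, A P & points (P + M)%VS Q].

Definition is_vertex (K : fieldType) (V : vectType K) (X : set {vspace V})
    (M : {vspace V}) : Prop :=
  [/\ M <> 0%VS, points M `<=` X &
      forall v x, points M v -> X x -> x <> v -> points (v + x)%VS `<=` X].

Definition is_cone (K : fieldType) (V : vectType K) (X : set {vspace V}) :
    Prop :=
  exists M, is_vertex X M.

(* A subset of the projective space P(M), seen as a subset of P(V). *)
Definition in_ambient (K : fieldType) (V : vectType K) (M : {vspace V})
    (A : set {vspace subvs_of M}) : set {vspace V} :=
  [set (linfun (@vsval K V M) @: P)%VS | P in A].

(* Main.v *)
Require Import Defs.
From HB Require Import structures.
From mathcomp Require Import all_boot all_order all_algebra all_field.
From mathcomp Require Import generic_quotient ring_quotient fraction.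
From mathcomp Require Import boolp classical_sets cardinality.
From mathcomp Require Import mpoly ring zify.

(* Let F be the equation of X, of degree d, and write D_v for the derivative in
   the direction v.  A point v of P(V) is Galois if and only if
   D_v F = M L^(e-1), where e = d for v outside X and e = d - 1 for v on X, L is a
   linear form with L(v) <> 0 and D_v M = 0: the equation is then M x^e + G, a
   Kummer extension.  Conversely, if v is Galois then F splits over the function
   field; as the singular locus has codimension at least 2 in X, the homogeneous
   coordinate ring is normal (an integral element outside of it would have a
   multiple with prime conductor, generated by two elements, over which F is
   singular, by Dedekind's criterion; two Jacobian elements obtained by
   elimination form a regular sequence, which excludes this).  So the conjugates
   of M t, for t a coordinate not vanishing at v, are forms, necessarily
   b M t + c with b constant; centering at the trace, the minimal polynomial of t
   becomes cyclic.
   The space M2 of the m with D_m F = 0 is the largest vertex of X, and X is a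
   cone over its section Y by a complement of M2, the Galois points of X lying over
   those of Y.  If D_m F = 0 only for m = 0, the symmetry D_v D_w F = D_w D_v F
   shows that, for the linear form L of a given Galois point, only finitely many
   Galois points lie off the hyperplane L = 0; so an infinite set of them would have
   infinitely many points in smaller and smaller linear spaces. *)

Set Implicit Arguments.
Unset Strict Implicit.
Unset Printing Implicit Defensive.

Import Order.TTheory GRing.Theory Num.Theory.
Import Pdiv.Ring.

Local Open Scope classical_set_scope.
Local Open Scope ring_scope.
Local Open Scope quotient_scope.

(** * Homogeneous components and substitutions *)

Section MpolyMorphisms.

(** The bound on [sing X] limits the length of chains of irreducible closed sets, whereas normality
    needs two Jacobian elements in regular sequence. A plane links them: the projection from a
    maximal linear space missing the singular locus maps that locus onto its target, and closed sets
    over a flag of the target form a long chain. So some plane misses the singular locus, and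
    elimination along its lines gives the two elements. Dedekind's criterion is proved over
    polynomials in one variable, so the other base variables are put in a field of constants; the
    integral element stays outside the ring because its denominator can be made monic in the
    variable that is kept. At an inner point the leading coefficient of [F] is a linear form, not a
    constant. Conjugates become polynomials only after multiplication by it, and it has to be shown
    to divide their linear coefficient and the trace before it can be cancelled. From degree 4 on, a
    second derivative leaves a positive power of [L] even at an inner point, where [D_v F] contains
    only [L^(d-2)]. For [d = 4] this power is 1, and comparing factors does not exclude inner points
    with different [L], whence the cube roots. *)

Lemma mpoly_rmorph_ext (R : comNzRingType) n (S : nzRingType)
    (f g : {rmorphism {mpoly R[n]} -> S}) :
  (forall c, f c%:MP = g c%:MP) -> (forall i, f 'X_i = g 'X_i) -> f =1 g.
Proof.
move=> eqC eqX; elim/mpolyind => [|c m p _ _ IH]; first by rewrite !rmorph0.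
rewrite !rmorphD IH -mul_mpolyC !rmorphM eqC; congr (_ * _ + _).
rewrite mpolyXE_id !rmorph_prod; apply: eq_bigr => i _.
by rewrite !rmorphXn eqX.
Qed.

Lemma mmapXU (R : comNzRingType) n (S : comNzRingType) (f : {rmorphism R -> S})
    (h : 'I_n -> S) i : mmap f h 'X_i = h i.
Proof. by rewrite mmapX mmap1U. Qed.

Lemma homog_lin (R : comNzRingType) n (p : {mpoly R[n]}) :
  p \is 1.-homog -> p = \sum_i p@_U_(i) *: 'X_i.
Proof.
move=> hp; apply/mpolyP => m; rewrite raddf_sum /=.
have [/eqP dm|dm] := boolP (mdeg m == 1%N); last first.
  rewrite (dhomog_nemf_coeff hp dm) big1 // => i _.
  rewrite mcoeffZ mcoeffX; case: eqP => [mE|]; last by rewrite mulr0.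
  by rewrite -mE mdeg1 eqxx in dm.
have /mdeg1P/= [i /eqP ->] : mdeg m == 1%N by rewrite dm.
rewrite (bigD1 i) //= mcoeffZ mcoeffXU eqxx mulr1 big1 ?addr0 // => j ji.
by rewrite mcoeffZ mcoeffXU (negbTE ji) mulr0.
Qed.

Lemma homog0_const (R : comNzRingType) n (p : {mpoly R[n]}) :
  p \is 0.-homog -> p = (p@_0)%:MP.
Proof.
move=> hp; apply/mpolyP => m; rewrite mcoeffC.
have [->|m0] := eqVneq m 0%MM; first by rewrite mulr1.
rewrite mulr0 (dhomog_nemf_coeff hp) //.
by rewrite mdeg_eq0.
Qed.

(* The substitution [X_i |-> X_i * 'X]; its coefficients are the homogeneous
   components. *)
Definition grade (R : comNzRingType) n (p : {mpoly R[n]}) :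
    {poly {mpoly R[n]}} :=
  mmap (polyC \o (@mpolyC n R)) (fun i => ('X_i)%:P * 'X) p.

HB.instance Definition _ (R : comNzRingType) n :=
  GRing.RMorphism.copy (@grade R n)
    (mmap (polyC \o (@mpolyC n R)) (fun i => ('X_i)%:P * 'X)).

Lemma gradeX (R : comNzRingType) n (m : 'X_{1..n}) :
  grade ('X_[m] : {mpoly R[n]}) = ('X_[m])%:P * 'X^(mdeg m).
Proof.
rewrite /grade mmapX /mmap1 mpolyXE_id mdegE.
rewrite (eq_bigr (fun i => ('X_i ^+ m i)%:P * 'X^(m i))) => [|i _]; last first.
  by rewrite exprMn rmorphXn.
rewrite big_split /= rmorph_prod; congr (_ * _).
by rewrite (big_morph _ (fun a b => exprD 'X a b) (expr0 _)).
Qed.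

Lemma gradeZ (R : comNzRingType) n c (p : {mpoly R[n]}) :
  grade (c *: p) = c%:MP%:P * grade p.
Proof. exact: mmapZ. Qed.

Lemma coef_grade (R : comNzRingType) n (p : {mpoly R[n]}) d :
  (grade p)`_d = pihomog mdeg d p.
Proof.
elim/mpolyind: p => [|c m p _ _ IH]; first by rewrite rmorph0 coef0 pihomog0.
rewrite pihomogD -IH (rmorphD (@grade R n)) coefD; congr (_ + _).
rewrite /= gradeZ gradeX coefCM coefCM coefXn.
rewrite linearZ /= pihomogX eq_sym; case: eqP => _.
  by rewrite mulr1 mul_mpolyC.
by rewrite !mulr0 scaler0.
Qed.

Lemma grade_homog (R : comNzRingType) n (p : {mpoly R[n]}) d :
  p \is d.-homog -> grade p = p%:P * 'X^d.
Proof.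
move=> hp; apply/polyP => k; rewrite coef_grade coefCM coefXn.
case: eqP => [->|/eqP ne]; first by rewrite mulr1 pihomog_dE.
by rewrite mulr0 (pihomog_ne0 _ hp) // eq_sym.
Qed.

Lemma homog_gradeP (R : comNzRingType) n (p : {mpoly R[n]}) d :
  grade p = p%:P * 'X^d -> p \is d.-homog.
Proof.
move=> gp; rewrite homog_piE -coef_grade gp coefCM coefXn eqxx mulr1.
exact/eqP.
Qed.

Lemma pihomogM (R : comNzRingType) n (p q : {mpoly R[n]}) d k :
  p \is d.-homog -> pihomog mdeg (d + k) (p * q) = p * pihomog mdeg k q.
Proof.
move=> hp; rewrite -!coef_grade rmorphM /= (grade_homog hp) -mulrA coefCM.
by rewrite coefXnM ltnNge leq_addr /= addKn.
Qed.

Lemma homogC (R : comNzRingType) n (c : R) :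
  (c%:MP : {mpoly R[n]}) \is 0.-homog.
Proof. by apply: homog_gradeP; rewrite /grade mmapC mulr1. Qed.

Lemma homog_comp (R : comNzRingType) n k (l : n.-tuple {mpoly R[k]})
    (p : {mpoly R[n]}) d :
  (forall i, tnth l i \is 1.-homog) -> p \is d.-homog ->
  p \mPo l \is d.-homog.
Proof.
move=> hl hp; apply: homog_gradeP.
have -> : grade (p \mPo l) = map_poly (comp_mpoly l) (grade p).
  apply: (@mpoly_rmorph_ext _ _ _ (@grade R k \o comp_mpoly l)
    (map_poly (comp_mpoly l) \o @grade R n)) => [c|i] /=.
    rewrite comp_mpolyC /grade !mmapC /= map_polyC /=.
    by rewrite comp_mpolyC.
  rewrite {2}/grade mmapXU rmorphM /= map_polyX map_polyC /= comp_mpolyXU.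
  by rewrite -tnth_nth (grade_homog (hl i)) expr1.
by rewrite (grade_homog hp) rmorphM /= map_polyC /= map_polyXn.
Qed.

Lemma homog_meval0 (R : comNzRingType) n (p : {mpoly R[n]}) d w :
  (0 < d)%N -> p \is d.-homog -> (forall i, w i = 0) -> p.@[w] = 0.
Proof.
move=> d0 /dhomogP hp w0; rewrite mevalE big_seq big1 // => mm /hp /= dm.
have [j mj] : exists j, mm j != 0%N.
  apply/existsP; apply: contraTT d0; rewrite negb_exists => /forallP h.
  rewrite -leqNgt leqn0 -dm mdegE; apply/eqP; apply: big1 => j _.
  by have /negPn/eqP := h j.
by rewrite (bigD1 j) //= w0 expr0n (negbTE mj) mul0r mulr0.
Qed.

End MpolyMorphisms.

(** * Frames *)

Section Frames.

Variables (K : fieldType) (N m : nat).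
Variables (e0 : 'I_N -> K) (e : 'I_m -> 'I_N -> K).
Variables (x0 : {mpoly K[N]}) (l : m.-tuple {mpoly K[N]}).

(* [x0, l] is a basis of linear forms and [e0, e] the dual basis of K^N. *)
Definition dual_frame :=
  [/\ x0 \is 1.-homog, forall j, tnth l j \is 1.-homog,
      x0.@[e0] = 1 /\ (forall j, x0.@[e j] = 0),
      (forall j, (tnth l j).@[e0] = 0) /\
        (forall j k, (tnth l j).@[e k] = (j == k)%:R) &
      forall i, 'X_i = e0 i *: x0 + \sum_j e j i *: tnth l j].

(* Coordinates with respect to a frame: a polynomial in the variable dual to
   [e0] over the polynomials in the variables dual to [e]. *)
Definition to_frame (p : {mpoly K[N]}) : {poly {mpoly K[m]}} :=
  mmap (polyC \o (@mpolyC m K))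
    (fun i => (e0 i)%:MP%:P * 'X + (\sum_j e j i *: 'X_j)%:P) p.

HB.instance Definition _ := GRing.RMorphism.copy to_frame
  (mmap (polyC \o (@mpolyC m K))
    (fun i => (e0 i)%:MP%:P * 'X + (\sum_j e j i *: 'X_j)%:P)).

Definition of_frame (P : {poly {mpoly K[m]}}) : {mpoly K[N]} :=
  (map_poly (comp_mpoly l) P).[x0].

HB.instance Definition _ := GRing.RMorphism.copy of_frame
  (horner_eval x0 \o map_poly (comp_mpoly l)).

Lemma to_frameC c : to_frame c%:MP = c%:MP%:P.
Proof. by rewrite /to_frame mmapC. Qed.

Lemma to_frameX i :
  to_frame 'X_i = (e0 i)%:MP%:P * 'X + (\sum_j e j i *: 'X_j)%:P.
Proof. by rewrite /to_frame mmapXU. Qed.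

Lemma to_frameZ c p : to_frame (c *: p) = c%:MP%:P * to_frame p.
Proof. exact: mmapZ. Qed.

Lemma of_frameC p : of_frame p%:P = p \mPo l.
Proof. by rewrite /of_frame map_polyC hornerC. Qed.

Lemma of_frameX : of_frame 'X = x0.
Proof. by rewrite /of_frame map_polyX hornerX. Qed.

Lemma to_frameB p q : to_frame (p - q) = to_frame p - to_frame q.
Proof. by pose f : {rmorphism _ -> _} := to_frame; apply: (rmorphB f). Qed.

Lemma of_frameB P Q : of_frame (P - Q) = of_frame P - of_frame Q.
Proof. by pose f : {rmorphism _ -> _} := of_frame; apply: (rmorphB f). Qed.

Lemma meval_to_frame p y s :
  (map_poly (meval y) (to_frame p)).[s] =
  p.@[fun i => s * e0 i + \sum_j y j * e j i].
Proof.
have := @mpoly_rmorph_ext K N _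
  (horner_eval s \o map_poly (meval y) \o to_frame)
  (meval (fun i => s * e0 i + \sum_j y j * e j i)).
apply=> [c|i] /=; rewrite /horner_eval.
  by rewrite to_frameC map_polyC hornerC /= !mevalC.
rewrite to_frameX rmorphD rmorphM /= !map_polyC map_polyX hornerMXaddC /=.
rewrite mevalC mevalXU hornerC mulrC raddf_sum; congr (_ + _).
by apply: eq_bigr => j _; rewrite /= mevalZ mevalXU mulrC.
Qed.

(** A form of degree [d] in ['X] and the base variables taken together. *)
Definition bihomog d (P : {poly {mpoly K[m]}}) :=
  (size P <= d.+1)%N /\ forall i, (i <= d)%N -> P`_i \is (d - i).-homog.

Lemma bihomog0 d : bihomog d 0.
Proof. by split=> [|i _]; rewrite ?size_poly0 // coef0 dhomog0. Qed.

Lemma bihomogC c : bihomog 0 c%:MP%:P.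
Proof.
split; first exact: size_polyC_leq1.
by case=> [|i] // _; rewrite coefC homogC.
Qed.

Lemma bihomog1 : bihomog 0 1.
Proof. by have := bihomogC 1; rewrite !rmorph1. Qed.

Lemma bihomogD d P Q : bihomog d P -> bihomog d Q -> bihomog d (P + Q).
Proof.
move=> [sP hP] [sQ hQ]; split=> [|i id].
  by rewrite (leq_trans (size_polyD _ _)) // geq_max sP.
by rewrite coefD rpredD ?hP ?hQ.
Qed.

Lemma bihomogM d k P Q :
  bihomog d P -> bihomog k Q -> bihomog (d + k) (P * Q).
Proof.
move=> [sP hP] [sQ hQ]; split=> [|i id].
  rewrite (leq_trans (size_polyMleq _ _)) // -subn1 leq_subLR add1n.
  by rewrite -addnS -addSn leq_add.
rewrite coefM; apply: rpred_sum => j _.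
have ji : (j <= i)%N by rewrite -ltnS.
case: (leqP j d) => [jd|jd]; last first.
  by rewrite nth_default ?mul0r ?dhomog0 // (leq_trans sP).
case: (leqP (i - j) k) => [ijk|ijk]; last first.
  by rewrite (nth_default 0 (leq_trans sQ ijk)) mulr0 dhomog0.
have -> : (d + k - i = (d - j) + (k - (i - j)))%N.
  by rewrite subnBA // addnBA ?leq_subr //; lia.
by apply: dhomogM; [apply: hP|apply: hQ].
Qed.

Lemma bihomog_to_frame d p : p \is d.-homog -> bihomog d (to_frame p).
Proof.
have hX1 i : bihomog 1 (to_frame 'X_i).
  rewrite to_frameX; split=> [|k].
    by rewrite size_MXaddC; case: ifP => // _; rewrite ltnS size_polyC_leq1.
  rewrite coefD mul_polyC coefZ coefX coefC.
  case: k => [|[|k]] // _; rewrite ?mulr0 ?mulr1.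
    rewrite add0r; apply: rpred_sum => j _; apply: dhomogZ.
    by rewrite dhomogX /= mdeg1.
  by rewrite addr0 homogC.
have hX mm : bihomog (mdeg mm) (to_frame 'X_[mm]).
  rewrite mpolyXE_id mdegE rmorph_prod /=.
  elim/big_rec2: _ => [|i k P _ hP]; first exact: bihomog1.
  apply: bihomogM => //.
  elim: (mm i) => [|a IH]; first by rewrite expr0 rmorph1; apply: bihomog1.
  by rewrite exprS (rmorphM to_frame); apply: (bihomogM (hX1 i) IH).
move=> hp; rewrite [p]mpolyE (rmorph_sum to_frame) /= big_seq.
elim/big_rec: _ => [|mm P hmm hP]; first exact: bihomog0.
apply: bihomogD => //; rewrite /= to_frameZ -[d]add0n -(dhomog_mf hp hmm).
by apply: bihomogM; [apply: bihomogC | apply: hX].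
Qed.

(** Only the top coefficient has degree 0. Setting the base variables to 0 and ['X] to 1, which is
    evaluation at [e0], kills all the others. *)
Lemma coef_top_to_frame d p :
  p \is d.-homog -> (to_frame p)`_d = (p.@[e0])%:MP.
Proof.
move=> hp; have [sb hb] := bihomog_to_frame hp.
have [c topE] : exists c, (to_frame p)`_d = c%:MP.
  have := hb d (leqnn d); rewrite subnn => /homog0_const ->.
  by exists ((to_frame p)`_d)@_0%MM.
rewrite topE; congr (_%:MP).
have := meval_to_frame p (fun _ => 0) 1.
rewrite (@meval_eq _ _ _ e0); last first.
  by move=> i; rewrite mul1r big1 ?addr0 // => j _; rewrite mul0r.
move=> <-; rewrite (@horner_coef_wide _ d.+1); last first.
  exact: leq_trans (size_poly _ _) sb.
rewrite big_ord_recr /= expr1n mulr1 coef_map /= topE mevalC.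
rewrite big1 ?add0r // => i _.
have := hb i (ltnW (ltn_ord i)); rewrite coef_map /= expr1n mulr1.
by move=> hh; apply: (homog_meval0 _ hh); rewrite ?subn_gt0.
Qed.

Hypothesis dualF : dual_frame.

Lemma to_frameK : cancel to_frame of_frame.
Proof.
case: dualF => _ _ _ _ XE.
apply: (@mpoly_rmorph_ext K N _ (of_frame \o to_frame) idfun) => [c|i] /=.
  by rewrite to_frameC of_frameC comp_mpolyC.
rewrite to_frameX rmorphD rmorphM /= !of_frameC of_frameX comp_mpolyC.
rewrite mul_mpolyC [in RHS]XE; congr (_ + _); rewrite raddf_sum.
by apply: eq_bigr => j _; rewrite /= comp_mpolyZ comp_mpolyXU -tnth_nth.
Qed.

Lemma to_frame_lin p : p \is 1.-homog ->
  to_frame p = (p.@[e0])%:MP%:P * 'X + (\sum_j p.@[e j] *: 'X_j)%:P.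
Proof.
move=> hp; have [c ->] : exists c : 'I_N -> K, p = \sum_i c i *: 'X_i.
  by exists (fun i => p@_U_(i)); apply: homog_lin.
rewrite (rmorph_sum to_frame) /=.
under eq_bigr => i _ do rewrite to_frameZ to_frameX mulrDr.
have ev x : (\sum_i c i *: 'X_i).@[x] = \sum_i c i * x i.
  by rewrite raddf_sum; apply: eq_bigr => i _; rewrite /= mevalZ mevalXU.
rewrite big_split /=; congr (_ + _).
  rewrite ev !rmorph_sum mulr_suml; apply: eq_bigr => i _ /=.
  by rewrite mulrA -!rmorphM.
under eq_bigr => i _ do rewrite -polyCM.
rewrite -rmorph_sum; congr (_%:P).
rewrite (eq_bigr (fun i => \sum_j c i *: (e j i *: 'X_j))); last first.
  by move=> i _; rewrite -scaler_sumr; apply: mul_mpolyC.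
rewrite exchange_big /=; apply: eq_bigr => j _.
by rewrite ev scaler_suml; apply: eq_bigr => i _ /=; rewrite scalerA.
Qed.

Lemma of_frameK : cancel of_frame to_frame.
Proof.
case: dualF => hx hl [x01 x0e] [l0 le] XE.
have x0E : to_frame x0 = 'X.
  rewrite to_frame_lin // x01 mul1r big1 ?addr0 // => j _.
  by rewrite x0e scale0r.
have lE j : to_frame (tnth l j) = ('X_j)%:P.
  rewrite to_frame_lin // l0 mpolyC0 polyC0 mul0r add0r; congr (_%:P).
  rewrite (bigD1 j) //= le eqxx scale1r big1 ?addr0 // => k kj.
  by rewrite le eq_sym (negbTE kj) scale0r.
have cE p : to_frame (p \mPo l) = p%:P.
  apply: (@mpoly_rmorph_ext K m _ (to_frame \o comp_mpoly l) polyC) => [c|i] /=.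
    by rewrite comp_mpolyC to_frameC.
  by rewrite comp_mpolyXU -tnth_nth lE.
move=> P; elim/poly_ind: P => [|P c IH]; first by rewrite !rmorph0.
by rewrite !rmorphD !rmorphM /= IH of_frameX x0E of_frameC cE.
Qed.

End Frames.

(* A predicate rather than [closedFieldType], whose many inheritance paths to the
   ring structures make unification very slow. *)
Definition alg_closed (K : fieldType) :=
  forall p : {poly K}, size p != 1%N -> exists x, root p x.

(** * Polynomials as functions over an algebraically closed field *)

Section Evaluation.

Variable K : fieldType.
Hypothesis Kclosed : alg_closed K.

(** An algebraically closed field has enough points: for [p] not constant, [p - 1] has a root, and
    [p] is 1 there. *)
Lemma poly_eq0_eval (p : {poly K}) : (forall x, p.[x] = 0) -> p = 0.
Proof.
move=> p0; have [/eqP/size_poly1P [c c0 pE]|s1] := eqVneq (size p) 1%N.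
  by have /eqP := p0 0; rewrite pE hornerC (negbTE c0).
apply/eqP; apply: contraT => pn0; have s2 : (1 < size p)%N.
  by rewrite ltn_neqAle eq_sym s1 size_poly_gt0.
have [|x] := Kclosed (p := p - 1).
  by rewrite size_polyDl ?size_polyN ?size_poly1 // gtn_eqF.
by rewrite rootE hornerD hornerN hornerC p0 sub0r oppr_eq0 oner_eq0.
Qed.

(** The vector [w] replaces the standard basis vector of index [i0]; the dual forms are corrected by
    multiples of ['X_i0]. *)
Lemma exists_frame N (w : 'I_N -> K) i0 : w i0 != 0 ->
  exists e x0 (l : N.-1.-tuple {mpoly K[N]}), dual_frame w e x0 l.
Proof.
case: N w i0 => [|m] w i0 w0; first by case: i0 w0.
exists (fun j i => (i == lift i0 j)%:R), ((w i0)^-1 *: 'X_i0).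
exists [tuple 'X_(lift i0 j) - (w (lift i0 j) / w i0) *: 'X_i0 | j < m].
have hX i : 'X_i \is [in K[m.+1], 1.-homog] by rewrite dhomogX /= mdeg1.
split=> [|j| | |i].
- exact: dhomogZ.
- by rewrite tnth_mktuple rpredB // dhomogZ.
- split=> [|j]; rewrite mevalZ mevalXU ?mulVf //.
  by rewrite (negbTE (neq_lift _ _)) mulr0.
- split=> [j|j k]; rewrite tnth_mktuple mevalB mevalZ !mevalXU.
    by rewrite divfK ?subrr.
  rewrite (negbTE (neq_lift i0 k)) mulr0 subr0 eq_sym (inj_eq lift_inj).
  by rewrite eq_sym.
- under eq_bigr do rewrite tnth_mktuple.
  rewrite scalerA; case: (unliftP i0 i) => [j ->|->].
    rewrite (bigD1 j) //= eqxx scale1r big1 ?addr0 => [|k kj].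
      by rewrite addrC subrK.
    by rewrite (inj_eq lift_inj) eq_sym (negbTE kj) scale0r.
  rewrite mulfV // scale1r big1 ?addr0 // => k _.
  by rewrite (negbTE (neq_lift _ _)) scale0r.
Qed.

(** Starting from any frame at [w], each [e j] is moved along [w] into the kernel of [x0]; the forms
    [l] vanish at [w], so they stay dual. *)
Lemma exists_dual_frame N (w : 'I_N -> K) (x0 : {mpoly K[N]}) :
  x0 \is 1.-homog -> x0.@[w] = 1 ->
  exists e (l : N.-1.-tuple {mpoly K[N]}), dual_frame w e x0 l.
Proof.
move=> hx x01.
have [i wi] : exists i, w i != 0.
  apply: contrapT => /forallNP h; move/eqP: x01.
  rewrite (homog_meval0 _ hx) // => [|i]; first by rewrite eq_sym oner_eq0.
  by apply/eqP/negPn/negP.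
have [e [x [l F]]] := exists_frame wi; case: (F) => hx' hl [_ _] [l0 le] XE.
have x0E : x0 = x + \sum_j x0.@[e j] *: tnth l j.
  rewrite -[LHS](to_frameK F) to_frame_lin // x01 rmorphD rmorphM /=.
  rewrite of_frameC comp_mpolyC of_frameX mpolyC1 mul1r of_frameC.
  rewrite (raddf_sum (comp_mpoly l)) /=; congr (_ + _); apply: eq_bigr => j _.
  by rewrite comp_mpolyZ comp_mpolyXU -tnth_nth.
have hlin (p : {mpoly K[N]}) j : p \is 1.-homog ->
    p.@[fun i => e j i - x0.@[e j] * w i] = p.@[e j] - x0.@[e j] * p.@[w].
  move=> /homog_lin ->; rewrite !(raddf_sum (meval _)) /= mulr_sumr -sumrB.
  by apply: eq_bigr => k _; rewrite !mevalZ !mevalXU; ring.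
exists (fun j i => e j i - x0.@[e j] * w i), l; split=> //.
- by split=> // j; rewrite hlin // x01 mulr1 subrr.
- by split=> // j k; rewrite hlin // l0 mulr0 subr0.
move=> k; have -> : w k *: x0 = w k *: x + \sum_j (w k * x0.@[e j]) *: tnth l j.
  rewrite {1}x0E scalerDr scaler_sumr; congr (_ + _).
  by apply: eq_bigr => j _; rewrite scalerA.
rewrite XE -addrA; congr (_ + _); rewrite -big_split /=; apply: eq_bigr => j _.
by rewrite -scalerDl; congr (_ *: _); ring.
Qed.

(** Induction on the number of variables: in a frame, [p] is a polynomial in one variable whose
    coefficients vanish at every point of a smaller space. *)
Lemma meval_eq0 N (p : {mpoly K[N]}) : (forall x, p.@[x] = 0) -> p = 0.
Proof.
elim: N p => [|m IH] p p0.
  by have := p0 (fun _ => 0); rewrite [p]nvar0_mpolyC mevalC => ->; rewrite mpolyC0.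
have [|e [x0 [l F]]] := @exists_frame m.+1 (fun _ => 1) ord0; first exact: oner_neq0.
rewrite -(to_frameK F p); set P := to_frame _ _ _; suff -> : P = 0 by rewrite rmorph0.
apply/polyP => k; rewrite coef0; apply: IH => y.
suff E : map_poly (meval y) P = 0.
  by rewrite -[LHS]/(meval y P`_k) -coef_map E coef0.
by apply: poly_eq0_eval => s; rewrite meval_to_frame.
Qed.

Lemma meval_inj N (p q : {mpoly K[N]}) : (forall x, p.@[x] = q.@[x]) -> p = q.
Proof.
move=> E; apply/eqP; rewrite -subr_eq0; apply/eqP/meval_eq0 => x.
by rewrite mevalB E subrr.
Qed.

Lemma size_to_frame N m (e0 : 'I_N -> K) (e : 'I_m -> 'I_N -> K) p d :
  (msize p <= d.+1)%N ->
  (size (to_frame e0 e p) <= d.+1)%N /\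
  (to_frame e0 e p)`_d = ((pihomog mdeg d p).@[e0])%:MP.
Proof.
move=> sp; rewrite {1 2}(pihomog_partitionE (mf := mdeg) sp).
have hb k := bihomog_to_frame e0 e (pihomogP mdeg k p).
split.
  rewrite (rmorph_sum (to_frame e0 e)); apply: leq_trans (size_sum _ _ _) _.
  apply/bigmax_leqP => i _; have [s _] := hb i.
  exact: leq_trans s (ltn_ord i).
have /= topE := coef_top_to_frame e0 e (pihomogP mdeg d p).
rewrite (rmorph_sum (to_frame e0 e)) coef_sum big_ord_recr /= -topE.
rewrite [X in X + _]big1 ?add0r // => i _.
have [s _] := hb i; apply: nth_default; exact: leq_trans s (ltn_ord i).
Qed.

(** Noether normalization: the direction [e0] is chosen where the homogeneous component of top
    degree does not vanish. *)
Lemma noether_frame N (p : {mpoly K[N]}) : (1 < msize p)%N ->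
  exists e0 e x0 (l : N.-1.-tuple {mpoly K[N]}), dual_frame e0 e x0 l /\
    exists2 c, c != 0 & lead_coef (to_frame e0 e p) = c%:MP.
Proof.
move=> s1; set d := (msize p).-1.
have d0 : (0 < d)%N by rewrite /d -subn1 subn_gt0.
have sE : msize p = d.+1 by rewrite prednK // ltnW.
have [w pw] : exists w, (pihomog mdeg d p).@[w] != 0.
  apply: contrapT => /forallNP h.
  have p0 : pihomog mdeg d p = 0 by apply: meval_eq0 => x; apply/eqP/negPn/negP.
  have pn0 : p != 0 by apply: contraTneq s1 => ->; rewrite mmeasure0.
  have /eqP := mlead_deg pn0; rewrite sE eqSS => /eqP dE.
  move: (mlead_supp pn0) dE; move: (mlead p) => mm.
  rewrite mcoeff_msupp => /eqP pmm dE; apply: pmm.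
  suff <- : (pihomog mdeg d p)@_mm = p@_mm by rewrite p0 mcoeff0.
  have pE : p = \sum_(i < d.+1) pihomog mdeg i p.
    by apply: pihomog_partitionE; rewrite sE.
  rewrite [in RHS]pE.
  rewrite big_ord_recr /= mcoeffD.
  suff -> : (\sum_(i < d) pihomog mdeg i p)@_mm = 0 by rewrite add0r.
  rewrite (raddf_sum (mcoeff mm)); apply: big1 => i _.
  apply: dhomog_nemf_coeff (pihomogP mdeg i p) _ => /=.
  by rewrite dE neq_ltn ltn_ord orbT.
have [i wi] : exists i, w i != 0.
  apply: contrapT => /forallNP h; move: pw => /negP[].
  rewrite (homog_meval0 d0 (pihomogP mdeg d p)) // => i.
  by have /negP/negPn/eqP := h i.
have [e [x0 [l F]]] := exists_frame wi; exists w, e, x0, l; split=> //.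
have [|s t] := @size_to_frame _ _ w e p d; first by rewrite sE.
exists (pihomog mdeg d p).@[w] => //.
suff sP : size (to_frame w e p) = d.+1 by rewrite lead_coefE sP.
apply/eqP; rewrite eqn_leq s /= ltnNge; apply: contraNN pw => sd.
by rewrite -(mpolyC_eq0 N.-1) -t nth_default.
Qed.


End Evaluation.

(** * Normality of hypersurfaces *)


Section MonicDivision.

Lemma nat_min (P : nat -> Prop) :
  (exists n, P n) -> exists2 n, P n & forall m, P m -> (n <= m)%N.
Proof.
move=> [n Pn]; have ex : exists n, `[< P n >] by exists n; apply/asboolP.
case: (ex_minnP ex) => m /asboolP Pm mmin; exists m => // k Pk.
by apply: mmin; apply/asboolP.
Qed.

(** Dividing [q] by [D] leaves [D (p - r s) = r w] with [w] of smaller degree than [D], and degrees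
    force [p = r s]. In other words [D] is regular modulo the constant [r]. *)
Lemma monic_regular (A : idomainType) (r : A) (D p q : {poly A}) :
  D \is monic -> D * p = r%:P * q -> exists z, p = r%:P * z.
Proof.
move=> Dm E; pose s := rdivp q D; pose w := rmodp q D.
have qE : q = s * D + w := Pdiv.RingMonic.rdivp_eq Dm q.
have ws : (size w < size D)%N by rewrite ltn_rmodpN0 // monic_neq0.
exists s; apply/eqP; rewrite -subr_eq0; apply: contraTT ws => ne.
have {}E : D * (p - r%:P * s) = r%:P * w by rewrite mulrBr E qE; ring.
rewrite -leqNgt (@leq_trans (size (r%:P * w))) //; last first.
  by rewrite mul_polyC size_scale_leq.
rewrite -E size_monicM // -subn1 -addnBA ?leq_addr //.
by rewrite lt0n size_poly_eq0.
Qed.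

End MonicDivision.

(** * Dedekind's criterion over polynomials in one variable *)

Section Dedekind.

Variables (k E : fieldType) (theta : {rmorphism {poly {poly k}} -> E}).
Variable (F : {poly {poly k}}).
Hypotheses (Fm : F \is monic) (thF : theta F = 0).
Hypothesis kerF : forall p, theta p = 0 -> exists q, p = q * F.

Local Notation S x := (exists p, theta p = x).

Let S0 : S 0. Proof. by exists 0; rewrite rmorph0. Qed.

Let SD x y : S x -> S y -> S (x + y).
Proof. by move=> [p <-] [q <-]; exists (p + q); rewrite rmorphD. Qed.

Let SM p x : S x -> S (theta p * x).
Proof. by move=> [q <-]; exists (p * q); rewrite rmorphM. Qed.

Let SB x y : S x -> S y -> S (x - y).
Proof. by move=> [p <-] [q <-]; exists (p - q); rewrite rmorphB. Qed.

(* Kummer-Dedekind: when [u] is integral over the image of [theta] without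
   belonging to it, some multiple of [u] has for conductor a prime ideal which
   is generated by two elements and over which [F] is singular. *)
Lemma dedekind u (D : {poly k}) :
  ~ S u -> D != 0 -> S (theta D%:P * u) -> integralOver theta u ->
  exists b, let u2 := theta b * u in
  [/\ ~ S u2,
      forall x y, S (theta (x * y) * u2) -> S (theta x * u2) \/ S (theta y * u2) &
      exists c p1 q1 p2 q2,
        [/\ ~ S (theta c * u2),
            S (theta p1 * u2) /\ S (theta q1 * u2),
            S (theta p2 * u2) /\ S (theta q2 * u2) &
            c * F = p1 * q1 - p2 * q2]].
Proof.
move=> nSu D0 SDu [P Pm /rootP Pu].
(* First choice: a multiple of [u] outside the ring that a base polynomial [pi] of least possible
   degree multiplies into it. Minimality makes [pi] coprime to every nonzero polynomial of smaller
   degree. *)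
pose Ppi s := exists D b, [/\ D != 0 :> {poly k}, ~ S (theta b * u),
  S (theta D%:P * (theta b * u)) & size D = s].
have [|s0 [pi [b0 [pi0 nSb0 Spib0 <-]]] minpi] := @nat_min Ppi.
  by exists (size D), D, 1; rewrite rmorph1 mul1r.
have {}minpi D' b : D' != 0 -> ~ S (theta b * u) ->
    S (theta D'%:P * (theta b * u)) -> (size pi <= size D')%N.
  by move=> *; apply: minpi; exists D', b.
(* Second choice, with [pi] fixed: a monic [H] of least degree multiplying some such multiple into
   the ring. [F] is a candidate, as it maps to 0. *)
pose PH s := exists H b, [/\ H \is monic, ~ S (theta b * u),
  S (theta pi%:P * (theta b * u)), S (theta H * (theta b * u)) & size H = s].
have [|s1 [H [b [Hm nSb Spib SHb <-]]] minH] := @nat_min PH.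
  by exists (size F), F, b0; split=> //; rewrite thF mul0r.
have {}minH H' b' : H' \is monic -> ~ S (theta b' * u) ->
    S (theta pi%:P * (theta b' * u)) -> S (theta H' * (theta b' * u)) ->
    (size H <= size H')%N.
  by move=> *; apply: minH; exists H', b'.
set u2 := theta b * u in Spib SHb nSb.
have cop (lam : {poly k}) : lam != 0 -> (size lam < size pi)%N -> coprimep lam pi.
  move=> lam0 slam; rewrite /coprimep; set g := gcdp lam pi.
  have g0 : g != 0 by rewrite gcdp_eq0 negb_and lam0.
  have gpi : g %| pi := dvdp_gcdr lam pi.
  have sg : (size g < size pi)%N.
    by apply: leq_ltn_trans slam; rewrite dvdp_leq // dvdp_gcdl.
  apply: contraT => sg1; have sg2 : (1 < size g)%N.
    by rewrite ltn_neqAle eq_sym sg1 lt0n size_poly_eq0.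
  have piE := divpK gpi.
  have pg0 : pi %/ g != 0 by apply: contraNneq pi0 => pg; rewrite -piE pg mul0r.
  have spg : (size (pi %/ g)%R < size pi)%N.
    have := size_mul pg0 g0; rewrite piE => ->.
    by case: (size g) sg2 => [|[|n]] // _; rewrite !addnS /= ltnS leq_addr.
  have [Sg|nSg] := pselect (S (theta g%:P * u2)).
    by have := minpi g b g0 nSb Sg; rewrite leqNgt sg.
  have := minpi (pi %/ g) (g%:P * b) pg0; rewrite rmorphM -mulrA => /(_ nSg).
  rewrite mulrA -rmorphM -polyCM piE => /(_ Spib).
  by rewrite leqNgt spg.
(* Divide [p] by [H] and reduce the coefficients of the remainder modulo [pi]. If something is left,
   Bezout modulo [pi] makes its leading coefficient 1, which contradicts the minimality of [H]. *)
have gen c : ~ S (theta c * u2) -> forall p, S (theta (p * c) * u2) ->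
    exists al be, p = al * pi%:P + be * H.
  move=> nSc p Sp; pose q := rdivp p H; pose r := rmodp p H.
  have pE : p = q * H + r := Pdiv.RingMonic.rdivp_eq Hm p.
  have sr : (size r < size H)%N by rewrite ltn_rmodpN0 // monic_neq0.
  have Sr : S (theta (r * c) * u2).
    have -> : theta (r * c) * u2 =
        theta (p * c) * u2 - theta (q * c) * (theta H * u2).
      by rewrite pE !(rmorphM, rmorphD); ring.
    by apply: SB => //; apply: SM.
  pose r1 := \poly_(i < size r) (r`_i %% pi).
  pose r2 := \poly_(i < size r) (r`_i %/ pi).
  have rE : r = r2 * pi%:P + r1.
    apply/polyP => i; rewrite coefD coefMC !coef_poly; case: ltnP => ir.
      exact: divp_eq.
    by rewrite nth_default // mul0r addr0.
  have [r10|r10] := eqVneq r1 0.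
    by exists r2, q; rewrite pE rE r10; ring.
  have sr1 : (size r1 < size H)%N by apply: leq_ltn_trans sr; apply: size_poly.
  set e := (size r1).-1; set lam := lead_coef r1.
  have lam0 : lam != 0 by rewrite lead_coef_eq0.
  have slam : (size lam < size pi)%N.
    rewrite /lam lead_coefE coef_poly; case: ifP => _.
      by rewrite ltn_modp.
    by rewrite size_poly0 lt0n size_poly_eq0.
  have /Bezout_eq1_coprimepP [[al be] /= ab] := cop _ lam0 slam.
  pose H' := al%:P * r1 + (be * pi)%:P * 'X^e.
  have se : size r1 = e.+1 by rewrite prednK // lt0n size_poly_eq0.
  have He : H'`_e = 1 by rewrite coefD !coefCM coefXn eqxx mulr1 -ab.
  have sH' : size H' = e.+1.
    apply/eqP; rewrite eqn_leq; apply/andP; split; last first.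
      rewrite ltnNge; apply/negP => sH; move: He.
      by rewrite nth_default // => /eqP; rewrite eq_sym oner_eq0.
    rewrite (leq_trans (size_polyD _ _)) // geq_max !mul_polyC.
    rewrite (leq_trans (size_scale_leq _ _)) ?se //.
    by rewrite (leq_trans (size_scale_leq _ _)) ?size_polyXn.
  have H'm : H' \is monic by rewrite monicE lead_coefE sH' He.
  have := minH H' (c * b) H'm; rewrite rmorphM -mulrA -/u2 => /(_ nSc).
  rewrite mulrCA => /(_ (SM _ Spib)) hh.
  have : (size H <= size H')%N.
    apply: hh; rewrite mulrA -rmorphM.
    have -> : H' * c = al%:P * (r * c) - (al%:P * r2 * c) * pi%:P
        + (be%:P * 'X^e * c) * pi%:P.
      rewrite /H' rE polyCM; move: al%:P be%:P pi%:P 'X^e => x1 x2 x3 x4.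
      by ring.
    rewrite rmorphD rmorphB !(rmorphM theta _ pi%:P) (rmorphM theta _ (r * c)).
    rewrite mulrDl mulrBl -!mulrA.
    by apply: SD; [apply: SB|]; apply: SM.
  by rewrite sH' -se leqNgt sr1.
have prime x y : S (theta (x * y) * u2) -> S (theta x * u2) \/ S (theta y * u2).
  move=> Sxy; have [Sy|nSy] := pselect (S (theta y * u2)); [by right|left].
  have [al [be ->]] := gen y nSy x Sxy.
  by rewrite rmorphD !rmorphM mulrDl -!mulrA; apply: SD; apply: SM.
(* The integral equation of [u] puts a power of [s] in the conductor, and primality brings the
   exponent down to 1. *)
have integ p s : S (theta p * u2) -> theta s = theta p * u2 -> S (theta s * u2).
  move=> _ sE; set n := (size P).-1.
  have sP : size P = n.+1 by rewrite prednK // lt0n size_poly_eq0 monic_neq0.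
  have Pu' : u ^+ n = - \sum_(i < n) theta P`_i * u ^+ i.
    apply/eqP; rewrite -addr_eq0 addrC; apply/eqP; rewrite -[RHS]Pu.
    rewrite (@horner_coef_wide _ n.+1) -?sP ?size_poly // sP big_ord_recr /=.
    have -> : (map_poly theta P)`_n = 1.
      rewrite coef_map /=; suff -> : P`_n = 1 by rewrite rmorph1.
      by move: Pm; rewrite monicE lead_coefE => /eqP.
    by rewrite mul1r; congr (_ + _); apply: eq_bigr => i _; rewrite coef_map.
  have n0 : (0 < n)%N.
    rewrite lt0n; apply/eqP => n0; move: Pu'; rewrite n0 big_ord0 oppr0 expr0.
    by move/eqP; rewrite oner_eq0.
  have sE' : theta s = theta (p * b) * u by rewrite sE rmorphM mulrA.
  have key : S (theta (s ^+ n.-1) * u2).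
    suff Su : S (theta (s ^+ n.-1) * u) by rewrite /u2 mulrCA; apply: SM.
    have -> : theta (s ^+ n.-1) * u = theta ((p * b) ^+ n.-1) * u ^+ n.
      by rewrite !rmorphXn sE' -[in RHS](prednK n0) exprSr mulrA -exprMn.
    rewrite Pu' mulrN -mulNr -rmorphN mulr_sumr.
    elim/big_ind: _ => // i _.
    have -> : n.-1 = (i + (n.-1 - i))%N.
      by rewrite subnKC // -ltnS prednK.
    have -> : theta (- (p * b) ^+ (i + (n.-1 - i))) * (theta P`_i * u ^+ i) =
      theta (- ((p * b) ^+ (n.-1 - i) * P`_i)) * theta (s ^+ i).
      rewrite !rmorphN (rmorphM theta _ P`_i) !rmorphXn sE' exprD exprMn.
      move: (theta (p * b) ^+ i) (theta (p * b) ^+ _) (theta P`_i) (u ^+ i).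
      by move=> x1 x2 x3 x4; ring.
    by apply: SM; exists (s ^+ i).
  elim: n.-1 key => [|j IH]; first by rewrite expr0 rmorph1 mul1r.
  by rewrite exprS => /prime [//|/IH].
have [g gE] := Spib; have [h hE] := SHb.
have Sg := integ _ _ Spib gE; have Sh := integ _ _ SHb hE.
(* Both [H g] and [pi h] represent [pi H u2], so they differ by a multiple of [F]. The four factors
   lie in the conductor. *)
have [|c cE] := kerF (p := H * g - pi%:P * h).
  by rewrite rmorphB !rmorphM gE hE; ring.
exists b; split=> //; exists c, H, g, pi%:P, h; split=> //.
(* Otherwise [c] and [F] would both be combinations of [pi] and [H]; since [H] is regular modulo
   [pi], the relation could be divided by [pi], and [u2] would be in the ring. *)
move=> Sc; apply: (nSb).
have nS1 : ~ S (theta 1 * u2) by rewrite rmorph1 mul1r.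
have [|c2 [c1 c12]] := gen 1 nS1 c; first by rewrite mulr1.
have [|be [al abE]] := gen 1 nS1 F; first by rewrite mulr1 thF mul0r.
have [|z zE] := @monic_regular _ pi H (g - c * al) (h + c * be) Hm.
  apply/eqP; rewrite -subr_eq0; apply/eqP.
  have -> : H * (g - c * al) - pi%:P * (h + c * be) =
    (H * g - pi%:P * h) - c * (be * pi%:P + al * H) by ring.
  by rewrite cE -abE subrr.
have thpi : theta pi%:P != 0.
  apply/eqP => /kerF [q qE].
  have q0 : q != 0.
    by apply: contraNneq pi0 => q0; move: qE; rewrite q0 mul0r => /eqP; rewrite polyC_eq0.
  have := size_polyC_leq1 pi; rewrite qE size_Mmonic //.
  have sF : (1 < size F)%N.
    rewrite ltn_neqAle lt0n size_poly_eq0 monic_neq0 // andbT eq_sym.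
    apply/negP => /size_poly1P [a a0 Fa]; move: Fm thF; rewrite Fa monicE lead_coefC.
    by move=> /eqP -> /eqP; rewrite rmorph1 oner_eq0.
  move: sF q0; rewrite -size_poly_gt0; case: (size q) (size F) => [|a] [|[|a']] //=.
  by rewrite !addnS.
have thF' : theta al * theta H = - (theta be * theta pi%:P).
  by apply/eqP; rewrite -addr_eq0 -!rmorphM -rmorphD addrC -abE thF.
have gE' : theta pi%:P * u2 = theta c * theta al + theta pi%:P * theta z.
  by rewrite -gE -!rmorphM -rmorphD -zE addrC subrK.
exists (c2 * al - c1 * be + z).
apply: (mulfI thpi); rewrite gE' c12 !(rmorphD, rmorphB, rmorphM).
have -> : (theta c2 * theta pi%:P + theta c1 * theta H) * theta al =
  theta c2 * theta pi%:P * theta al + theta c1 * (theta al * theta H) by ring.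
by rewrite thF'; ring.
Qed.

End Dedekind.

Section Subfields.

Variables (E : fieldType) (P : {pred E}).

(** An alias mentioning the closure proof, so that an arbitrary predicate can carry the algebraic
    structures. *)
Definition subfield_pred (clo : divring_closed P) : {pred E} := P.

HB.instance Definition _ clo :=
  GRing.isDivringClosed.Build E (subfield_pred clo) clo.

Record subfield_of (clo : divring_closed P) :=
  SubfieldOf { subfield_val : E; _ : subfield_val \in subfield_pred clo }.

HB.instance Definition _ clo := [isSub for @subfield_val clo].
HB.instance Definition _ clo := [Choice of subfield_of clo by <:].
HB.instance Definition _ clo :=
  [SubChoice_isSubIntegralDomain of subfield_of clo by <:].
HB.instance Definition _ clo :=
  [SubIntegralDomain_isSubField of subfield_of clo by <:].

End Subfields.

Section MonicQuotient.

Variables (R : idomainType) (E : fieldType) (theta : {rmorphism {poly R} -> E}).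
Variable (F : {poly R}).
Hypotheses (Fm : F \is monic) (thF : theta F = 0).
Hypothesis kerF : forall p, theta p = 0 -> exists q, p = q * F.

Local Notation S x := (exists p, theta p = x).

Lemma quotient_const_neq0 c : c != 0 -> theta c%:P != 0.
Proof.
move=> c0; apply/eqP => /kerF [q qE].
have q0 : q != 0.
  by apply: contraNneq c0 => q0; move: qE; rewrite q0 mul0r => /eqP; rewrite polyC_eq0.
have := size_polyC_leq1 c; rewrite qE size_Mmonic //.
have sF : (1 < size F)%N.
  rewrite ltn_neqAle lt0n size_poly_eq0 monic_neq0 // andbT eq_sym.
  apply/negP => /size_poly1P [a a0 Fa]; move: Fm thF; rewrite Fa monicE lead_coefC.
  by move=> /eqP -> /eqP; rewrite rmorph1 oner_eq0.
move: sF q0; rewrite -size_poly_gt0; case: (size q) (size F) => [|a] [|[|a']] //=.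
by rewrite !addnS.
Qed.

Lemma quotient_small p : theta p = 0 -> (size p < size F)%N -> p = 0.
Proof.
move=> /kerF [q ->]; have [->|q0] := eqVneq q 0; first by rewrite mul0r.
rewrite size_Mmonic // ltnNge -subn1 -addnBAC ?size_poly_gt0 //.
by rewrite leq_addl.
Qed.

Lemma quotient_mod p : theta (rmodp p F) = theta p.
Proof.
by rewrite [in RHS](Pdiv.RingMonic.rdivp_eq Fm p) rmorphD rmorphM thF mulr0 add0r.
Qed.

(* The quotient is free over [R], so a fraction with two coprime denominators
   belongs to it. *)
Lemma regular_mem (p1 p2 : R) u : p1 != 0 ->
  (forall al be, p2 * al = p1 * be -> exists ga, al = p1 * ga) ->
  S (theta p1%:P * u) -> S (theta p2%:P * u) -> S u.
Proof.
move=> p10 reg [a aE] [b bE]; pose A := rmodp a F; pose B := rmodp b F.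
have sm (q : {poly R}) (c : R) : (size (c%:P * rmodp q F)%R < size F)%N.
  by rewrite mul_polyC (leq_ltn_trans (size_scale_leq _ _)) // ltn_rmodpN0 // monic_neq0.
have AB : p2%:P * A = p1%:P * B.
  apply/eqP; rewrite -subr_eq0; apply/eqP; apply: quotient_small.
    by rewrite rmorphB !rmorphM !quotient_mod aE bE; ring.
  by rewrite (leq_ltn_trans (size_polyD _ _)) // gtn_max size_polyN !sm.
have ex i : exists ga, A`_i = p1 * ga.
  by apply: (reg _ B`_i); rewrite -!coefCM AB.
have [ga gaE] := choice ex.
have AE : A = p1%:P * \poly_(i < size A) ga i.
  apply/polyP => i; rewrite coefCM coef_poly; case: ltnP => // h.
  by rewrite nth_default // mulr0.
exists (\poly_(i < size A) ga i); apply: (mulfI (quotient_const_neq0 p10)).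
by rewrite -rmorphM -AE quotient_mod.
Qed.

Lemma horner_theta (Q : {poly R}) : (map_poly (theta \o polyC) Q).[theta 'X] = theta Q.
Proof.
elim/poly_ind: Q => [|Q c IH]; first by rewrite !rmorph0 horner0.
by rewrite rmorphD rmorphM /= map_polyX map_polyC hornerMXaddC IH rmorphD rmorphM.
Qed.

(** In an equation of least degree for [theta h] over [R], the constant term is nonzero and a
    multiple of [theta h]; it does duty for the norm. *)
Lemma norm_elt h : theta h != 0 ->
  exists2 D : R, D != 0 & exists c, theta D%:P = theta h * theta c.
Proof.
move=> h0; have [P Pm /rootP Ph] : integralOver (theta \o polyC) (theta h).
  rewrite -horner_theta; apply: integral_horner.
    by apply/integral_poly => i; rewrite coef_map; apply: integral_id.
  by exists F => //; apply/rootP; rewrite horner_theta.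
pose Q s := exists q : {poly R}, [/\ q != 0,
  (map_poly (theta \o polyC) q).[theta h] = 0 & size q = s].
have [|s [q [q0 qh <-]] qmin] := @nat_min Q.
  by exists (size P), P; rewrite monic_neq0.
move: q0 qh qmin; elim/poly_ind: q => [|q c _]; first by rewrite eqxx.
move=> qc0; rewrite rmorphD rmorphM /= map_polyX map_polyC hornerMXaddC /= => qh qmin.
have c0 : c != 0.
  apply: contraNneq qc0 => c0; move: qh; rewrite c0 rmorph0 addr0 => /eqP.
  rewrite mulf_eq0 (negbTE h0) orbF => /eqP qh.
  have [->|q0] := eqVneq q 0; first by rewrite mul0r addr0.
  have := qmin (size q) (ex_intro _ q (And3 q0 qh erefl)).
  by rewrite c0 addr0 size_mulX // ltnn.
exists c => //; exists (- (map_poly polyC q).[h]).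
rewrite rmorphN mulrN -horner_map -map_poly_comp mulrC.
by apply/eqP; rewrite -addr_eq0 addrC qh.
Qed.

End MonicQuotient.

(** * Dedekind's criterion over the fraction field of the coefficients *)

Section FractionDedekind.

Variables (A : idomainType) (E : fieldType).
Variables (theta : {rmorphism {poly {poly A}} -> E}) (F : {poly {poly A}}).
Hypotheses (Fm : F \is monic) (thF : theta F = 0).
Hypothesis kerF : forall p, theta p = 0 -> exists q, p = q * F.

Let eps : {rmorphism A -> E} := theta \o polyC \o polyC.

Let eps0 a : a != 0 -> eps a != 0.
Proof. by move=> a0; apply: (quotient_const_neq0 Fm thF kerF); rewrite polyC_eq0. Qed.

(** The fraction field of [A], realized inside [E] so that [theta] extends to it by evaluation. *)
Let kpred : {pred E} := fun x => `[< exists a b, b != 0 /\ x = eps a / eps b >].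

Let kclosed : divring_closed kpred.
Proof.
split=> [|x y /asboolP [a [b [b0 ->]]] /asboolP [a' [b' [b'0 ->]]]
         |x y /asboolP [a [b [b0 ->]]] /asboolP [a' [b' [b'0 ->]]]]; apply/asboolP.
- by exists 1, 1; rewrite oner_neq0 !rmorph1 divr1.
- exists (a * b' - a' * b), (b * b'); rewrite mulf_neq0 //; split=> //.
  rewrite rmorphB !rmorphM; field; by rewrite !eps0.
- have [->|a'0] := eqVneq a' 0.
    by exists 0, 1; rewrite oner_neq0 !rmorph0 !mul0r invr0 mulr0.
  exists (a * b'), (b * a'); rewrite mulf_neq0 //; split=> //.
  rewrite !rmorphM; field; by rewrite !eps0.
Qed.

Local Notation k := (subfield_of kclosed).

Let incl_subproof a : eps a \in subfield_pred kclosed.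
Proof. by apply/asboolP; exists a, 1; rewrite oner_neq0 rmorph1 divr1. Qed.

Definition fincl (a : A) : k := SubfieldOf (incl_subproof a).

Fact fincl_zmod : zmod_morphism fincl.
Proof. by move=> a b; apply: val_inj; rewrite /= !rmorphB. Qed.

Fact fincl_monoid : monoid_morphism fincl.
Proof. by split=> [|a b]; apply: val_inj; rewrite /= ?rmorph1 ?rmorphM. Qed.

HB.instance Definition _ := GRing.isZmodMorphism.Build A k fincl fincl_zmod.
HB.instance Definition _ := GRing.isMonoidMorphism.Build A k fincl fincl_monoid.

Let lift : {rmorphism {poly {poly A}} -> {poly {poly k}}} :=
  map_poly (map_poly fincl).

Let ev1 : {rmorphism {poly k} -> E} :=
  horner_eval (theta ('X)%:P) \o map_poly (val : k -> E).

Let thk : {rmorphism {poly {poly k}} -> E} :=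
  horner_eval (theta 'X) \o map_poly ev1.

Let fincl_inj : injective fincl.
Proof.
move=> a b ab; apply/eqP; rewrite -subr_eq0; apply: contraT => /eps0.
by rewrite rmorphB; have /(congr1 val)/= -> := ab; rewrite subrr eqxx.
Qed.

Let fincl_neq0 a : a != 0 -> fincl a != 0.
Proof. by rewrite -(rmorph0 fincl) (inj_eq fincl_inj). Qed.

Let liftX : lift 'X = 'X. Proof. exact: map_polyX. Qed.

Let liftC q : lift q%:P = (map_poly fincl q)%:P. Proof. exact: map_polyC. Qed.

Let thkX : thk 'X = theta 'X.
Proof. by rewrite -[LHS]/((map_poly ev1 'X).[theta 'X]) map_polyX hornerX. Qed.

Let thkP q : thk q%:P = ev1 q.
Proof. by rewrite -[LHS]/((map_poly ev1 q%:P).[theta 'X]) map_polyC hornerC. Qed.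

Let ev1_lift q : ev1 (map_poly fincl q) = theta q%:P.
Proof.
rewrite -[LHS]/((map_poly (val : k -> E) (map_poly fincl q)).[theta ('X)%:P]).
rewrite -map_poly_comp (eq_map_poly (g := eps)); last by [].
elim/poly_ind: q => [|q a IH]; first by rewrite !rmorph0 horner0.
have eX : (map_poly eps : {rmorphism _ -> _}) 'X = 'X by apply: map_polyX.
have eC c : (map_poly eps : {rmorphism _ -> _}) c%:P = (eps c)%:P by apply: map_polyC.
rewrite (rmorphD (map_poly eps)) (rmorphM (map_poly eps)) eX eC.
by rewrite hornerMXaddC IH polyCD polyCM rmorphD rmorphM.
Qed.

Let thk_lift p : thk (lift p) = theta p.
Proof.
elim/poly_ind: p => [|p q IH]; first by rewrite !rmorph0.
rewrite (rmorphD lift) (rmorphM lift) (rmorphD thk) (rmorphM thk).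
by rewrite liftX liftC thkX IH rmorphD rmorphM thkP ev1_lift.
Qed.

Let liftCC a : lift a%:P%:P = (fincl a)%:P%:P.
Proof. by rewrite liftC map_polyC. Qed.

Let finclK r : r != 0 -> (fincl r)^-1%:P%:P * (fincl r)%:P%:P = 1.
Proof.
by move=> r0; rewrite -polyCM -polyCM mulVf ?fincl_neq0.
Qed.

Let clear0 (x : k) : exists2 r, r != 0 & exists a, fincl a = fincl r * x.
Proof.
case: x => x px; have /asboolP [a [b [b0 xE]]] := px; exists b => //; exists a.
by apply: val_inj; rewrite /= xE mulrCA mulfV ?mulr1 // eps0.
Qed.

Let clear1 (q : {poly k}) : exists2 r, r != 0 &
  exists q', map_poly fincl q' = (fincl r)%:P * q.
Proof.
elim/poly_ind: q => [|q c [r r0 [q' q'E]]].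
  by exists 1; rewrite ?oner_neq0 //; exists 0; rewrite rmorph0 mulr0.
have [s s0 [a aE]] := clear0 c.
exists (r * s); rewrite ?mulf_neq0 //; exists (s%:P * q' * 'X + (r * a)%:P).
rewrite !(rmorphD, rmorphM) /= map_polyX !map_polyC /= q'E aE !polyCM.
by ring.
Qed.

Let clear2 (q : {poly {poly k}}) : exists2 r, r != 0 &
  exists q', lift q' = (fincl r)%:P%:P * q.
Proof.
elim/poly_ind: q => [|q c [r r0 [q' q'E]]].
  by exists 1; rewrite ?oner_neq0 //; exists 0; rewrite rmorph0 mulr0.
have [s s0 [a aE]] := clear1 c.
exists (r * s); rewrite ?mulf_neq0 //; exists (s%:P%:P * q' * 'X + (r%:P * a)%:P).
rewrite (rmorphD lift) !(rmorphM lift) liftX liftCC liftC q'E.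
rewrite (rmorphM (map_poly fincl)) /= map_polyC /= aE (rmorphM fincl) !polyCM.
by move: 'X (fincl r)%:P%:P (fincl s)%:P%:P c%:P => x1 x2 x3 x5; ring.
Qed.

Let lift_inj : injective lift.
Proof. by apply: map_inj_poly; [apply: map_inj_poly|]; rewrite ?rmorph0. Qed.

Let thkC a : thk (fincl a)%:P%:P = eps a.
Proof. by rewrite -liftCC thk_lift. Qed.

Local Notation Sk x := (exists2 r, r != 0 & exists p, theta p = eps r * x).

(** [Sk] is membership in the ring after constants are inverted. Inverting them does not absorb [u]:
    a constant denominator and the monic [D] satisfy the hypotheses of [regular_mem]. The relation
    found over the fraction field is multiplied by all its denominators. *)
Lemma fraction_dedekind u (D : {poly A}) : D \is monic ->
  ~ (exists p, theta p = u) -> (exists p, theta p = theta D%:P * u) ->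
  integralOver theta u ->
  exists u2, [/\ ~ Sk u2,
    forall x y, Sk (theta (x * y) * u2) -> Sk (theta x * u2) \/ Sk (theta y * u2) &
    exists c p1 q1 p2 q2,
        [/\ ~ Sk (theta c * u2),
            Sk (theta p1 * u2) /\ Sk (theta q1 * u2),
            Sk (theta p2 * u2) /\ Sk (theta q2 * u2) &
            c * F = p1 * q1 - p2 * q2]].
Proof.
move=> Dm nSu SDu [P Pm /rootP Pu].
have SkP x : Sk x <-> exists p, thk p = x.
  split=> [[r r0 [p pE]]|[p <-]].
    exists ((fincl r)^-1%:P%:P * lift p); rewrite rmorphM thk_lift pE mulrA.
    by rewrite -thkC -(rmorphM thk) (finclK r0) rmorph1 mul1r.
  have [r r0 [q qE]] := clear2 p; exists r => //; exists q.
  by rewrite -thk_lift qE rmorphM thkC.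
have kerk p : thk p = 0 -> exists q, p = q * lift F.
  move=> p0; have [r r0 [q qE]] := clear2 p.
  have [|s sE] := kerF (p := q); first by rewrite -thk_lift qE rmorphM p0 mulr0.
  exists ((fincl r)^-1%:P%:P * lift s); rewrite -mulrA -(rmorphM lift) -sE qE.
  by rewrite mulrA (finclK r0) mul1r.
have [|||||| b [nS prime [c [p1 [q1 [p2 [q2 [nc [Sp1 Sq1] [Sp2 Sq2] cE]]]]]]]] :=
  @dedekind k E thk (lift F) _ _ kerk u (map_poly fincl D).
- by apply: monic_map.
- by rewrite thk_lift.
- move=> /SkP [r r0 Sr]; apply: nSu.
  apply: (regular_mem Fm thF kerF (p1 := r%:P) (p2 := D)) => //.
    by rewrite polyC_eq0.
  by move=> al be; apply: monic_regular.
- by rewrite monic_neq0 // monic_map.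
- have [p pE] := SDu; exists (lift p); rewrite thk_lift pE -thk_lift.
  by rewrite liftC.
- exists (map_poly lift P); first exact: monic_map.
  rewrite -map_poly_comp (eq_map_poly (g := theta)); first exact/rootP.
  by move=> p /=; rewrite -[RHS]thk_lift.
set u2 := thk b * u in nS prime nc Sp1 Sq1 Sp2 Sq2; exists u2.
have KE p r q : lift q = (fincl r)%:P%:P * p -> r != 0 ->
    (exists z, thk z = thk p * u2) <-> Sk (theta q * u2).
  move=> qE r0; rewrite SkP -thk_lift qE rmorphM -mulrA; split=> [[z <-]|[z zE]].
    by exists ((fincl r)%:P%:P * z); rewrite rmorphM.
  exists ((fincl r)^-1%:P%:P * z); rewrite rmorphM zE mulrA -(rmorphM thk).
  by rewrite (finclK r0) rmorph1 mul1r.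
split.
- by move=> /SkP.
- move=> x y; rewrite !SkP -!thk_lift rmorphM; exact: prime.
have [rc rc0 [c' c'E]] := clear2 c.
have [r1 r10 [p1' p1'E]] := clear2 p1; have [s1 s10 [q1' q1'E]] := clear2 q1.
have [r2 r20 [p2' p2'E]] := clear2 p2; have [s2 s20 [q2' q2'E]] := clear2 q2.
have SkM a x : Sk x -> Sk (theta a * x).
  by move=> [r r0 [p pE]]; exists r => //; exists (a * p); rewrite rmorphM pE mulrCA.
pose C a : {poly {poly A}} := a%:P%:P.
exists (C (r1 * s1 * r2 * s2) * c'), (C (rc * r2 * s2) * p1'), q1',
  (C (rc * r1 * s1) * p2'), q2'; split.
- have R0 : r1 * s1 * r2 * s2 * rc != 0 by rewrite !mulf_neq0.
  have E1 : lift (C (r1 * s1 * r2 * s2) * c') =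
      (fincl (r1 * s1 * r2 * s2 * rc))%:P%:P * c.
    have CC x y : (x * y)%:P%:P = x%:P%:P * y%:P%:P :> {poly {poly k}}.
      by rewrite !polyCM.
    rewrite (rmorphM lift) c'E liftCC (rmorphM fincl (r1 * s1 * r2 * s2) rc) CC.
    exact: mulrA.
  by move=> h; apply: nc; apply/(KE _ _ _ E1 R0).
- split; last exact/(KE _ _ _ q1'E s10).
  by rewrite rmorphM -mulrA; apply: SkM; apply/(KE _ _ _ p1'E r10).
- split; last exact/(KE _ _ _ q2'E s20).
  by rewrite rmorphM -mulrA; apply: SkM; apply/(KE _ _ _ p2'E r20).
apply: lift_inj; rewrite rmorphB !rmorphM c'E p1'E p2'E q1'E q2'E.
have -> : forall x y z : {poly {poly k}}, x * (y * c) * z = x * y * (c * z).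
  by move=> *; ring.
rewrite cE /C !liftCC !(rmorphM fincl) !polyCM.
move: (fincl rc)%:P%:P (fincl r1)%:P%:P (fincl s1)%:P%:P (fincl r2)%:P%:P
  (fincl s2)%:P%:P => x1 x2 x3 x4 x5.
ring.
Qed.

End FractionDedekind.

Section SingularMultiple.

Variables (R A : idomainType) (E : fieldType).
Variables (theta : {rmorphism {poly R} -> E}) (F : {poly R}).
Hypotheses (Fm : F \is monic) (thF : theta F = 0).
Hypothesis kerF : forall p, theta p = 0 -> exists q, p = q * F.
Variables (eta : {rmorphism R -> {poly A}}) (ite : {rmorphism {poly A} -> R}).
Hypotheses (etaK : cancel eta ite) (iteK : cancel ite eta).
Variables (I : finType) (delta : I -> {poly R} -> {poly R}).
Hypothesis deltaB : forall i p q, delta i (p - q) = delta i p - delta i q.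
Hypothesis deltaM : forall i p q, delta i (p * q) = delta i p * q + p * delta i q.

Local Notation S x := (exists p, theta p = x).

(** Applying [delta i] to [c F = p1 q1 - p2 q2], where [F] maps to 0, puts [c] times the derivative
    in the prime conductor, which does not contain [c]. The finitely many derivatives then share one
    denominator. *)
Lemma singular_multiple u D : eta D \is monic ->
  ~ S u -> S (theta D%:P * u) -> integralOver theta u ->
  exists2 u', ~ S u' & forall i, S (theta (delta i F) * u').
Proof.
move=> Dm nSu SDu [P Pm /rootP Pu].
pose T : {rmorphism {poly R} -> {poly {poly A}}} := map_poly eta.
pose U : {rmorphism {poly {poly A}} -> {poly R}} := map_poly ite.
have TK p : U (T p) = p by apply/polyP => i; rewrite /= !coef_map; apply: etaK.
have UK p : T (U p) = p by apply/polyP => i; rewrite /= !coef_map; apply: iteK.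
pose th2 : {rmorphism {poly {poly A}} -> E} := theta \o U.
have TE p : th2 (T p) = theta p by rewrite -[LHS]/(theta (U (T p))) TK.
have UE p : theta (U p) = th2 p by [].
have F2m : T F \is monic by apply: monic_map.
have F20 : th2 (T F) = 0 by rewrite TE.
have ker2 p : th2 p = 0 -> exists q, p = q * T F.
  by move=> /kerF [q qE]; exists (T q); rewrite -(rmorphM T) -qE UK.
have SD2 : exists p, th2 p = th2 (eta D)%:P * u.
  have [p pE] := SDu; exists (T p).
  by rewrite TE pE -TE -[T _]/(map_poly eta D%:P) map_polyC.
have int2 : integralOver th2 u.
  exists (map_poly T P); first exact: monic_map.
  rewrite -map_poly_comp (eq_map_poly (g := theta)); first exact/rootP.
  by move=> p /=; apply: TE.
have nS2' : ~ (exists p, th2 p = u).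
  by move=> [p pE]; apply: nSu; exists (U p).
clearbody T U th2.
have [u2 [nS2 prime [cc [q1 [r1 [q2 [r2 [ncc [K1 K1'] [K2 K2'] ccE]]]]]]]] :=
  fraction_dedekind F2m F20 ker2 Dm nS2' SD2 int2.
pose eps r := th2 r%:P%:P.
pose Sk x := exists2 r, r != 0 & exists p, th2 p = eps r * x.
have SkD x y : Sk x -> Sk y -> Sk (x + y).
  move=> [r rn0 [p pE]] [s sn0 [q qE]]; exists (r * s); rewrite ?mulf_neq0 //.
  exists (s%:P%:P * p + r%:P%:P * q).
  by rewrite (rmorphD th2) !(rmorphM th2) pE qE /eps !polyCM (rmorphM th2); ring.
have SkM p x : Sk x -> Sk (theta p * x).
  move=> [r rn0 [q qE]]; exists r => //; exists (T p * q).
  by rewrite (rmorphM th2) TE qE mulrCA.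
have SkN x : Sk x -> Sk (- x).
  by move=> /(SkM (-1)); rewrite (rmorphN theta) rmorph1 mulN1r.
have dF i : Sk (theta (delta i F) * u2).
  have := congr1 U ccE; rewrite (rmorphB U) !(rmorphM U) TK => E1.
  have {E1} := congr1 (delta i) E1; rewrite deltaB !deltaM => E1.
  have Kp p q : Sk (th2 q * u2) -> Sk (theta (p * U q) * u2).
    by rewrite (rmorphM theta) UE -mulrA; apply: SkM.
  have : Sk (theta (U cc * delta i F) * u2).
    have -> : U cc * delta i F =
      delta i (U q1) * U r1 + delta i (U r1) * U q1
      - (delta i (U q2) * U r2 + delta i (U r2) * U q2) - delta i (U cc) * F.
      apply/eqP; rewrite eq_sym subr_eq [X in _ == X]addrC E1.
      by rewrite (mulrC (delta i (U r1))) (mulrC (delta i (U r2))).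
    rewrite (rmorphB theta) (rmorphM theta _ F) thF mulr0 subr0.
    rewrite (rmorphB theta) !(rmorphD theta) mulrBl !mulrDl.
    by apply: (SkD); [|apply: SkN]; apply: (SkD); apply: Kp.
  rewrite (rmorphM theta) UE -TE -(rmorphM th2) => /prime [//|].
  by rewrite TE.
have /choice [r rP] i :
    exists r, r != 0 /\ exists p, th2 p = eps r * (theta (delta i F) * u2).
  by have [r rn0 rE] := dF i; exists r.
pose R1 := \prod_i r i.
have R0 : R1 != 0 by apply/prodf_neq0 => i _; have [] := rP i.
exists (eps R1 * u2) => [[p pE]|i].
  by apply: nS2; exists R1 => //; exists (T p); rewrite TE.
have [_ [p pE]] := rP i; rewrite /R1 (bigD1 i) //=.
set R' := \prod_(j | j != i) r j.
exists (U (R'%:P%:P * p)); rewrite UE (rmorphM th2) pE /eps !polyCM (rmorphM th2).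
by move: (th2 R'%:P%:P) (th2 (r i)%:P%:P) (theta (delta i F)) => y1 y2 y3; ring.
Qed.

End SingularMultiple.

Section Normality.

Variables (K : fieldType) (N : nat) (F : {mpoly K[N]}).
Hypothesis Kclosed : alg_closed K.
Variables (E : fieldType) (phi : {rmorphism {mpoly K[N]} -> E}).
Hypothesis phiF : phi F = 0.
Hypothesis kerphi : forall p, phi p = 0 -> exists q, p = q * F.
Hypothesis fracphi : forall u, exists g h, phi h != 0 /\ u = phi g / phi h.

Variables (m : nat) (e0 : 'I_N -> K) (e : 'I_m -> 'I_N -> K).
Variables (x0 : {mpoly K[N]}) (l : m.-tuple {mpoly K[N]}).
Hypothesis frame : dual_frame e0 e x0 l.
Variable d : nat.
Hypotheses (Fh : F \is d.-homog) (Fe0 : F.@[e0] != 0).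

Local Notation S x := (exists p, phi p = x).

Definition frame_monic : {poly {mpoly K[m]}} :=
  (F.@[e0])^-1%:MP%:P * to_frame e0 e F.

Lemma size_frame : size (to_frame e0 e F) = d.+1.
Proof.
have [s _] := bihomog_to_frame e0 e Fh.
apply/eqP; rewrite eqn_leq s /= ltnNge; apply/negP => s'.
have := coef_top_to_frame e0 e Fh; rewrite nth_default // => /esym/eqP.
by rewrite mpolyC_eq0 (negbTE Fe0).
Qed.

Lemma frame_monicP : frame_monic \is monic.
Proof.
rewrite monicE lead_coefM lead_coefC lead_coefE size_frame /=.
by rewrite (coef_top_to_frame e0 e Fh) -mpolyCM mulVf.
Qed.

Lemma of_frame_monic : of_frame x0 l frame_monic = (F.@[e0])^-1%:MP * F.
Proof.
by rewrite /frame_monic rmorphM /= of_frameC comp_mpolyC (to_frameK frame).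
Qed.

Let th1 : {rmorphism {poly {mpoly K[m]}} -> E} := phi \o of_frame x0 l.

Lemma frame_monic0 : phi (of_frame x0 l frame_monic) = 0.
Proof. by rewrite of_frame_monic rmorphM phiF mulr0. Qed.

Lemma frame_ker p : phi (of_frame x0 l p) = 0 -> exists q, p = q * frame_monic.
Proof.
move=> /kerphi [q qE]; exists (to_frame e0 e q * (F.@[e0])%:MP%:P).
rewrite -[p](of_frameK frame) qE rmorphM /frame_monic -!mulrA; congr (_ * _).
by rewrite mulrA -polyCM -mpolyCM mulfV // mpolyC1 polyC1 mul1r.
Qed.

Definition jacobian h := exists (a : 'I_N -> {mpoly K[N]}) a0,
  h = \sum_i a i * F^`M(i) + a0 * F.

(* If [u] is integral but outside the ring, the partial derivatives of [F], hence
   also [p1] and [p2], multiply into the ring some element outside of it; this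
   contradicts the regularity of the sequence [p1], [p2]. *)
Lemma integrally_closed (p1 p2 : {mpoly K[m]}) : p1 != 0 ->
  (forall al be, p2 * al = p1 * be -> exists ga, al = p1 * ga) ->
  jacobian (p1 \mPo l) -> jacobian (p2 \mPo l) ->
  forall u, integralOver phi u -> S u.
Proof.
move=> p10 reg J1 J2 u [P Pm /rootP Pu]; apply: contrapT => nSu.
have th1E p : th1 (to_frame e0 e p) = phi p by rewrite /th1 /= (to_frameK frame).
have S1 x : S x <-> exists p, th1 p = x.
  split=> [[p <-]|[p <-]]; first by exists (to_frame e0 e p).
  by exists (of_frame x0 l p).
have Sc (c : K) x : c != 0 -> S (phi c%:MP * x) -> S x.
  move=> c0 [p pE]; exists (c^-1%:MP * p); rewrite rmorphM pE mulrA -rmorphM.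
  by rewrite -mpolyCM mulVf // mpolyC1 rmorph1 mul1r.
have [g [h [h0 uE]]] := fracphi u.
have [|D D0 [c cE]] := @norm_elt {mpoly K[m]} E th1 frame_monic
    frame_monicP frame_monic0 (to_frame e0 e h).
  by rewrite th1E.
have SDu : S (th1 D%:P * u).
  exists (of_frame x0 l c * g).
  rewrite cE th1E uE rmorphM; have -> : phi (of_frame x0 l c) = th1 c by [].
  by move: (th1 c) => t; field; exact: h0.
(* A constant denominator puts [u] in the ring at once; any other becomes monic in one variable by
   Noether normalization. *)
have [sD|sD] := leqP (msize D) 1.
  have DE := msize1_polyC sD; set a := D@_0%MM in DE.
  apply: nSu; apply: (Sc a); first by apply: contraNneq D0 => a0; rewrite DE a0 mpolyC0.
  by move: SDu; rewrite DE /th1 /= of_frameC comp_mpolyC.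
have [w [e' [x' [l' [fr' [a a0 aE]]]]]] := noether_frame Kclosed sD.
have D2m : to_frame w e' (a^-1%:MP * D) \is monic.
  rewrite monicE rmorphM lead_coefM /= to_frameC lead_coefC aE -mpolyCM mulVf //.
(* The partial derivatives of the ambient space, carried over to the frame, where they remain
   derivations. *)
pose delta i p := to_frame e0 e (of_frame x0 l p)^`M(i).
have deltaB i p q : delta i (p - q) = delta i p - delta i q.
  by rewrite /delta of_frameB mderivB to_frameB.
have deltaM i p q : delta i (p * q) = delta i p * q + p * delta i q.
  rewrite /delta (rmorphM (of_frame x0 l)) mderivM (rmorphD (to_frame e0 e)).
  by rewrite !(rmorphM (to_frame e0 e)) /= !(of_frameK frame).
have nS1 : ~ (exists p, th1 p = u) by rewrite -S1.
have SD1 : exists p, th1 p = th1 (a^-1%:MP * D)%:P * u.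
  have [p pE] := SDu; exists (to_frame e0 e (a^-1%:MP * p)).
  rewrite th1E rmorphM pE polyCM rmorphM mulrA; congr (_ * _ * _).
  by rewrite /th1 /= of_frameC comp_mpolyC.
have int1 : integralOver th1 u.
  exists (map_poly (to_frame e0 e) P); first exact: monic_map.
  rewrite -map_poly_comp (eq_map_poly (g := phi)); first exact/rootP.
  by move=> p /=; apply: th1E.
have [u3 nS3 Sd3] := @singular_multiple {mpoly K[m]} {mpoly K[m.-1]} E th1
  frame_monic frame_monicP frame_monic0 frame_ker (to_frame w e') (of_frame x' l')
  (to_frameK fr') (of_frameK fr') 'I_N delta deltaB deltaM u _ D2m nS1 SD1 int1.
have {}nS3 : ~ S u3 by rewrite S1.
have Sd i : S (phi F^`M(i) * u3).
  apply: (Sc (F.@[e0])^-1); first by rewrite invr_eq0.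
  have [p pE] := Sd3 i; exists (of_frame x0 l p); rewrite -[LHS]/(th1 p) pE.
  rewrite /delta th1E of_frame_monic mderivM mderivC mul0r add0r rmorphM.
  by rewrite mulrA.
have SM p x : S x -> S (phi p * x).
  by move=> [q <-]; exists (p * q); rewrite rmorphM.
have SD x y : S x -> S y -> S (x + y).
  by move=> [p <-] [q <-]; exists (p + q); rewrite rmorphD.
have SJ q : jacobian q -> S (phi q * u3).
  move=> [b [b0 ->]]; rewrite rmorphD mulrDl; apply: (SD); last first.
    by exists 0; rewrite rmorphM phiF mulr0 mul0r rmorph0.
  rewrite (rmorph_sum phi) mulr_suml; elim/big_ind: _ => [||i _].
  - by exists 0; rewrite rmorph0.
  - exact: SD.
  - by rewrite rmorphM -mulrA; apply: SM.
have S2' q : S (phi (q \mPo l) * u3) -> exists p, th1 p = th1 q%:P * u3.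
  by rewrite S1 -[th1 q%:P]/(phi (of_frame x0 l q%:P)) of_frameC.
apply: nS3; rewrite S1; apply: (@regular_mem {mpoly K[m]} E th1 frame_monic
  frame_monicP frame_monic0 frame_ker p1 p2 u3 p10 reg); apply: S2'; exact: SJ.
Qed.

End Normality.

(** * Elimination and dimension *)

Section Vectors.

Variables (K : fieldType) (V : vectType K).

Local Notation KV := {mpoly K[\dim {:V}]}.
Local Notation ev p v := (p : KV).@[coords v].

Lemma coordsD (v w : V) i : coords (v + w) i = coords v i + coords w i.
Proof. by rewrite /coords linearD. Qed.

Lemma coordsZ c (v : V) i : coords (c *: v) i = c * coords v i.
Proof. by rewrite /coords linearZ. Qed.

Lemma coords0 i : coords (0 : V) i = 0.
Proof. by rewrite /coords linear0. Qed.

Lemma coords_surj (c : 'I_(\dim {:V}) -> K) : exists v : V, coords v =1 c.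
Proof.
exists (\sum_i c i *: (vbasis {:V})`_i) => i; rewrite /coords coord_sum_free //.
exact: basis_free (vbasisP fullv).
Qed.

Lemma coords_eq0 (v : V) : (forall i, coords v i = 0) -> v = 0.
Proof.
move=> v0; rewrite (coord_vbasis (memvf v)) big1 // => i _.
by rewrite -/(coords v i) v0 scale0r.
Qed.

Lemma ev_homog1 (p : KV) : p \is 1.-homog ->
  forall c v w, ev p (c *: v + w) = c * ev p v + ev p w.
Proof.
move=> /homog_lin pE c v w; rewrite pE !(raddf_sum (meval _)) /= mulr_sumr.
rewrite -big_split; apply: eq_bigr => i _ /=.
by rewrite !mevalZ !mevalXU coordsD coordsZ; ring.
Qed.

Lemma ev_homog1D (p : KV) v w : p \is 1.-homog ->
  ev p (v + w) = ev p v + ev p w.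
Proof. by move=> hp; rewrite -[v in LHS]scale1r ev_homog1 // mul1r. Qed.

Lemma ev_homog1Z (p : KV) c v : p \is 1.-homog -> ev p (c *: v) = c * ev p v.
Proof.
move=> hp; rewrite -[_ *: _]addr0 ev_homog1 //.
by rewrite (homog_meval0 (ltn0Sn 0) hp (@coords0)) addr0.
Qed.

Lemma ev_homogZ (p : KV) d c v : p \is d.-homog -> ev p (c *: v) = c ^+ d * ev p v.
Proof.
move=> /dhomogP hp; rewrite !mevalE mulr_sumr; apply: eq_big_seq => mm /hp /= dm.
rewrite mulrCA; congr (_ * _); rewrite -dm mdegE -prodrXr -big_split.
by apply: eq_bigr => i _ /=; rewrite coordsZ exprMn.
Qed.

(** The form is the coordinate along [u] with respect to a complement [W] of the line of [u] that
    contains [U]. *)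
Lemma exists_form (U : {vspace V}) u : u \notin U ->
  exists2 x : KV, x \is 1.-homog & ev x u = 1 /\ forall v, v \in U -> ev x v = 0.
Proof.
move=> uU; have u0 : u != 0 by apply: contraNneq uU => ->; apply: mem0v.
pose W := (U + (U + <[u]>)^C)%VS.
have dis : (<[u]> :&: W)%VS = 0%VS.
  apply/eqP; rewrite -subv0; apply/subvP => v; rewrite memv_cap => /andP[].
  move=> /vlineP [c ->] /memv_addP [a aU [b bC cE]]; rewrite memv0.
  have bE : b = c *: u - a by rewrite cE addrC addKr.
  have b0 : b = 0.
    apply/eqP; rewrite -memv0 -(capv_compl (U + <[u]>)%VS) memv_cap bC andbT bE.
    apply: rpredB; last exact: (subvP (addvSl _ _)).
    by apply: (subvP (addvSr _ _)); apply: rpredZ; apply: memv_line.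
  have [->|c0] := eqVneq c 0; first by rewrite scale0r.
  case/negP: uU; rewrite -[u](scalerK c0) rpredZ // cE b0 addr0 //.
pose f (v : V) : K := coord [tuple u] ord0 (daddv_pi <[u]> W v).
pose x : KV := \sum_(i < \dim {:V}) f (vbasis {:V})`_i *: 'X_i.
have xE v : ev x v = f v.
  rewrite /x (raddf_sum (meval _)) [in RHS](coord_vbasis (memvf v)) /f !linear_sum /=.
  apply: eq_bigr => i _; by rewrite !linearZ /= mevalXU mulrC.
exists x.
  by apply: rpred_sum => i _; apply: dhomogZ; rewrite dhomogX /= mdeg1.
split=> [|v vU]; rewrite xE /f.
  rewrite daddv_pi_id ?memv_line //.
  have := coord_free (X := [tuple u]) ord0 ord0; rewrite /= seq1_free u0.
  by move=> ->.
have vW : v \in W by apply: (subvP (addvSl _ _)).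
have := daddv_pi_add dis (w := v); rewrite (subvP (addvSr _ _)) // => /(_ isT).
rewrite (daddv_pi_id (U := W)) ?(capvC W) // => /(canRL (addrK _)).
by rewrite subrr => ->; rewrite linear0.
Qed.

Lemma coords_neq0 (v : V) : v != 0 -> exists i, coords v i != 0.
Proof.
move=> v0; apply: contrapT => /forallNP h; case/eqP: v0; apply: coords_eq0 => i.
by apply/eqP/negPn/negP.
Qed.

End Vectors.

Section Elimination.

Variables (K : fieldType) (V : vectType K).
Hypothesis Kclosed : alg_closed K.

Local Notation KV := {mpoly K[\dim {:V}]}.
Local Notation ev p v := (p : KV).@[coords v].

Definition homog_ideal (I : KV -> Prop) :=
  [/\ I 0, forall p q, I p -> I q -> I (p + q), forall a p, I p -> I (a * p) &
      forall p, I p -> forall k, I (pihomog mdeg k p)].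

(** Such polynomials are the functions that factor through the projection from [U]. *)
Definition translation_inv (U : {vspace V}) (p : KV) :=
  forall x u, u \in U -> ev p (x + u) = ev p x.

Lemma homog_comp_neq0 (p : KV) v : ev p v != 0 ->
  exists k, ev (pihomog mdeg k p) v != 0.
Proof.
move=> pv; apply: contrapT => /forallNP h; case/negP: pv.
rewrite {1}(pihomog_partitionE (mf := mdeg) (leqnn (msize p))).
rewrite (raddf_sum (meval _)) big1 // => i _.
by apply/eqP/negPn/negP; apply: h.
Qed.

Lemma all_roots (p : {poly K}) : p != 0 -> exists rs : seq K, forall x, root p x -> x \in rs.
Proof.
move: {2}(size p) (leqnn (size p)) => n; elim: n p => [|n IH] p.
  by rewrite leqn0 size_poly_eq0 => ->.
move=> sp p0; have [[x px]|np] := pselect (exists x, root p x); last first.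
  by exists [::] => x px; case: np; exists x.
have /factor_theorem [q qE] := px.
have q0 : q != 0 by apply: contraNneq p0 => q0; rewrite qE q0 mul0r.
have [|rs rsP] := IH q _ q0.
  by move: sp; rewrite qE size_Mmonic ?monicXsubC // size_XsubC addn2.
exists (x :: rs) => y; rewrite qE rootM root_XsubC inE.
by case/orP => [/rsP ->|->]; rewrite ?orbT.
Qed.

Lemma horner_grade (p : KV) (x : V) c :
  (map_poly (meval (coords x)) (grade p)).[c] = ev p (c *: x).
Proof.
have := @mpoly_rmorph_ext K _ _
  (horner_eval c \o map_poly (meval (coords x)) \o @grade K (\dim {:V}))
  (meval (coords (c *: x))).
apply=> [a|i] /=; rewrite /horner_eval /grade.
  by rewrite mmapC /= map_polyC hornerC /= !mevalC.
rewrite mmapXU rmorphM /= map_polyX map_polyC hornerMX hornerC /=.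
by rewrite !mevalXU coordsZ mulrC.
Qed.

Lemma pihomog_inv U (p : KV) k : translation_inv U p ->
  translation_inv U (pihomog mdeg k p).
Proof.
move=> hp x u uU; rewrite -!coef_grade.
have E : map_poly (meval (coords (x + u))) (grade p) =
    map_poly (meval (coords x)) (grade p).
  apply/eqP; rewrite -subr_eq0; apply/eqP; apply: (poly_eq0_eval Kclosed) => c.
  by rewrite hornerD hornerN !horner_grade scalerDr hp ?subrr // memvZ.
by have := congr1 (fun P : {poly K} => P`_k) E; rewrite !coef_map.
Qed.

(** The leading coefficients survive, so the Sylvester matrix keeps its size under
    specialization. *)
Lemma rmorph_resultant (A B : nzRingType) (f : {rmorphism A -> B}) (p q : {poly A}) :
  f (lead_coef p) != 0 -> f (lead_coef q) != 0 ->
  f (resultant p q) = resultant (map_poly f p) (map_poly f q).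
Proof.
move=> fp fq; rewrite /resultant /Sylvester_mx !size_map_poly_id0 //.
rewrite -det_map_mx map_col_mx; congr (\det (col_mx _ _)); apply: map_lin1_mx => v;
by rewrite map_poly_rV rmorphM /= map_rVpoly.
Qed.

Variable I : KV -> Prop.
Hypothesis Ihom : homog_ideal I.

(* By induction on [s]: the last vector is eliminated by a resultant of two
   elements of [I], which are first made monic in its direction. *)
Lemma elimination (s : seq V) q : free s ->
  (forall x, x \in <<s>>%VS -> x != 0 -> exists2 f, I f & ev f x != 0) ->
  (forall x, x \in <<s>>%VS -> exists2 f, I f & ev f (q + x) != 0) ->
  exists h k, [/\ I h, h \is k.-homog, translation_inv <<s>> h & ev h q != 0].
Proof.
case: Ihom => I0 ID IM Ipi; elim: s q => [|u s IH] q.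
  move=> _ _ /(_ 0 (mem0v _)) [f If]; rewrite addr0 => /homog_comp_neq0 [k fk].
  exists (pihomog mdeg k f), k; split=> //; first exact: Ipi.
    exact: pihomogP.
  by move=> x v; rewrite span_nil memv0 => /eqP ->; rewrite addr0.
rewrite free_cons span_cons => /andP[us frs] zU zq.
set U := <<s>>%VS in us zU zq IH *.
have sU : (U <= <[u]> + U)%VS := addvSr _ _.
have uU : u \in (<[u]> + U)%VS by apply: (subvP (addvSl _ _)); apply: memv_line.
have zs x : x \in U -> x != 0 -> exists2 f, I f & ev f x != 0.
  by move=> xU; apply: zU; apply: (subvP sU).
(* Nonvanishing at [u] makes [f] monic in the direction [u], up to a constant. *)
have [|f [k [If fk fs fu]]] := IH u frs zs.
  move=> x xU; apply: zU; first by rewrite rpredD // (subvP sU).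
  by apply: contraNneq us => /eqP; rewrite addr_eq0 => /eqP ->; rewrite rpredN.
have [x0 hx0 [x0u x0U]] := exists_form us.
have [e [l F]] := exists_dual_frame hx0 x0u.
case: (F) => _ hl _ [l0 le] XE.
pose y (x : V) j := ev (tnth l j) x.
pose tf : {rmorphism KV -> {poly {mpoly K[(\dim {:V}).-1]}}} := to_frame (coords u) e.
pose sp (x : V) (p : KV) : {poly K} := map_poly (meval (y x)) (tf p).
have spE x p c : (sp x p).[c] = ev p (x + (c - ev x0 x) *: u).
  rewrite /sp meval_to_frame; apply: meval_eq => i.
  rewrite coordsD coordsZ -[coords x i](mevalXU (coords x)) XE mevalD mevalZ.
  rewrite (raddf_sum (meval _)) /= mulrBl.
  have -> : \sum_j y x j * e j i = \sum_j (e j i *: tnth l j).@[coords x].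
    by apply: eq_bigr => j _; rewrite mevalZ mulrC.
  by ring.
pose q0 := q - ev x0 q *: u.
have x0q0 c : ev x0 (q0 + c *: u) = c.
  rewrite ev_homog1D // ev_homog1Z // x0u mulr1 /q0 -scaleNr ev_homog1D //.
  by rewrite ev_homog1Z // x0u mulr1 subrr add0r.
have fq0 : sp q f != 0.
  apply: contraTneq fu => f0; rewrite negbK.
  have := coef_top_to_frame (coords u) e fk => /(congr1 (meval (y q))).
  by rewrite -coef_map -/(tf f) -/(sp q f) f0 coef0 mevalC => /esym/eqP.
(* On the line through [q] with direction [u], [f] has finitely many zeros; [g] is now made nonzero
   at all of them, one root at a time. *)
have [rs rsP] := all_roots fq0.
have [g [Ig gs gq]] : exists g, [/\ I g, translation_inv U g &
    forall c, c \in rs -> ev g (q0 + c *: u) != 0].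
  elim: (rs) => [|c cs [g [Ig gs gq]]].
    by exists 0; split=> // x v _; rewrite !meval0.
  have [ccs|ccs] := boolP (c \in cs).
    exists g; split=> // c'; rewrite inE => /orP[/eqP ->|]; exact: gq.
  have [|g1 [k1 [Ig1 _ g1s g1q]]] := IH (q0 + c *: u) frs zs.
    move=> x xU; have -> : q0 + c *: u + x = q + ((c - ev x0 q) *: u + x).
      by rewrite /q0 scalerBl addrA (addrC (c *: u)) !addrA.
    by apply: zq; rewrite rpredD ?rpredZ // (subvP sU).
  pose P : KV := \prod_(c' <- cs) (x0 - c'%:MP).
  have inv_x0 : translation_inv U (x0 : KV).
    by move=> x v vU; rewrite ev_homog1D // (x0U _ vU) addr0.
  have evP x : ev P x = \prod_(c' <- cs) (ev x0 x - c').
    rewrite (rmorph_prod (meval _)); apply: eq_bigr => c' _ /=.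
    by rewrite mevalB mevalC.
  exists ((x0 - c%:MP) * g + P * g1); split.
  - by apply: ID; apply: IM.
  - move=> x v vU; rewrite !mevalD !mevalM !mevalB !evP !inv_x0 // gs // g1s //.
    by rewrite !mevalC.
  move=> c'; rewrite inE mevalD !mevalM mevalB mevalC evP x0q0.
  case: eqVneq => [->|ne] /= h.
    rewrite subrr mul0r add0r mulf_neq0 // prodf_seq_neq0.
    by apply/allP => d dcs; apply/implyP => _; rewrite subr_eq0; apply: contraNneq ccs => ->.
  rewrite (big_rem c') //= subrr !mul0r addr0 mulf_neq0 ?subr_eq0 ?gq //.
(* The added term gives [G] the constant leading coefficient of [f], so that resultants specialize,
   and leaves the values of [g] at the zeros of [f] unchanged. *)
pose n := size (tf g).
pose G := g + f * x0 ^+ n.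
have IG : I G by apply: ID => //; rewrite mulrC; apply: IM.
have tx0 : tf x0 = 'X by rewrite -(of_frameX x0 l) /tf /= (of_frameK F).
have tG : tf G = tf g + tf f * 'X^n.
  by rewrite (rmorphD tf) (rmorphM tf) (rmorphXn tf) tx0.
have [sf _] := bihomog_to_frame (coords u) e fk.
have lf : (tf f)`_k = (ev f u)%:MP := coef_top_to_frame _ _ fk.
have sf' : size (tf f) = k.+1.
  apply/eqP; rewrite eqn_leq sf /= ltnNge; apply/negP => h.
  by move: lf; rewrite nth_default // => /esym/eqP; rewrite mpolyC_eq0 (negbTE fu).
have leadf : lead_coef (tf f) = (ev f u)%:MP by rewrite lead_coefE sf'.
have s1 : size (tf f * 'X^n) = (k.+1 + n)%N.
  by rewrite size_Mmonic ?monicXn ?size_polyXn ?sf' ?addnS // -size_poly_eq0 sf'.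
have s2 : (size (tf g) < size (tf f * 'X^n)%R)%N.
  by rewrite s1 addSn ltnS leq_addl.
have leadG : lead_coef (tf G) = (ev f u)%:MP.
  by rewrite tG addrC lead_coefDl // lead_coef_Mmonic ?monicXn.
have lead_meval x (p : KV) : lead_coef (tf p) = (ev f u)%:MP ->
    meval (y x) (lead_coef (tf p)) != 0.
  by move=> ->; rewrite mevalC.
have [k0|k0] := posnP k.
  move: fk fu; rewrite k0 => f0 fu; exists f, 0%N; split=> //.
    by move=> x v _; rewrite (homog0_const f0) !mevalC.
  by move: fu; rewrite (homog0_const f0) !mevalC.
have sG : (1 < size (tf G))%N.
  by rewrite tG addrC size_polyDl // s1 (leq_trans _ (leq_addr _ _)).
pose r := resultant (tf f) (tf G).
have rE x : r.@[y x] = resultant (sp x f) (sp x G).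
  by rewrite /r rmorph_resultant // lead_meval.
have Gs : translation_inv U G.
  move=> x v vU; rewrite !mevalD !mevalM !rmorphXn /= gs // fs //.
  by rewrite ev_homog1D // (x0U _ vU) addr0.
have spq p c : (sp q p).[c] = ev p (q0 + c *: u).
  by rewrite spE /q0 scalerBl addrA addrAC.
have rq : r.@[y q] != 0.
  rewrite rE resultant_eq0; apply/negP => sg.
  have [c] := Kclosed (p := gcdp (sp q f) (sp q G)) (negbT (gtn_eqF sg)).
  rewrite root_gcd => /andP[fc /rootP]; rewrite spq mevalD mevalM rmorphXn /=.
  move: (fc) => /rootP; rewrite spq => ->; rewrite mul0r addr0 => gc.
  by have := gq c (rsP _ fc); rewrite gc eqxx.
pose h := r \mPo l.
have hE x : ev h x = r.@[y x] by rewrite comp_mpoly_meval.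
have Ih : I h.
  have sf1 : (1 < size (tf f))%N by rewrite sf' ltnS.
  have [[a b] _ /= rab] := resultant_in_ideal sf1 sG.
  have tK p : of_frame x0 l (tf p) = p := to_frameK F p.
  have hof : h = of_frame x0 l r%:P by rewrite of_frameC.
  rewrite hof; have -> : r%:P = a * tf f + b * tf G by exact: rab.
  have -> : of_frame x0 l (a * tf f + b * tf G) =
      of_frame x0 l (a * tf f) + of_frame x0 l (b * tf G).
    exact: (rmorphD (of_frame x0 l)).
  have fm p P : of_frame x0 l (P * tf p) = of_frame x0 l P * p.
    by rewrite -[p in RHS]tK; apply: (rmorphM (of_frame x0 l)).
  by apply: ID; rewrite fm; apply: IM.
(* Along [u] the forms [l] are constant, and along [U] the two polynomials of the resultant do not
   change. *)
have hs : translation_inv (<[u]> + U) h.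
  move=> x _ /memv_addP [_ /vlineP [c ->] [v vU ->]].
  have yE : y (x + (c *: u + v)) =1 y (x + v).
    by move=> j; rewrite /y !ev_homog1D // ev_homog1Z // l0 mulr0 add0r.
  rewrite !hE (meval_eq _ yE) !rE.
  have spv p : translation_inv U p -> sp (x + v) p = sp x p.
    move=> ps; apply/eqP; rewrite -subr_eq0; apply/eqP.
    apply: (poly_eq0_eval Kclosed) => c'; rewrite hornerD hornerN !spE.
    rewrite (ev_homog1D x v hx0) (x0U _ vU) addr0 (addrAC x v).
    by rewrite (ps _ _ vU) subrr.
  by rewrite !spv.
have /homog_comp_neq0 [j hj] : ev h q != 0 by rewrite hE.
exists (pihomog mdeg j h), j; split=> //; [exact: Ipi|exact: pihomogP|].
exact: pihomog_inv.
Qed.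

End Elimination.

Section ZeroSets.

Variables (K : fieldType) (V : vectType K).
Hypothesis Kclosed : alg_closed K.

Local Notation KV := {mpoly K[\dim {:V}]}.
Local Notation ev p v := (p : KV).@[coords v].

Lemma pointsP (M P : {vspace V}) : points M P ->
  exists v, [/\ v != 0, v \in M & P = <[v]>%VS].
Proof.
move=> [dP PM]; exists (vpick P); have vP : vpick P \in P := memv_pick P.
have v0 : vpick P != 0 by rewrite vpick0 -dimv_eq0 dP.
split=> //; first exact: (subvP PM).
by apply/esym/eqP; rewrite eqEdim -memvE vP dP dim_vline v0.
Qed.

Lemma points_line (M : {vspace V}) v : v != 0 -> v \in M -> points M <[v]>%VS.
Proof. by move=> v0 vM; split; [rewrite dim_vline v0|rewrite -memvE]. Qed.

Definition zeros (I : KV -> Prop) : set {vspace V} :=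
  [set P | points fullv P /\ forall f, I f -> vanish f P].

Lemma zeros_line I v : homog_ideal I -> v != 0 ->
  zeros I <[v]>%VS <-> forall f, I f -> ev f v = 0.
Proof.
move=> [_ _ _ Ipi] v0; split=> [[_ h] f If|h].
  by apply: (h f If); apply: memv_line.
split=> [|f If w /vlineP [c ->]]; first by apply: points_line; rewrite ?memvf.
rewrite [f](pihomog_partitionE (mf := mdeg) (leqnn _)) (raddf_sum (meval _)).
rewrite big1 // => i _ /=; rewrite (ev_homogZ _ _ (pihomogP mdeg i f)).
by rewrite h ?mulr0 //; apply: Ipi.
Qed.

Lemma zclosed_zeros I : homog_ideal I -> zclosed (zeros I).
Proof.
move=> Ih; case: (Ih) => _ _ _ Ipi.
exists [set f | I f /\ exists m, f \is m.-homog] => [f [_ //]|].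
apply/seteqP; split=> P [PV h]; split=> //; first by move=> f [If _]; apply: h.
have [v [v0 _ PE]] := pointsP PV; rewrite PE.
have [_ ] := zeros_line Ih v0; case=> [|_ //] f If.
rewrite [f](pihomog_partitionE (mf := mdeg) (leqnn _)) (raddf_sum (meval _)).
rewrite big1 // => i _ /=; apply: (h (pihomog mdeg i f)).
  by split; [apply: Ipi|exists i; apply: pihomogP].
by rewrite PE memv_line.
Qed.

End ZeroSets.

(** * Chains of irreducible closed sets over a linear projection *)

Section Chains.

Variables (K : fieldType) (V : vectType K).
Hypothesis Kclosed : alg_closed K.

Local Notation KV := {mpoly K[\dim {:V}]}.
Local Notation ev p v := (p : KV).@[coords v].

Variable b : seq V.
Hypothesis bfree : free b.

Local Notation U := (<<b>>%VS).

Definition no_zero (I : KV -> Prop) :=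
  forall x, x \in U -> x != 0 -> exists2 f, I f & ev f x != 0.

(* [L] lies in the image of the zeros of [I] under the projection from [U]. *)
Definition dominates (I : KV -> Prop) (L : {vspace V}) :=
  forall q, q \in L -> q \notin U ->
    exists2 x, x \in U & forall f, I f -> ev f (q + x) = 0.

(** Elimination turns a point without preimage into an equation that holds on the image. A linear
    factor vanishing on [U] is added so that the points where [h] is nonzero are off [U]. *)
Lemma dominates_elim I L : homog_ideal I -> no_zero I -> ~ dominates I L ->
  exists q h, [/\ q \in L, I h, translation_inv U h & ev h q != 0 /\
    forall u, u \in U -> ev h u = 0].
Proof.
move=> Ih nz nd.
have [q [qL qU nq]] : exists q, [/\ q \in L, q \notin U &
    ~ exists2 x, x \in U & forall f, I f -> ev f (q + x) = 0].
  apply: contrapT => h; apply: nd => q qL qU; apply: contrapT => nq.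
  by apply: h; exists q.
have [|h [k [Ih' _ hs hq]]] := elimination Kclosed Ih bfree nz (q := q).
  move=> x xU; apply: contrapT => h; apply: nq; exists x => // f If.
  by apply/eqP; apply: contrapT => /negP fq; apply: h; exists f.
have [x hx [xq xU]] := exists_form qU; case: Ih => _ _ IM _.
exists q, (x * h); split=> //; first exact: IM.
  by move=> y u uU; rewrite !mevalM hs // ev_homog1D // (xU _ uU) addr0.
by split=> [|u uU]; rewrite mevalM ?xq ?mul1r // xU // mul0r.
Qed.

(** A large ideal has few zeros: this replaces the choice of an irreducible component dominating the
    projection of [L]. *)
Definition maximal_dominating (I : KV -> Prop) L :=
  [/\ homog_ideal I, dominates I L & forall I', homog_ideal I' -> dominates I' L ->
    (forall f, I f -> I' f) -> forall f, I' f -> I f].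

(** Zorn's lemma. If the union of a chain of ideals failed to dominate, elimination would give one
    element as a witness, and it would already lie in a member of the chain. *)
Lemma exists_maximal I L : homog_ideal I -> no_zero I -> dominates I L ->
  exists2 I', maximal_dominating I' L & forall f, I f -> I' f.
Proof.
move=> Ih nz dI.
pose T := {J : KV -> Prop | [/\ homog_ideal J, dominates J L & forall f, I f -> J f]}.
have t0 : T by exists I.
pose R (s t : T) := `[< forall f, sval s f -> sval t f >].
have [||A Atot|t tmax] := ZL_preorder t0 (R := R).
- by move=> s; apply/asboolP.
- by move=> r s t /asboolP rs /asboolP st; apply/asboolP => f /rs /st.
- have [[a0 Aa0]|Ae] := pselect (exists a, A a); last first.
    by exists t0 => s As; case: Ae; exists s.
  pose J f := exists2 s, A s & sval s f.
  have both f g : J f -> J g -> exists s, [/\ A s, sval s f & sval s g].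
    move=> [s As sf] [t At tg]; case: (Atot s t As At) => /asboolP st.
      by exists t; split=> //; apply: st.
    by exists s; split=> //; apply: st.
  have Jh : homog_ideal J.
    split.
    - by exists a0 => //; have [[]] := svalP a0.
    - move=> f g Jf Jg; have [s [As sf sg]] := both f g Jf Jg; exists s => //.
      by have [[_ sD _ _] _ _] := svalP s; apply: sD.
    - by move=> c f [s As sf]; exists s => //; have [[_ _ sM _] _ _] := svalP s; apply: sM.
    - by move=> f [s As sf] k; exists s => //; have [[_ _ _ sp] _ _] := svalP s; apply: sp.
  have IJ f : I f -> J f by move=> If; exists a0 => //; have [_ _] := svalP a0; apply.
  have Jd : dominates J L.
    apply: contrapT => nd; have [|q [h [qL [s As sh] hs [hq hU]]]] := dominates_elim Jh _ nd.
      by move=> x xU x0; have [f If fx] := nz x xU x0; exists f => //; apply: IJ.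
    have [_ sd _] := svalP s; have [|x xU zx] := sd q qL.
      by apply: contraNN hq => qU; rewrite hU.
    by have := zx h sh; rewrite hs // => /eqP; rewrite (negbTE hq).
  by exists (exist _ J (And3 Jh Jd IJ)) => s As; apply/asboolP => f sf; exists s.
have [th td tI] := svalP t; exists (sval t) => //; split=> // I' Ih' dI' tI' f If.
have h g : I g -> I' g by move=> /tI /tI'.
pose t' : T := exist _ I' (And3 Ih' dI' h).
by have /asboolP := tmax t' (introT (asboolP _) tI'); apply.
Qed.

Lemma line_poly (p : KV) x y : exists P : {poly K}, forall c, P.[c] = ev p (x + c *: y).
Proof.
exists (mmap polyC (fun i => (coords x i)%:P + (coords y i)%:P * 'X) p) => c.
have := @mpoly_rmorph_ext K _ _ (horner_eval c \o
  mmap polyC (fun i => (coords x i)%:P + (coords y i)%:P * 'X))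
  (meval (coords (x + c *: y))).
apply=> [a|i] /=; rewrite /horner_eval ?mmapC ?mmapXU ?mevalC ?mevalXU ?hornerC //.
by rewrite hornerD hornerM !hornerC hornerX coordsD coordsZ mulrC.
Qed.

Lemma nonzero_both (f g : KV) (L : {vspace V}) p q : p \in L -> q \in L -> ev f p != 0 -> ev g q != 0 ->
  exists x : V, [/\ x \in L, ev f x != 0 & ev g x != 0].
Proof.
move=> pL qL fp gq.
have [P PE] := line_poly f p (q - p); have [Q QE] := line_poly g p (q - p).
have P0 : P != 0.
  by apply: contraNneq fp => P0; rewrite -[p]addr0 -(scale0r (q - p)) -PE P0 horner0.
have Q0 : Q != 0.
  by apply: contraNneq gq => Q0; rewrite -[q](subrK p) addrC -[q - p]scale1r -QE Q0 horner0.
have [c] : exists c, (P * Q).[c] != 0.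
  apply: contrapT => /forallNP h; have /eqP : P * Q = 0.
    by apply: (poly_eq0_eval Kclosed) => c; apply/eqP/negPn/negP.
  by rewrite mulf_eq0 (negbTE P0) (negbTE Q0).
rewrite hornerM mulf_eq0 negb_or PE QE => /andP[fc gc].
by exists (p + c *: (q - p)); split=> //; rewrite rpredD // rpredZ // rpredB.
Qed.

(** If neither of two closed sets contains the zeros, each gives a [U]-invariant equation. Over a
    point of [L] where both equations are nonzero there is a zero of [I], and it lies in neither
    set. *)
Lemma maximal_irreducible I L : no_zero I -> maximal_dominating I L ->
  (exists2 q, q \in L & q \notin U) -> zirreducible (zeros I).
Proof.
move=> nz [Ih dI Imax] [q0 q0L q0U]; case: (Ih) => I0 ID IM Ipi.
have pt q : q \in L -> q \notin U -> exists2 x, x \in U &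
    q + x != 0 /\ zeros I <[q + x]>%VS.
  move=> qL qU; have [x xU zx] := dI q qL qU; exists x => //.
  have n0 : q + x != 0.
    by apply: contraNneq qU => /eqP; rewrite addr_eq0 => /eqP ->; rewrite rpredN.
  by split=> //; apply/zeros_line.
split; first exact: zclosed_zeros.
  by have [x xU [_ zx]] := pt _ q0L q0U; exists <[q0 + x]>%VS.
(* A closed set that does not contain the zeros of [I] is cut out of them by an
   element of the larger ideal [I + (a)], hence by a [U]-invariant element. *)
have key A : zclosed A -> ~ (zeros I `<=` A) ->
    exists q h, [/\ q \in L, ev h q != 0, translation_inv U h,
      forall u, u \in U -> ev h u = 0 &
      forall z, z != 0 -> (forall f, I f -> ev f z = 0) -> A <[z]>%VS -> ev h z = 0].
  move=> [IA IAh ->] nA.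
  have [P [PI nP]] : exists P, zeros I P /\ ~ (points fullv P /\ forall f, IA f -> vanish f P).
    by apply: contrapT => /forallNP h; apply: nA => P PI; apply: contrapT => nP; apply: (h P).
  have [a [IAa naP]] : exists a, IA a /\ ~ vanish a P.
    apply: contrapT => /forallNP h; apply: nP; split; first by case: PI.
    by move=> f fA; apply: contrapT => nf; apply: (h f).
  have [k ak] := IAh a IAa.
  pose J f := exists g c, I g /\ f = g + c * a.
  have Jh : homog_ideal J.
    split.
    - by exists 0, 0; rewrite mul0r addr0.
    - move=> _ _ [g [c [Ig ->]]] [g' [c' [Ig' ->]]]; exists (g + g'), (c + c').
      by split; [apply: ID|ring].
    - move=> r _ [g [c [Ig ->]]]; exists (r * g), (r * c).
      by split; [apply: IM|ring].
    - move=> _ [g [c [Ig ->]]] j.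
      exists (pihomog mdeg j g), (if (k <= j)%N then pihomog mdeg (j - k) c else 0).
      split; first exact: Ipi.
      rewrite pihomogD; congr (_ + _); rewrite -coef_grade rmorphM /= (grade_homog ak).
      rewrite mulrA coefMXn coefMC ltnNge; case: leqP => //= _; last by rewrite mul0r.
      by rewrite coef_grade.
  have IJ f : I f -> J f by move=> If; exists f, 0; rewrite mul0r addr0.
  have nd : ~ dominates J L.
    move=> Jd; apply: naP; case: PI => _; apply; apply: (Imax J) => //.
    by exists 0, 1; rewrite mul1r add0r.
  have [|q [h [qL [g [c [Ig hE]]] hs [hq hU]]]] := dominates_elim Jh _ nd.
    by move=> x xU x0; have [f If fx] := nz x xU x0; exists f => //; apply: IJ.
  exists q, h; split=> // z z0 zI [_ zA].
  by rewrite hE mevalD mevalM zI // (zA a IAa z) ?memv_line // mulr0 addr0.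
move=> A B cA cB sAB; apply: contrapT => /not_orP [nA nB].
have [q [h [qL hq hs hU hz]]] := key A cA nA.
have [q' [h' [q'L hq' hs' hU' hz']]] := key B cB nB.
have [x [xL hx hx']] := nonzero_both qL q'L hq hq'.
have xU : x \notin U by apply: contraNN hx => xU; rewrite hU.
have [u uU [z0 zz]] := pt x xL xU.
have zI f : I f -> ev f (x + u) = 0 by move: f; apply/zeros_line.
case: (sAB _ zz) => [/hz|/hz'] => /(_ z0 zI) /eqP.
  by rewrite hs // (negbTE hx).
by rewrite hs' // (negbTE hx').
Qed.

(** The top member is given by a maximal ideal [I2]. Its zeros in the smaller space [L] still
    dominate [L], as lifting moves points only along [U], which [L] contains. A zero over [c] is not
    in [L], so the inclusion is strict. *)
Lemma exists_chain s I : free (s ++ b) -> homog_ideal I -> no_zero I ->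
  dominates I <<s ++ b>>%VS ->
  exists Z : nat -> set {vspace V},
    (forall i, (i < size s)%N -> zirreducible (Z i) /\ Z i `<=` zeros I) /\
    (forall i, (i.+1 < size s)%N -> Z i `<` Z i.+1).
Proof.
elim: s I => [|c s IH] I.
  by move=> *; exists (fun _ => set0); split.
rewrite cat_cons free_cons span_cons => /andP[cL frs] Ih nz dI.
set L := <<s ++ b>>%VS in cL dI IH *.
have UL : (U <= L)%VS by rewrite /L span_cat addvSr.
have [I2 I2max II2] := exists_maximal Ih nz dI.
have [I2h I2d _] := I2max; case: (I2h) => I20 I2D I2M I2p.
have nz2 : no_zero I2.
  by move=> x xU x0; have [f If fx] := nz x xU x0; exists f => //; apply: II2.
have cU : c \notin U by apply: contraNN cL; apply: (subvP UL).
have cL2 : c \in (<[c]> + L)%VS by rewrite (subvP (addvSl _ _)) // memv_line.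
have irr : zirreducible (zeros I2).
  by apply: (maximal_irreducible nz2 I2max); exists c.
pose I3 f := exists g h, [/\ I2 g, (forall x, x \in L -> ev h x = 0) & f = g + h].
have I3h : homog_ideal I3.
  split.
  - by exists 0, 0; split=> // [x _|]; rewrite ?meval0 ?addr0.
  - move=> _ _ [g [h [g2 hL ->]]] [g' [h' [g2' hL' ->]]].
    exists (g + g'), (h + h'); split=> [|x xL|]; [exact: I2D| |by ring].
    by rewrite mevalD hL ?hL' ?addr0.
  - move=> a _ [g [h [g2 hL ->]]]; exists (a * g), (a * h); split=> [|x xL|].
    + exact: I2M.
    + by rewrite mevalM hL ?mulr0.
    + by ring.
  - move=> _ [g [h [g2 hL ->]]] k; exists (pihomog mdeg k g), (pihomog mdeg k h).
    split=> [|x xL|]; [exact: I2p| |by rewrite pihomogD].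
    rewrite -coef_grade -(coef_map (meval _)).
    suff -> : map_poly (meval (coords x)) (grade h) = 0 by rewrite coef0.
    apply: (poly_eq0_eval Kclosed) => a.
    by rewrite horner_grade hL // memvZ.
have I23 f : I2 f -> I3 f.
  by move=> If; exists f, 0; split=> // [x _|]; rewrite ?meval0 ?addr0.
have nz3 : no_zero I3.
  by move=> x xU x0; have [f If fx] := nz2 x xU x0; exists f => //; apply: I23.
have d3 : dominates I3 L.
  move=> q qL qU; have [|x xU zx] := I2d q _ qU; first exact: (subvP (addvSr _ _)).
  exists x => // _ [g [h [g2 hL ->]]]; rewrite mevalD zx // hL ?addr0 //.
  by rewrite rpredD // (subvP UL).
have [Z [Zirr Zst]] := IH I3 frs I3h nz3 d3.
have z32 : zeros I3 `<=` zeros I2 by move=> P [PV h]; split=> // f /I23; apply: h.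
have z2 : zeros I2 `<=` zeros I by move=> P [PV h]; split=> // f /II2; apply: h.
exists (fun i => if (i < size s)%N then Z i else zeros I2); split=> i /= si.
  case: ltnP => h; last by split.
  by have [zi zs] := Zirr i h; split=> // P /zs /z32 /z2.
rewrite ltnS in si; rewrite si; case: ltnP => h; first exact: Zst.
have [zi zs] := Zirr i si; split; first by move=> P /zs /z32.
have [x xU zx] := I2d c cL2 cU.
have n0 : c + x != 0.
  by apply: contraNneq cU => /eqP; rewrite addr_eq0 => /eqP ->; rewrite rpredN.
have /(zeros_line I2h n0) zc : forall f, I2 f -> ev f (c + x) = 0 by [].
move=> /(_ _ zc) /zs /(zeros_line I3h n0) z3.
have cxL : c + x \notin L.
  by apply: contraNN cL => h'; rewrite -[c](addrK x) rpredB // (subvP UL).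
have [y hy [y1 yL]] := exists_form cxL.
have : ev y (c + x) = 0.
  by apply: z3; exists 0, y; rewrite add0r.
by rewrite y1 => /eqP; rewrite oner_eq0.
Qed.

End Chains.

(** Take a space through [v0] of maximal dimension without zeros. The projection from it is onto,
    otherwise a vector could be added; a complement of dimension [t + 1] then yields a chain of
    length [t]. *)
Lemma exists_avoiding (K : fieldType) (V : vectType K) (Kclosed : alg_closed K)
    (I : {mpoly K[\dim {:V}]} -> Prop) v0 (k : int) :
  homog_ideal I -> (exists2 f, I f & f.@[coords v0] != 0) -> v0 != 0 ->
  zdim_le (zeros I) k ->
  exists b, [/\ free (v0 :: b), no_zero (v0 :: b) I &
    (\dim {:V})%:Z <= (size b)%:Z + 2 + k].
Proof.
move=> Ih [f0 If0 f0v] v00 [k1 zd]; case: (Ih) => I0 ID IM Ipi.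
pose Q n := `[< exists b : seq V, [/\ size b = n, free (v0 :: b) & no_zero (v0 :: b) I] >].
have exQ : exists n, Q n.
  exists 0%N; apply/asboolP; exists [::]; split=> //; first by rewrite seq1_free.
  move=> x; rewrite span_seq1 => /vlineP [c ->]; rewrite scaler_eq0 (negbTE v00) orbF.
  move=> c0; have [j fj] := homog_comp_neq0 f0v; exists (pihomog mdeg j f0).
    exact: Ipi.
  by rewrite (ev_homogZ _ _ (pihomogP mdeg j f0)) mulf_neq0 // expf_neq0.
have bQ n : Q n -> (n <= \dim {:V})%N.
  move=> /asboolP [b [<- fb _]]; move: (fb); rewrite /free => /eqP h.
  have : (\dim <<v0 :: b>> <= \dim {:V})%N by apply/dimvS/subvf.
  by rewrite h /=; apply: leq_trans; apply: leqW.
case: (ex_maxnP exQ bQ) => n /asboolP [b [bn fb nz]] nmax; exists b; split=> //.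
set B := v0 :: b in fb nz *.
have dB : \dim <<B>> = n.+1 by move: fb; rewrite /free => /eqP ->; rewrite /= bn.
have dI : dominates B I fullv.
  move=> q _ qU; apply: contrapT => nq.
  have : Q n.+1.
    apply/asboolP; exists (rcons b q); rewrite size_rcons bn.
    have pe : perm_eq (v0 :: rcons b q) (q :: B).
      by rewrite -cat1s -cats1 catA cats1 -/B perm_rcons.
    have se : <<v0 :: rcons b q>>%VS = (<[q]> + <<B>>)%VS.
      by rewrite -span_cons; apply: eq_span => x; apply: perm_mem.
    split=> //; first by rewrite (perm_free pe) free_cons qU.
    rewrite /no_zero se => x /memv_addP [_ /vlineP [c ->] [u uB ->]].
    have [->|c0] := eqVneq c 0; first by rewrite scale0r add0r; apply: nz.
    move=> _; have uB' : c^-1 *: u \in <<B>>%VS by rewrite memvZ.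
    have [f If fx] : exists2 f, I f & f.@[coords (q + c^-1 *: u)] != 0.
      apply: contrapT => h; apply: nq; exists (c^-1 *: u) => // f If.
      by apply/eqP; apply: contrapT => /negP fx; apply: h; exists f.
    have [j fj] := homog_comp_neq0 fx; exists (pihomog mdeg j f); first exact: Ipi.
    have -> : c *: q + u = c *: (q + c^-1 *: u) by rewrite scalerDr scalerA mulfV ?scale1r.
    by rewrite (ev_homogZ _ _ (pihomogP mdeg j f)) mulf_neq0 // expf_neq0.
  by move=> /nmax; rewrite ltnn.
pose s : seq V := vbasis (<<B>>^C)%VS.
have ss : <<s>>%VS = (<<B>>^C)%VS := span_basis (vbasisP _).
have fsB : free (s ++ B).
  rewrite cat_free fb (basis_free (vbasisP _)) directv_addE /= ss.
  by rewrite capvC capv_compl eqxx !andbT; apply/andP; split; apply: directv_trivial.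
have sN : (size s + n.+1 = \dim {:V})%N.
  rewrite -dB size_tuple; have := dimv_compl <<B>>%VS => ->.
  by rewrite subnK // dimvS // subvf.
have [Z [Zi Zs]] : exists Z : nat -> set {vspace V},
    (forall i, (i < size s)%N -> zirreducible (Z i) /\ Z i `<=` zeros I) /\
    (forall i, (i.+1 < size s)%N -> Z i `<` Z i.+1).
  apply: (exists_chain Kclosed fb fsB Ih nz) => q _; apply: dI; exact: memvf.
(* A zero complement gives no chain; the bound then comes from [-1 <= k]. *)
rewrite -sN bn; case: (size s) Zi Zs => [|t] Zi Zs; first lia.
have := zd t Z Zi Zs; lia.
Qed.

(** * Finiteness of Galois points off cones *)

Lemma mderiv_homog (K : fieldType) n (p : {mpoly K[n]}) k i : p \is k.+1.-homog -> p^`M(i) \is k.-homog.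
Proof.
move=> /dhomogP hp; rewrite [p]mpolyE (raddf_sum (mderiv i)) big_seq.
apply: rpred_sum => mm /hp /= dm; rewrite mderivZ mderivX; apply: dhomogZ.
have [->|mi] := eqVneq (mm i) 0%N; first by rewrite scale0r dhomog0.
apply: dhomogZ; rewrite dhomogX /= -eqSS -dm -{2}(@submK _ U_(i) mm).
  by rewrite mdegD mdeg1 addn1.
by apply/mnm_lepP => j; rewrite mnm1E; case: eqP => // <-; rewrite lt0n.
Qed.

Section DirectionalDerivative.

Variables (K : fieldType) (V : vectType K).

Local Notation KV := {mpoly K[\dim {:V}]}.
Local Notation ev p v := (p : KV).@[coords v].

Definition dderiv (v : V) (p : KV) : KV := \sum_i coords v i *: p^`M(i).

Lemma dderivD v p q : dderiv v (p + q) = dderiv v p + dderiv v q.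
Proof.
by rewrite -big_split; apply: eq_bigr => i _; rewrite mderivD scalerDr.
Qed.

Lemma dderivZ v c p : dderiv v (c *: p) = c *: dderiv v p.
Proof.
rewrite /dderiv scaler_sumr; apply: eq_bigr => i _.
by rewrite mderivZ !scalerA mulrC.
Qed.

Lemma dderivN v p : dderiv v (- p) = - dderiv v p.
Proof. by rewrite -scaleN1r dderivZ scaleN1r. Qed.

Lemma dderivC v c : dderiv v c%:MP = 0.
Proof. by rewrite /dderiv big1 // => i _; rewrite mderivC scaler0. Qed.

Lemma dderivM v p q : dderiv v (p * q) = dderiv v p * q + p * dderiv v q.
Proof.
rewrite /dderiv mulr_suml mulr_sumr -big_split; apply: eq_bigr => i _ /=.
by rewrite mderivM scalerDr scalerAl scalerAr.
Qed.

Lemma dderivXn v p n : dderiv v (p ^+ n) = (n%:R *: p ^+ n.-1) * dderiv v p.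
Proof.
elim: n => [|n IH]; first by rewrite expr0 -mpolyC1 dderivC scale0r mul0r.
rewrite exprS dderivM IH -natr1 /= scalerDl scale1r mulrDl addrC; congr (_ + _).
  case: n {IH} => [|n] /=; first by rewrite !scale0r !mul0r mulr0.
  by rewrite exprS !mulrA -scalerAr.
exact: mulrC.
Qed.

Lemma dderiv_form v p : p \is 1.-homog -> dderiv v p = (ev p v)%:MP.
Proof.
move=> /homog_lin pE; rewrite /dderiv [in RHS]pE (raddf_sum (meval _)).
rewrite (raddf_sum (@mpolyC _ _)); apply: eq_bigr => i _ /=.
rewrite mevalZ mevalXU mulrC mpolyCM mul_mpolyC; congr (_ *: _).
rewrite [in LHS]pE (raddf_sum (mderiv i)) (bigD1 i) //= big1 => [|j ji].
  rewrite addr0 mderivZ mderivX mnm1E eqxx scale1r.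
  rewrite -[X in (X - _)%MM]add0m addmK mpolyX0 -mul_mpolyC; exact: mulr1.
by rewrite mderivZ mderivX mnm1E (negbTE ji) scale0r scaler0.
Qed.

Lemma dderivDl v w p : dderiv (v + w) p = dderiv v p + dderiv w p.
Proof.
by rewrite -big_split; apply: eq_bigr => i _; rewrite coordsD scalerDl.
Qed.

Lemma dderivZl c v p : dderiv (c *: v) p = c *: dderiv v p.
Proof.
by rewrite /dderiv scaler_sumr; apply: eq_bigr => i _; rewrite coordsZ scalerA.
Qed.

Lemma dderiv_comm v w p : dderiv v (dderiv w p) = dderiv w (dderiv v p).
Proof.
have E a b : dderiv a (dderiv b p) =
    \sum_i \sum_j (coords a i * coords b j) *: p^`M(j)^`M(i).
  apply: eq_bigr => i _; rewrite (raddf_sum (mderiv i)) scaler_sumr.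
  by apply: eq_bigr => j _ /=; rewrite mderivZ scalerA.
rewrite !E exchange_big; apply: eq_bigr => i _; apply: eq_bigr => j _.
by rewrite mulrC mderiv_comm.
Qed.

Lemma dderiv_homog v p d : p \is d.+1.-homog -> dderiv v p \is d.-homog.
Proof. by move=> hp; apply: rpred_sum => i _; apply/dhomogZ/mderiv_homog. Qed.

End DirectionalDerivative.

Section FiniteForms.

Variables (K : fieldType) (V : vectType K).
Hypothesis Kclosed : alg_closed K.
Hypothesis char0 : forall n, n.+1%:R != 0 :> K.

Local Notation KV := {mpoly K[\dim {:V}]}.
Local Notation ev p v := (p : KV).@[coords v].

Lemma form_ext (p q : KV) : (forall v : V, ev p v = ev q v) -> p = q.
Proof.
move=> E; apply: (meval_inj Kclosed) => x; have [v vx] := coords_surj x.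
by rewrite -!(meval_eq _ vx).
Qed.

Lemma form_proportional (A L : KV) : A \is 1.-homog -> L \is 1.-homog ->
  (forall v : V, ev L v = 0 -> ev A v = 0) -> exists c, A = c *: L.
Proof.
move=> hA hL AL; have [[v1 Lv1]|nv] := pselect (exists v : V, ev L v != 0); last first.
  exists 0; rewrite scale0r; apply: form_ext => v; rewrite meval0 AL //.
  by apply/eqP; apply: contrapT => /negP h; apply: nv; exists v.
exists (ev A v1 / ev L v1); apply: form_ext => v; rewrite mevalZ.
have := AL (- (ev L v / ev L v1) *: v1 + v).
rewrite !ev_homog1 // => /(_ _) h; move: h; rewrite mulNr divfK // addNr.
by move=> /(_ erefl) /eqP; rewrite addr_eq0 => /eqP h; rewrite -[LHS]opprK -h; field.
Qed.

(* The equation of a hypersurface with a Galois point [v]: up to a linear change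
   of coordinates [F = M x^e + G] with [M] and [G] free of [x]. *)
Definition galois_form (F : KV) d e (v : V) :=
  exists M L, [/\ dderiv v F = M * L ^+ e.-1, L \is 1.-homog /\ ev L v != 0,
    M \is (d - e).-homog, dderiv v M = 0 & M != 0].

Variables (F : KV).
Hypothesis noncone : forall v : V, dderiv v F = 0 -> v = 0.

Let prop_line (v w : V) c : w != 0 -> w = c *: v -> <[w]>%VS = <[v]>%VS.
Proof.
move=> w0 wE; have c0 : c != 0 by apply: contraNneq w0 => c0; rewrite wE c0 scale0r.
apply/eqP; rewrite eqEsubv -!memvE wE rpredZ ?memv_line //=.
by rewrite -[v in v \in _](scalerK c0) rpredZ // memv_line.
Qed.

Lemma mixed_deriv k M0 L0 M L v0 v :
  dderiv v0 F = M0 * L0 ^+ k.+1 -> dderiv v F = M * L ^+ k.+1 ->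
  L0 \is 1.-homog -> L \is 1.-homog ->
  dderiv v M0 * L0 ^+ k.+1 + (k.+1%:R * ev L0 v)%:MP * (M0 * L0 ^+ k) =
  dderiv v0 M * L ^+ k.+1 + (k.+1%:R * ev L v0)%:MP * (M * L ^+ k).
Proof.
move=> D0 D hL0 hL; have := dderiv_comm v v0 F; rewrite D0 D.
have E (P Q : KV) w : Q \is 1.-homog -> dderiv w (P * Q ^+ k.+1) =
    dderiv w P * Q ^+ k.+1 + (k.+1%:R * ev Q w)%:MP * (P * Q ^+ k).
  move=> hQ; rewrite dderivM dderivXn (dderiv_form w hQ); congr (_ + _).
  by rewrite -mul_mpolyC mpolyCM /=; ring.
by rewrite !E.
Qed.

Lemma homog0_neq0 (M : KV) : M \is 0.-homog -> M != 0 -> exists2 c, c != 0 & M = c%:MP.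
Proof.
move=> /homog0_const -> h; exists M@_0%MM => //.
by apply: contraNneq h => ->; rewrite mpolyC0.
Qed.

(** Some combination of [v] and [v0], with nonzero coefficient at [v], annihilates [F]; off cones it
    is 0. *)
Lemma same_direction (v0 v : V) (M0 L0 M L : KV) k c0 c : v != 0 ->
  dderiv v0 F = M0 * L0 ^+ k -> dderiv v F = M * L ^+ k -> c0 != 0 ->
  c0 *: (M * L ^+ k) = c *: (M0 * L0 ^+ k) -> <[v]>%VS = <[v0]>%VS.
Proof.
move=> vn0 D0 D c0n E; apply: (@prop_line _ _ (c0^-1 * c)) => //.
apply: (scalerI c0n); rewrite scalerA mulrA mulfV // mul1r.
apply/eqP; rewrite -subr_eq0 -scaleNr; apply/eqP/noncone.
by rewrite dderivDl !dderivZl D0 D E scaleNr subrr.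
Qed.

(** [M] and [M0] are constants, so the mixed derivative equates multiples of [L0 ^+ k] and [L ^+ k].
    As [0 < k], the forms are proportional. *)
Lemma outer_neighbour k v0 M0 L0 v : (0 < k)%N -> v != 0 ->
  dderiv v0 F = M0 * L0 ^+ k.+1 -> L0 \is 1.-homog -> M0 \is 0.-homog -> M0 != 0 ->
  galois_form F k.+2 k.+2 v -> ev L0 v != 0 -> <[v]>%VS = <[v0]>%VS.
Proof.
move=> k0 vn0 D0 hL0 hM0 Mn0 [M [L [D [hL Lv]]]]; rewrite subnn => hM _ Mn L0v.
have [m0 m0n M0E] := homog0_neq0 hM0 Mn0; have [m mn ME] := homog0_neq0 hM Mn.
have := mixed_deriv D0 D hL0 hL; rewrite M0E ME !dderivC !mul0r !add0r => E.
have [c L0E] : exists c, L0 = c *: L.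
  apply: form_proportional => // x Lx.
  have := congr1 (meval (coords x)) E; rewrite !mevalM !mevalC !rmorphXn /= Lx.
  rewrite [0 ^+ _]expr0n (gtn_eqF k0) !mulr0 => /eqP.
  rewrite !mulf_eq0 (negbTE (char0 _)) (negbTE L0v) (negbTE m0n) /=.
  by rewrite expf_eq0 => /andP[_ /eqP].
apply: (same_direction (c0 := m0 * c ^+ k.+1) (c := m) vn0 D0 D).
  rewrite mulf_neq0 // expf_neq0 //; apply: contraNneq L0v => c0.
  by rewrite L0E c0 scale0r meval0.
by rewrite M0E ME L0E exprZn -!mul_mpolyC !mpolyCM; ring.
Qed.

(** * Comparison of two inner Galois points *)

Section Inner.

Variables (k : nat) (v0 : V) (M0 L0 : KV).
Hypotheses (k0 : (0 < k)%N) (D0 : dderiv v0 F = M0 * L0 ^+ k.+1).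
Hypotheses (hL0 : L0 \is 1.-homog) (hM0 : M0 \is 1.-homog) (L0v0 : ev L0 v0 = 1).
Hypotheses (M0v0 : ev M0 v0 = 0) (M0n : M0 != 0).

Variables (v : V) (M L : KV).
Hypotheses (D : dderiv v F = M * L ^+ k.+1) (hL : L \is 1.-homog) (hM : M \is 1.-homog).
Hypotheses (vn0 : v != 0) (Lv : ev L v != 0) (Mv : ev M v = 0) (L0v : ev L0 v = 1).
Hypothesis Mn : M != 0.

(** Cofactors of [L0 ^+ k] and [L ^+ k] in the mixed derivative; the comparison rests on
    divisibility in [L0 ^+ k * A = L ^+ k * A']. *)
Let A : KV := (ev M0 v)%:MP * L0 + k.+1%:R%:MP * M0.
Let A' : KV := (ev M v0)%:MP * L + (k.+1%:R * ev L v0)%:MP * M.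

Let AA : L0 ^+ k * A = L ^+ k * A'.
Proof.
have := mixed_deriv D0 D hL0 hL.
rewrite (dderiv_form v hM0) (dderiv_form v0 hM) L0v mulr1 => E.
rewrite /A /A' !mulrDr; rewrite !exprS in E.
by rewrite [LHS](_ : _ = (ev M0 v)%:MP * (L0 * L0 ^+ k) +
  k.+1%:R%:MP * (M0 * L0 ^+ k)); [rewrite E|]; ring.
Qed.

(** Evaluating [A = c ^+ k A'] at [v0] and at [v] gives two linear equations in [M0(v)] and
    [c^(k+1) M(v0)], with determinant [(k+2)^2 - 1 = (k+1)(k+3)]. Both unknowns vanish, and [M0] is
    a multiple of [M]. *)
Lemma inner_same_form c : L = c *: L0 -> <[v]>%VS = <[v0]>%VS.
Proof.
move=> LE; have c0 : c != 0 by apply: contraNneq Lv => c0; rewrite LE c0 scale0r meval0.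
have L00 : L0 != 0 by apply: contraNneq Lv => L00; rewrite LE L00 scaler0 meval0.
pose N := (c ^+ k)%:MP * A'.
have AN : A = N.
  apply: (mulfI (expf_neq0 k L00)); rewrite AA {1}LE exprZn -mul_mpolyC /N; ring.
pose b := ev M v0; pose b0 := ev M0 v.
have Lv0 : ev L v0 = c by rewrite LE mevalZ L0v0 mulr1.
have LvE : ev L v = c by rewrite LE mevalZ L0v mulr1.
have E0 := congr1 (meval (coords v0)) AN; have E1 := congr1 (meval (coords v)) AN.
rewrite /A /N /A' !(mevalD, mevalM, mevalC) L0v0 M0v0 Lv0 -/b -/b0 mulr0 mulr1 addr0 in E0.
rewrite /A /N /A' !(mevalD, mevalM, mevalC) L0v Mv Lv0 LvE -/b -/b0 mulr0 mulr1 addr0 in E1.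
have b00 : b0 = 0.
  have h : (k.+1 * k.+3)%:R * b0 = 0.
    have E2 : k.+2%:R * (b0 + k.+1%:R * b0) = k.+2%:R * (c ^+ k * (b * c)) by rewrite E1.
    have E3 : b0 = k.+2%:R * (c ^+ k * (b * c)).
      by rewrite E0 -[k.+2]addn1 natrD; ring.
    have {}E3 : b0 = k.+2%:R * (b0 + k.+1%:R * b0) by rewrite E2 -E3.
    have -> : (k.+1 * k.+3)%:R * b0 = k.+2%:R * (b0 + k.+1%:R * b0) - b0.
      by rewrite natrM -(addn2 k.+1) -(addn1 k.+1) !natrD; ring.
    by rewrite -E3 subrr.
  by move/eqP: h; rewrite mulnS addSn mulf_eq0 (negbTE (char0 _)) => /eqP.
have bz : b = 0.
  move/eqP: E1; rewrite b00 mulr0 addr0 eq_sym !mulf_eq0 expf_eq0 (negbTE c0) andbF.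
  by rewrite orbF => /eqP.
have ME : M0 = c ^+ k.+1 *: M.
  have := AN; rewrite /A /N /A' -/b -/b0 b00 bz mpolyC0 !mul0r !add0r Lv0 => h.
  apply: (mulfI (x := k.+1%:R%:MP)); first by rewrite mpolyC_eq0.
  by rewrite h -mul_mpolyC exprS !mpolyCM; ring.
apply: (same_direction (c0 := 1) (c := 1) vn0 D0 D); first exact: oner_neq0.
by rewrite !scale1r ME LE exprZn -!mul_mpolyC; ring.
Qed.

Hypothesis nprop : ~ exists c, L = c *: L0.

Let zker : exists z : V, ev L z = 0 /\ ev L0 z != 0.
Proof.
apply: contrapT => h; apply: nprop.
have [c cE] : exists c, L0 = c *: L.
  apply: form_proportional => // x Lx; apply/eqP; apply: contrapT => /negP L0x.
  by apply: h; exists x.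
exists c^-1; rewrite cE scalerA mulVf ?scale1r //.
by apply: contraTneq (oner_neq0 K) => c0; rewrite -L0v cE c0 scale0r meval0 eqxx.
Qed.

Let hA : A \is 1.-homog.
Proof. by rewrite /A !mul_mpolyC; apply: rpredD; apply: dhomogZ. Qed.

Let An0 : A != 0.
Proof.
apply: contraTneq (oner_neq0 K) => A0.
have b0 : ev M0 v = 0.
  have := congr1 (meval (coords v0)) A0.
  by rewrite /A !(mevalD, mevalM, mevalC) L0v0 M0v0 mulr0 addr0 mulr1.
move/eqP: A0; rewrite /A b0 mpolyC0 mul0r add0r mulf_eq0 mpolyC_eq0.
by rewrite (negbTE (char0 _)) (negbTE M0n).
Qed.

(** As [0 < k], [A] vanishes at the zeros of [L] that are not zeros of [L0]; adding such a zero [z]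
    reaches the remaining ones by linearity. *)
Let Aprop : exists2 c, c != 0 & A = c *: L.
Proof.
have [z [Lz L0z]] := zker.
have A0 x : ev L x = 0 -> ev L0 x != 0 -> ev A x = 0.
  move=> Lx L0x; have := congr1 (meval (coords x)) AA.
  rewrite !mevalM !rmorphXn /= Lx [0 ^+ _]expr0n (gtn_eqF k0) mul0r => /eqP.
  by rewrite mulf_eq0 expf_eq0 (negbTE L0x) andbF => /eqP.
have [c cE] : exists c, A = c *: L.
  apply: form_proportional => // x Lx.
  have [L0x|] := eqVneq (ev L0 x) 0; last exact: A0.
  have := A0 (x + z); rewrite !(ev_homog1D _ _ hL, ev_homog1D _ _ hL0, ev_homog1D _ _ hA).
  by rewrite Lx Lz L0x !add0r (A0 z Lz L0z) addr0; apply.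
exists c => //; apply: contraNneq An0 => c0; by rewrite cE c0 scale0r.
Qed.

(** With [A] a multiple of [L], one factor [L] cancels. If [1 < k], another remains on the right and
    vanishes at [z], where [L0] does not. *)
Lemma inner_k1 : k = 1%N.
Proof.
have [c cn cE] := Aprop; have [z [Lz L0z]] := zker.
have Ln : L != 0 by apply: contraNneq Lv => ->; rewrite meval0.
case: k k0 AA => [|[|j]] // _ E; exfalso.
have : c *: L0 ^+ j.+2 = L ^+ j.+1 * A'.
  apply: (mulfI Ln); move: E; rewrite cE => E; rewrite [RHS]mulrA -exprS -E.
  by rewrite -!mul_mpolyC; ring.
have evX (p : KV) n : meval (coords z) (p ^+ n) = ev p z ^+ n by apply: rmorphXn.
move=> /(congr1 (meval (coords z))); rewrite mevalZ (mevalM (coords z) (L ^+ j.+1)).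
rewrite (evX L0) (evX L) Lz expr0n mul0r.
by move/eqP; rewrite mulf_eq0 (negbTE cn) expf_eq0 (negbTE L0z).
Qed.

(** For [k = 1], [L] is proportional to [A = 2 (M0 + s L0)], where [s = M0(v) / 2]. The mixed
    derivative then determines [M] up to a scalar that [M(v) = 0] fixes; [3 s^2] clears the
    denominators. *)
Lemma inner_normal_form : exists s,
  [/\ s != 0, ev M0 v = 2 * s &
    (3 * s ^+ 2)%:MP * dderiv v F = - (M0 - (2 * s)%:MP * L0) * (M0 + s%:MP * L0) ^+ 2].
Proof.
have [c cn cE] := Aprop; have k1 := inner_k1.
pose s := ev M0 v / 2.
have two : 2 != 0 :> K := char0 1.
have sE : ev M0 v = 2 * s by rewrite /s mulrCA mulfV // mulr1.
pose L1 := M0 + s%:MP * L0.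
have LE : L = (2 / c) *: L1.
  apply: (scalerI cn); rewrite -cE scalerA mulrCA mulfV // mulr1 /A k1 sE /L1.
  by rewrite -mul_mpolyC !mpolyCM; ring.
pose M1 := (2 / c) ^+ 2 *: M.
have D1 : dderiv v F = M1 * L1 ^+ 2.
  by rewrite D k1 LE exprZn /M1 -!mul_mpolyC; ring.
have hL1 : L1 \is 1.-homog by rewrite /L1 mul_mpolyC rpredD // dhomogZ.
have hM1 : M1 \is 1.-homog by apply: dhomogZ.
have L1v0 : ev L1 v0 = s by rewrite mevalD mevalM mevalC M0v0 L0v0 add0r mulr1.
have M1v : ev M1 v = 0 by rewrite mevalZ Mv mulr0.
have M1n : M1 != 0.
  by rewrite /M1 scaler_eq0 negb_or Mn andbT expf_neq0 // mulf_neq0 // invr_neq0.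
have sn : s != 0.
  apply: contraNneq Lv => s0; rewrite LE mevalZ mevalD mevalM mevalC sE s0.
  by rewrite mulr0 mul0r addr0 mulr0.
have D0' : dderiv v0 F = M0 * L0 ^+ 2 by rewrite D0 k1.
have L1n : L1 != 0 by apply: contraNneq sn => L10; rewrite -L1v0 L10 meval0.
have E := @mixed_deriv 1 M0 L0 M1 L1 v0 v D0' D1 hL0 hL1.
rewrite (dderiv_form v hM0) (dderiv_form v0 hM1) L0v L1v0 sE in E.
pose bb := ev M1 v0.
have E2 : 2%:MP * L0 = bb%:MP * L1 + (2 * s)%:MP * M1.
  apply: (mulfI L1n); have -> : L1 * (2%:MP * L0) =
    (2 * s)%:MP * L0 ^+ 2 + (2 * 1)%:MP * (M0 * L0 ^+ 1).
    by rewrite /L1 !mpolyCM mpolyC1; ring.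
  by rewrite E -/bb; ring.
have b3 : bb * (3 * s) = 2.
  have := congr1 (meval (coords v)) E2; rewrite !(mevalD, mevalM, mevalC) L0v sE M1v.
  by rewrite mulr0 addr0 mulr1 => ->; ring.
have S3 : bb%:MP * (3%:MP * s%:MP) = 2%:MP :> KV by rewrite -!mpolyCM b3.
exists s; split=> //; rewrite D1 -/L1 mulrA; congr (_ * _).
apply: (mulfI (x := 2%:MP)); first by rewrite mpolyC_eq0.
have -> : 2%:MP * ((3 * s ^+ 2)%:MP * M1) = 3%:MP * s%:MP * ((2 * s)%:MP * M1).
  by rewrite !mpolyCM; ring.
have -> : (2 * s)%:MP * M1 = 2%:MP * L0 - bb%:MP * L1 by rewrite E2 addrC addKr.
have -> : 3%:MP * s%:MP * (2%:MP * L0 - bb%:MP * L1) =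
  3%:MP * s%:MP * 2%:MP * L0 - bb%:MP * (3%:MP * s%:MP) * L1 by ring.
rewrite S3 /L1 !mpolyCM.
have -> : 3%:MP = 2%:MP + 1 :> KV by rewrite -mpolyC1 -mpolyCD; congr (_%:MP); ring.
by ring.
Qed.

End Inner.

Section TwoNeighbours.

Variables (v0 : V) (M0 L0 : KV).
Hypotheses (D0 : dderiv v0 F = M0 * L0 ^+ 2).
Hypotheses (hL0 : L0 \is 1.-homog) (hM0 : M0 \is 1.-homog) (L0v0 : ev L0 v0 = 1).
Hypotheses (M0v0 : ev M0 v0 = 0) (M0n : M0 != 0).

Definition inner_normal (v : V) s :=
  [/\ s != 0, ev L0 v = 1, ev M0 v = 2 * s &
    (3 * s ^+ 2)%:MP * dderiv v F = - (M0 - (2 * s)%:MP * L0) * (M0 + s%:MP * L0) ^+ 2].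

Lemma inner_normal_inj v w s : inner_normal v s -> inner_normal w s -> v = w.
Proof.
move=> [sn _ _ Dv] [_ _ _ Dw]; apply/eqP; rewrite -subr_eq0; apply/eqP/noncone.
rewrite dderivDl -scaleN1r dderivZl scaleN1r; apply/eqP; rewrite subr_eq0; apply/eqP.
apply: (mulfI (x := (3 * s ^+ 2)%:MP)); last by rewrite Dv Dw.
by rewrite mpolyC_eq0 mulf_neq0 ?expf_neq0 // (char0 2).
Qed.

(** The coefficients of [w] make [L0] and [M0] vanish at [w], so [D_w] kills [D_v1 F], a polynomial
    in these two forms. But [D_w F] is [s1^3 - s2^3] times [M0^3] up to a nonzero scalar, and [D_v1]
    does not kill [M0^3]. *)
Lemma inner_normal_cube v1 v2 s1 s2 : inner_normal v1 s1 -> inner_normal v2 s2 ->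
  s1 ^+ 3 = s2 ^+ 3.
Proof.
move=> [sn1 L1 M1 D1] [sn2 L2 M2 D2].
pose w := (s1 - s2) *: v0 + (s2 *: v1 + (- s1) *: v2).
have Lw : ev L0 w = 0.
  by rewrite ev_homog1 // ev_homog1 // ev_homog1Z // L0v0 L1 L2; ring.
have Mw : ev M0 w = 0.
  by rewrite ev_homog1 // ev_homog1 // ev_homog1Z // M0v0 M1 M2; ring.
pose c : KV := (3 * s1 ^+ 2 * s2 ^+ 2)%:MP.
have Dw : c * dderiv w F = (s1 ^+ 3 - s2 ^+ 3)%:MP * M0 ^+ 3.
  rewrite !dderivDl !dderivZl D0 -!mul_mpolyC.
  have -> : c * ((s1 - s2)%:MP * (M0 * L0 ^+ 2) + (s2%:MP * dderiv v1 F +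
      (- s1)%:MP * dderiv v2 F)) = c * (s1 - s2)%:MP * (M0 * L0 ^+ 2) +
    (s2 ^+ 3)%:MP * ((3 * s1 ^+ 2)%:MP * dderiv v1 F) -
    (s1 ^+ 3)%:MP * ((3 * s2 ^+ 2)%:MP * dderiv v2 F).
    rewrite /c !(mpolyCM, mpolyCN); ring.
  rewrite D1 D2 /c mpolyCB (mpolyCB _ (s1 ^+ 3)) !(mpolyCM, rmorphXn) /=.
  have -> : 3%:MP = 3 :> KV by apply: rmorph_nat.
  have -> : 2%:MP = 2 :> KV by apply: rmorph_nat.
  by move: s1%:MP s2%:MP => x y; ring.
have D1w : (3 * s1 ^+ 2)%:MP * dderiv w (dderiv v1 F) = 0.
  have := congr1 (dderiv w) D1; rewrite dderivM dderivC mul0r add0r => ->.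
  rewrite dderivM dderivXn dderivN !dderivD dderivN !dderivM !dderivC.
  by rewrite !dderiv_form // Lw Mw mpolyC0; ring.
have := congr1 (fun p => (3 * s1 ^+ 2)%:MP * dderiv v1 p) Dw.
rewrite (dderivM v1 c) (dderivM v1 (s1 ^+ 3 - s2 ^+ 3)%:MP) !dderivC !mul0r !add0r.
rewrite mulrCA dderiv_comm D1w mulr0.
rewrite dderivXn dderiv_form // M1 => H.
have : ((3 * s1 ^+ 2) * (6 * s1) * (s1 ^+ 3 - s2 ^+ 3))%:MP * (M0 * M0) = 0.
  rewrite [RHS]H -mul_mpolyC /= !mpolyCM.
  have -> : 6%:MP = 3%:MP * 2%:MP :> KV by rewrite -mpolyCM; congr (_%:MP); ring.
  by ring.
move/eqP; rewrite mulf_eq0 (mulf_eq0 M0) (negbTE M0n) !orbF mpolyC_eq0 !mulf_eq0.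
by rewrite (negbTE (char0 5)) (negbTE (char0 2)) (negbTE sn1) /= subr_eq0 => /eqP.
Qed.

End TwoNeighbours.


Lemma galois_form_scale d e v c : c != 0 -> galois_form F d e v -> galois_form F d e (c *: v).
Proof.
move=> cn [M [L [D [hL Lv] hM DM Mn]]]; exists (c *: M), L; split=> //.
- by rewrite dderivZl D scalerAl.
- by split=> //; rewrite ev_homog1Z // mulf_neq0.
- exact: dhomogZ.
- by rewrite dderivZl dderivZ DM !scaler0.
- by rewrite scaler_eq0 negb_or cn.
Qed.

Let line_scale (v : V) c : c != 0 -> <[c *: v]>%VS = <[v]>%VS.
Proof.
move=> c0; have [->|v0] := eqVneq v 0; first by rewrite scaler0.
by apply: (@prop_line _ _ c) => //; rewrite scaler_eq0 negb_or c0.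
Qed.

Lemma finite_inner_normal v0 M0 L0 : dderiv v0 F = M0 * L0 ^+ 2 ->
  L0 \is 1.-homog -> M0 \is 1.-homog -> ev L0 v0 = 1 -> ev M0 v0 = 0 -> M0 != 0 ->
  finite_set [set P : {vspace V} | exists v s, inner_normal M0 L0 v s /\ P = <[v]>%VS].
Proof.
move=> D0 hL0 hM0 L0v0 M0v0 M0n.
have [[v1 [s1 N1]]|none] := pselect (exists v s, inner_normal M0 L0 v s); last first.
  rewrite (_ : [set _ | _] = set0); first exact: finite_set0.
  by apply/seteqP; split=> // P [v [s [h _]]]; apply: none; exists v, s.
have [|rs rsP] := @all_roots K ('X^3 - (s1 ^+ 3)%:P).
  by rewrite -size_poly_eq0 size_XnsubC.
pose f s : {vspace V} :=
  if pselect (exists v, inner_normal M0 L0 v s) is left h then <[projT1 (cid h)]>%VS else 0%VS.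
apply: (@sub_finite_set _ _ (f @` [set` rs])); last exact/finite_image/finite_seq.
move=> P [v [s [N ->]]]; exists s.
  apply: rsP; rewrite rootE !hornerE subr_eq0; apply/eqP.
  exact: (inner_normal_cube D0 hL0 hM0 L0v0 M0v0 M0n N N1).
rewrite /f; case: pselect => [h|[]]; last by exists v.
by rewrite (inner_normal_inj (projT2 (cid h)) N).
Qed.

(* Mixed derivatives: outer points with [L0 v != 0] coincide with [v0]; so do inner
   ones, except for [d = 4], where they inject into the cube roots of a constant. *)
Lemma finite_neighbours d e v0 M0 L0 : (4 <= d)%N -> e = d \/ e = d.-1 ->
  dderiv v0 F = M0 * L0 ^+ e.-1 -> L0 \is 1.-homog -> ev L0 v0 = 1 ->
  M0 \is (d - e).-homog -> dderiv v0 M0 = 0 -> M0 != 0 ->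
  finite_set [set P : {vspace V} |
    exists v, [/\ v != 0, P = <[v]>%VS, galois_form F d e v & ev L0 v != 0]].
Proof.
move=> d4 ed D0 hL0 L0v0 hM0 DM0 M0n.
(* The degree is [k + 3]: [0 < k] is the hypothesis [4 <= d], and [k = 1] is the quartic case. *)
case: d d4 ed hM0 => [|[|[|k]]] // k0 ed hM0.
case: ed => ee; subst e.
  apply: (@sub_finite_set _ _ [set <[v0]>%VS]); last exact: finite_set1.
  move=> P [v [vn -> G Lv]]; rewrite subnn in hM0.
  exact: (outer_neighbour (k := k.+1) _ vn D0 hL0 hM0 M0n G Lv).
rewrite /= subSnn in hM0 D0 *.
have M0v0 : ev M0 v0 = 0.
  by apply/eqP; rewrite -(mpolyC_eq0 (\dim {:V})) -(dderiv_form v0 hM0) DM0.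
have [k1|kn1] := eqVneq k 1%N; last first.
  apply: (@sub_finite_set _ _ [set <[v0]>%VS]); last exact: finite_set1.
  move=> P [v [vn -> G L0v]] /=; have cn := invr_neq0 L0v.
  rewrite -(line_scale v cn).
  have [M [L []]] := galois_form_scale cn G; set w := _ *: v => D [hL Lw].
  rewrite subSnn => hM DM Mn /=.
  have wn : w != 0 by rewrite scaler_eq0 negb_or cn.
  have L0w : ev L0 w = 1 by rewrite ev_homog1Z // mulVf.
  have Mw : ev M w = 0 by apply/eqP; rewrite -(mpolyC_eq0 (\dim {:V})) -(dderiv_form w hM) DM.
  have [[c cE]|nprop] := pselect (exists c, L = c *: L0).
    exact: (inner_same_form D0 hL0 hM0 L0v0 M0v0 D hL hM wn Lw Mw L0w cE).
  case/eqP: kn1.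
  exact: (inner_k1 k0 D0 hL0 hM0 L0v0 M0v0 M0n D hL hM Lw L0w nprop).
subst k; have N := finite_inner_normal D0 hL0 hM0 L0v0 M0v0 M0n.
apply: (@sub_finite_set _ _ ([set <[v0]>%VS] `|`
  [set P : {vspace V} | exists v s, inner_normal M0 L0 v s /\ P = <[v]>%VS])); last first.
  by rewrite finite_setU; split=> //; apply: finite_set1.
move=> P [v [vn -> G L0v]] /=; have cn := invr_neq0 L0v.
rewrite -(line_scale v cn).
have [M [L []]] := galois_form_scale cn G; set w := _ *: v => D [hL Lw].
rewrite subSnn => hM DM Mn /=.
have wn : w != 0 by rewrite scaler_eq0 negb_or cn.
have L0w : ev L0 w = 1 by rewrite ev_homog1Z // mulVf.
have Mw : ev M w = 0 by apply/eqP; rewrite -(mpolyC_eq0 (\dim {:V})) -(dderiv_form w hM) DM.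
have [[c cE]|nprop] := pselect (exists c, L = c *: L0).
  by left; exact: (inner_same_form D0 hL0 hM0 L0v0 M0v0 D hL hM wn Lw Mw L0w cE).
right; have [s [sn Ms E]] :=
  inner_normal_form (ltn0Sn 0) D0 hL0 hM0 L0v0 M0v0 M0n D hL hM Lw Mw L0w Mn nprop.
by exists w, s.
Qed.

Lemma exists_subspace (P : V -> Prop) :
  P 0 -> (forall c v w, P v -> P w -> P (c *: v + w)) ->
  exists W : {vspace V}, forall v, v \in W <-> P v.
Proof.
move=> P0 PL; pose Q n := exists2 W : {vspace V}, \dim W = n & forall v, v \in W -> P v.
have Q0 : exists n, `[< Q n >].
  exists 0%N; apply/asboolP; exists 0%VS; first exact: dimv0.
  by move=> v; rewrite memv0 => /eqP ->.
have Qb n : `[< Q n >] -> (n <= \dim {:V})%N by move=> /asboolP [W <- _]; exact/dimvS/subvf.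
have [n /asboolP [W dW WP] nmax] := ex_maxnP Q0 Qb.
exists W => v; split; first exact: WP.
move=> Pv; have : (\dim (<[v]> + W)%VS <= \dim W)%N.
  rewrite dW; apply: nmax; apply/asboolP; exists (<[v]> + W)%VS => // x.
  by move=> /memv_addP [_ /vlineP [c ->] [w wW ->]]; apply/PL/WP.
move=> h; suff -> : W = (<[v]> + W)%VS by rewrite (subvP (addvSl _ _)) ?memv_line.
by apply/eqP; rewrite eqEdim addvSr.
Qed.

Lemma finite_galois_forms d e : (4 <= d)%N -> e = d \/ e = d.-1 ->
  finite_set [set P : {vspace V} | exists v, [/\ v != 0, P = <[v]>%VS & galois_form F d e v]].
Proof.
move=> d4 ed.
suff H n (U : {vspace V}) : (\dim U <= n)%N -> finite_set [set P : {vspace V} |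
    exists v, [/\ v != 0, v \in U, P = <[v]>%VS & galois_form F d e v]].
  apply: (sub_finite_set _ (H _ fullv (leqnn _))) => P [v [vn -> G]].
  by exists v; rewrite memvf.
elim: n U => [|n IH] U dU.
  rewrite (_ : [set _ | _] = set0); first exact: finite_set0.
  apply/seteqP; split=> // P [v [vn vU _ _]]; case/negP: vn.
  by move: vU; move: dU; rewrite leqn0 dimv_eq0 => /eqP ->; rewrite memv0.
have [[v [vn vU G]]|none] :=
    pselect (exists v, [/\ v != 0, v \in U & galois_form F d e v]); last first.
  rewrite (_ : [set _ | _] = set0); first exact: finite_set0.
  by apply/seteqP; split=> // P [v [vn vU _ G]]; apply: none; exists v.
have [M0 [L0 [D0 [hL0 L0v] hM0 DM0 M0n]]] := G.
have cn := invr_neq0 L0v.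
have [W WP] : exists W : {vspace V}, forall x, x \in W <-> x \in U /\ ev L0 x = 0.
  apply: exists_subspace => [|c x y [xU Lx] [yU Ly]].
    by rewrite mem0v -[in ev _ _](scale0r v) ev_homog1Z // mul0r.
  by rewrite rpredD ?rpredZ // ev_homog1 // Lx Ly mulr0 addr0.
have WU : (\dim W <= n)%N.
  rewrite -ltnS (leq_trans _ dU) // ltnNge; apply/negP => h.
  have UW : (W <= U)%VS by apply/subvP => x /WP [].
  have WE : W = U by apply/eqP; rewrite eqEdim UW.
  by move: vU; rewrite -{1}WE => /WP [_ /eqP]; apply/negP.
have N : finite_set [set P : {vspace V} |
    exists v, [/\ v != 0, P = <[v]>%VS, galois_form F d e v & ev L0 v != 0]].
  apply: (@finite_neighbours d e ((ev L0 v)^-1 *: v) ((ev L0 v)^-1 *: M0) L0) => //.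
  - by rewrite dderivZl D0 scalerAl.
  - by rewrite ev_homog1Z // mulVf.
  - exact: dhomogZ.
  - by rewrite dderivZl dderivZ DM0 !scaler0.
  - by rewrite scaler_eq0 negb_or cn.
have FW := IH W WU.
have Z := eq_ind_r id (conj FW N) (finite_setU _ _); apply: (sub_finite_set _ Z).
move=> P [x [xn xU PE Gx]]; have [Lx|Lx] := eqVneq (ev L0 x) 0; last by right; exists x.
by left; exists x; split=> //; apply/WP.
Qed.

End FiniteForms.

(** * Galois points have a normal form *)

Section Derivations.

Lemma mpoly_gen (R : comNzRingType) n (P : {mpoly R[n]} -> Prop) :
  (forall c, P c%:MP) -> (forall i, P 'X_i) ->
  (forall p q, P p -> P q -> P (p + q)) ->
  (forall p q, P p -> P q -> P (p * q)) -> forall p, P p.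
Proof.
move=> PC PX PD PM; elim/mpolyind => [|c m p _ _ IH].
  by rewrite -mpolyC0; apply: PC.
apply: PD => //; rewrite -mul_mpolyC; apply: (PM) => //.
rewrite mpolyXE_id; apply: (big_ind P); [by rewrite -mpolyC1; apply: PC|exact: PM|move=> i _].
elim: (m i) => [|k IHk]; first by rewrite expr0 -mpolyC1.
by rewrite exprS; apply: PM.
Qed.

Lemma mderivXU (R : comNzRingType) n i j :
  ('X_j : {mpoly R[n]})^`M(i) = (i == j)%:R.
Proof.
rewrite mderivX mnm1E eq_sym; case: eqP => [->|_]; last by rewrite scale0r.
by rewrite scale1r -[X in (X - _)%MM]add0m addmK mpolyX0.
Qed.

(** Both sides are additive, obey the Leibniz rule along [f], and agree on constants and
    variables. *)
Lemma chain_rule (R : comNzRingType) n (A : comNzRingType)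
    (f : {rmorphism {mpoly R[n]} -> A}) (D : A -> A) :
  (forall x y, D (x + y) = D x + D y) ->
  (forall x y, D (x * y) = D x * y + x * D y) ->
  (forall c, D (f c%:MP) = 0) ->
  forall p, D (f p) = \sum_i f p^`M(i) * D (f 'X_i).
Proof.
move=> DD DM DC; apply: mpoly_gen => [c|i|p q IHp IHq|p q IHp IHq].
- by rewrite DC big1 // => i _; rewrite mderivC rmorph0 mul0r.
- rewrite (bigD1 i) //= big1 => [|j ji].
    by rewrite addr0 mderivXU eqxx rmorph1 mul1r.
  by rewrite mderivXU (negbTE ji) rmorph0 mul0r.
- rewrite rmorphD DD IHp IHq -big_split; apply: eq_bigr => i _.
  by rewrite mderivD rmorphD mulrDl.
- rewrite rmorphM DM IHp IHq mulr_suml mulr_sumr -big_split; apply: eq_bigr => i _ /=.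
  by rewrite mderivM rmorphD !rmorphM; ring.
Qed.

Variables (K : fieldType) (N m : nat).
Variables (e0 : 'I_N -> K) (e : 'I_m -> 'I_N -> K).

Lemma coef_linear (R : nzRingType) (a b : R) s :
  (a%:P * 'X + b%:P)`_s = if s is s'.+1 then (if s' is 0 then a else 0) else b.
Proof.
rewrite coefD mul_polyC coefZ coefX coefC.
by case: s => [|[|s]]; rewrite /= ?mulr0 ?mulr1 ?add0r ?addr0.
Qed.

Lemma deriv_to_frame p :
  deriv (to_frame e0 e p) = to_frame e0 e (\sum_i e0 i *: p^`M(i)).
Proof.
pose f : {rmorphism {mpoly K[N]} -> {poly {mpoly K[m]}}} := to_frame e0 e.
rewrite -[to_frame e0 e p]/(f p) (chain_rule (f := f)) => [|x y|x y|c].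
- rewrite (rmorph_sum f); apply: eq_bigr => i _.
  rewrite /f /= to_frameZ to_frameX derivD derivM !derivC derivX mul0r add0r addr0 mulr1.
  exact: mulrC.
- exact: derivD.
- exact: derivM.
- by rewrite /f /= to_frameC derivC.
Qed.

Lemma mderiv_to_frame j p i :
  ((to_frame e0 e p)`_i)^`M(j) = (to_frame e0 e (\sum_k e j k *: p^`M(k)))`_i.
Proof.
pose f : {rmorphism {mpoly K[N]} -> {poly {mpoly K[m]}}} := to_frame e0 e.
pose D (P : {poly {mpoly K[m]}}) : {poly {mpoly K[m]}} := map_poly (mderiv j) P.
have DE P k : (D P)`_k = (P`_k)^`M(j) by rewrite coef_map_id0 // linear0.
suff E : D (f p) = f (\sum_k e j k *: p^`M(k)) by rewrite -DE -[to_frame e0 e p]/(f p) E.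
have -> : D (f p) = \sum_k f p^`M(k) * D (f 'X_k); last first.
  rewrite (rmorph_sum f); apply: eq_bigr => k _.
  rewrite /f /= to_frameZ to_frameX mulrC; congr (_ * _).
  apply/polyP => s; rewrite DE coef_linear [RHS]coefC; case: s => [|[|s]] /=.
  - rewrite (raddf_sum (mderiv j)) (bigD1 j) //= big1 => [|k' kj].
      by rewrite addr0 mderivZ mderivXU eqxx -mul_mpolyC mulr1.
    by rewrite mderivZ mderivXU eq_sym (negbTE kj) scaler0.
  - exact: mderivC.
  - exact: linear0.
apply: (chain_rule (f := f)) => [x y|x y|c].
- by apply/polyP => s; rewrite coefD !DE coefD mderivD.
- apply/polyP => s; rewrite coefD DE !coefM (raddf_sum (mderiv j)) -big_split.
  by apply: eq_bigr => k _ /=; rewrite mderivM !DE.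
- have -> : D (f c%:MP) = D c%:MP%:P by congr D; apply: to_frameC.
  apply/polyP => s; rewrite DE [RHS]coef0 (coefC c%:MP).
  by case: ifP => _; [apply: mderivC|apply: linear0].
Qed.

End Derivations.

Section FramePoints.

Variables (K : fieldType) (N m : nat).
Hypothesis Kclosed : alg_closed K.

Lemma homog1_sum (p : {mpoly K[N]}) k (z : 'I_k -> K) (e : 'I_k -> 'I_N -> K) :
  p \is 1.-homog -> p.@[fun i => \sum_j z j * e j i] = \sum_j z j * p.@[e j].
Proof.
move=> /homog_lin ->; rewrite (raddf_sum (meval _)) /=.
under [RHS]eq_bigr do rewrite (raddf_sum (meval _)) mulr_sumr.
rewrite exchange_big; apply: eq_bigr => i _ /=.
by rewrite mevalZ mevalXU mulr_sumr; apply: eq_bigr => j _; rewrite mevalZ mevalXU; ring.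
Qed.

Variables (e0 : 'I_N -> K) (e : 'I_m -> 'I_N -> K).

(** The top coefficient along [e0] is a nonzero constant, so the equation keeps its positive degree
    over every base point [y]. *)
Lemma fiber_point (p : {mpoly K[N]}) d y : p \is d.-homog -> (0 < d)%N -> p.@[e0] != 0 ->
  exists s, p.@[fun i => s * e0 i + \sum_j y j * e j i] = 0.
Proof.
move=> hp d0 p0; have [|s] := Kclosed (p := map_poly (meval y) (to_frame e0 e p)).
  have sF := size_frame e hp p0; have tF := coef_top_to_frame e0 e hp.
  rewrite size_map_poly_id0.
    by apply/eqP => h1; move: (etrans (esym sF) h1) d0 => [->].
  have -> : lead_coef (to_frame e0 e p) = (p.@[e0])%:MP.
    by rewrite -tF; apply: (congr1 (fun k => (to_frame e0 e p)`_k.-1) sF).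
  by rewrite mevalC.
by rewrite rootE meval_to_frame => /eqP ps; exists s.
Qed.

Variables (x0 : {mpoly K[N]}) (l : m.-tuple {mpoly K[N]}).
Hypothesis frame : dual_frame e0 e x0 l.

Lemma frame_point x i :
  x i = x0.@[x] * e0 i + \sum_j (tnth l j).@[x] * e j i.
Proof.
case: frame => _ _ _ _ XE.
have := congr1 (meval x) (XE i); rewrite mevalXU mevalD mevalZ (raddf_sum (meval _)) mulrC => ->.
by congr (_ + _); apply: eq_bigr => j _; rewrite /= mevalZ mulrC.
Qed.

Lemma meval_coef0_to_frame p y :
  ((to_frame e0 e p)`_0).@[y] = p.@[fun i => \sum_j y j * e j i].
Proof.
have -> : p.@[fun i => \sum_j y j * e j i] = p.@[fun i => 0 * e0 i + \sum_j y j * e j i].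
  by apply: meval_eq => i; rewrite mul0r add0r.
by rewrite -meval_to_frame horner_coef0 coef_map.
Qed.

Lemma translation_frame h :
  (forall x s, h.@[fun i => x i + s * e0 i] = h.@[x]) ->
  h = (to_frame e0 e h)`_0 \mPo l.
Proof.
move=> inv; apply: (meval_inj Kclosed) => x; rewrite comp_mpoly_meval meval_coef0_to_frame.
rewrite -(inv (fun i => \sum_j (tnth l j).@[x] * e j i) x0.@[x]); apply: meval_eq => i.
rewrite [LHS]frame_point addrC; congr (_ + _).
Qed.

End FramePoints.

(** With [M], suitably scaled, as first coordinate of a frame, the hypothesis says that 0 is a root,
    and the factor theorem applies. *)
Lemma linear_form_dvd (K : fieldType) m (M p : {mpoly K[m]}) : alg_closed K ->
  M \is 1.-homog -> M != 0 -> (forall y, M.@[y] = 0 -> p.@[y] = 0) ->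
  exists q, p = M * q.
Proof.
move=> Kclosed hM Mn Mp.
have [y My] : exists y, M.@[y] != 0.
  apply: contrapT => /forallNP h; case/negP: Mn; apply/eqP/(meval_eq0 Kclosed) => y.
  by apply/eqP/negPn/negP.
have hM' : (M.@[y])^-1 *: M \is 1.-homog by apply: dhomogZ.
have [|e [l fr]] := exists_dual_frame hM' (w := y); first by rewrite mevalZ mulVf.
have /factor_theorem [Q QE] : root (to_frame y e p) 0.
  rewrite rootE horner_coef0; apply/eqP/(meval_eq0 Kclosed) => z.
  rewrite meval_coef0_to_frame; apply: Mp.
  rewrite homog1_sum //; apply: big1 => j _.
  case: fr => _ _ [_ /(_ j)] + _ _; rewrite mevalZ => /eqP.
  by rewrite mulf_eq0 invr_eq0 (negbTE My) => /eqP ->; rewrite mulr0.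
exists ((M.@[y])^-1 *: of_frame ((M.@[y])^-1 *: M) l Q).
rewrite -[LHS](to_frameK fr) QE polyC0 subr0 (rmorphM (of_frame _ l)).
transitivity (of_frame ((M.@[y])^-1 *: M) l Q * ((M.@[y])^-1 *: M)).
  by congr (_ * _); apply: of_frameX.
by rewrite -!scalerAr mulrC scalerAl.
Qed.

Lemma fraction_numden (R : idomainType) (u : {fraction R}) :
  exists n d : R, d != 0 /\ u = tofrac n / tofrac d.
Proof.
elim/quotW: u => x; exists (frac x).1, (frac x).2; split; first exact: denom_ratioP.
have d0 : tofrac (frac x).2 != 0 by rewrite tofrac_eq0 denom_ratioP.
apply: (canRL (mulfK d0)); rewrite -[LHS]/(FracField.mul _ _) !piE /FracField.mulf.
rewrite !numden_Ratio ?oner_eq0 // mulr1; apply/eqmodP; rewrite /= FracField.equivfE.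
by rewrite !numden_Ratio ?oner_eq0 ?denom_ratioP // mulr1 mulrC.
Qed.

(** * The function field of a hypersurface *)

Section Hypersurface.

Variables (K : fieldType) (V : vectType K) (X : hypersurface V).

Local Notation KV := {mpoly K[\dim {:V}]}.
Local Notation F := (hpoly X).

Lemma hidealP p : hideal X p <-> exists q, p = q * F.
Proof. by split=> [/asboolP|?]; last exact/asboolP. Qed.

(** One morphism with three properties, to be used in place of the quotient ring and its field of
    fractions. *)
Lemma exists_class : exists phi : {rmorphism KV -> fraction_field X},
  [/\ forall a b, ratfun X a b = phi a / phi b,
      forall p, (phi p == 0) = hideal X p &
      forall u, exists g h, phi h != 0 /\ u = phi g / phi h].
Proof.
pose pi : {rmorphism KV -> coordinate_ring X} :=
  \pi_({ideal_quot (vanishing_ideal X)}).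
pose phi : {rmorphism KV -> fraction_field X} := (@tofrac (coordinate_ring X)) \o pi.
have phi0 p : (phi p == 0) = hideal X p.
  rewrite /phi /= tofrac_eq0 -(rmorph0 pi).
  by have := @Quotient.idealrBE _ (vanishing_ideal X) p 0; rewrite subr0 => <-.
exists phi; split=> // u.
have [a [b [b0 ->]]] := fraction_numden u.
move: b0; rewrite -[a]reprK -[b]reprK => b0.
by exists (repr a), (repr b); rewrite -tofrac_eq0 in b0; split.
Qed.

End Hypersurface.

(** * Normality from a plane off the singular locus *)

Section Normality.

Variables (K : fieldType) (V : vectType K).
Hypothesis Kclosed : alg_closed K.

Local Notation KV := {mpoly K[\dim {:V}]}.
Local Notation ev p v := (p : KV).@[coords v].

Variables (F : KV) (d : nat).
Hypothesis Fh : F \is d.-homog.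

Lemma pihomog_multiple n k j (f g : {mpoly K[n]}) :
  f \is j.-homog -> exists q, pihomog mdeg k (g * f) = q * f.
Proof.
move=> hf; rewrite mulrC; have [jk|kj] := leqP j k.
  exists (pihomog mdeg (k - j) g); rewrite -{1}(subnKC jk) (pihomogM _ _ hf).
  exact: mulrC.
exists 0; rewrite mul0r -coef_grade rmorphM /= (grade_homog hf) -mulrA coefCM.
by rewrite coefXnM kj mulr0.
Qed.

Lemma jacobian_homog_ideal : homog_ideal (jacobian F).
Proof.
split.
- by exists (fun _ => 0), 0; rewrite big1 ?mul0r ?addr0 // => i _; rewrite mul0r.
- move=> p q [a [a0 ->]] [b [b0 ->]]; exists (fun i => a i + b i), (a0 + b0).
  by rewrite mulrDl addrACA -big_split; congr (_ + _); apply: eq_bigr => i _; rewrite mulrDl.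
- move=> p q [a [a0 ->]]; exists (fun i => p * a i), (p * a0).
  by rewrite mulrDr mulr_sumr mulrA; congr (_ + _); apply: eq_bigr => i _; rewrite mulrA.
- move=> p [a [a0 ->]] k.
  have dh i : exists n, F^`M(i) \is n.-homog.
    case: d Fh => [|n] h; last by exists n; apply: mderiv_homog.
    by exists 0%N; rewrite (homog0_const h) mderivC dhomog0.
  have ex i : exists q, pihomog mdeg k (a i * F^`M(i)) = q * F^`M(i).
    by have [n hn] := dh i; apply: pihomog_multiple hn.
  have [b bE] := choice ex; have [b0 b0E] := pihomog_multiple k a0 Fh.
  exists b, b0; rewrite pihomogD b0E; congr (_ + _).
  rewrite (raddf_sum (pihomog mdeg k)); apply: eq_bigr => i _; exact: bE.
Qed.

Variables (v0 a b : V).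
Hypotheses (Fv0 : ev F v0 != 0) (frees : free [:: v0; a; b]).
Hypothesis NW : no_zero [:: v0; a; b] (jacobian F).

Variables (E : fieldType) (phi : {rmorphism KV -> E}).
Hypothesis phiF : phi F = 0.
Hypothesis kerphi : forall p, phi p = 0 -> exists q, p = q * F.
Hypothesis fracphi : forall u, exists g h, phi h != 0 /\ u = phi g / phi h.

Let Jh := jacobian_homog_ideal.

Let nzero s q : free (q :: s) -> (<<q :: s>> <= <<[:: v0; a; b]>>)%VS ->
  exists h k, [/\ jacobian F h, h \is k.-homog, translation_inv <<s>> h & ev h q != 0].
Proof.
rewrite free_cons => /andP[qs fs]; rewrite span_cons subv_add => /andP[qU sU].
apply: (elimination Kclosed Jh fs) => x xs; first by apply: NW; apply: (subvP sU).
apply: NW; first by apply: rpredD; [rewrite memvE|apply: (subvP sU)].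
by apply: contraNneq qs => /eqP; rewrite addr_eq0 => /eqP ->; rewrite rpredN.
Qed.

Let translation U (h : KV) (u : V) x s : translation_inv U h -> u \in U ->
  h.@[fun i => x i + s * coords u i] = h.@[x].
Proof.
move=> inv uU; have [v vx] := coords_surj x.
rewrite -(meval_eq _ vx) -(inv v (s *: u)) ?rpredZ //.
by apply: meval_eq => i; rewrite coordsD coordsZ vx.
Qed.

(** Elimination gives [h1], invariant along [v0] and [b], nonzero at [a], and [h2], invariant along
    [v0] and [a], nonzero at [b]. On the base of the projection from [v0], [h2] is monic up to a
    constant in the direction of [b], and [h1] does not involve it: a regular sequence. *)
Lemma normal_hypersurface u : integralOver phi u -> exists p, phi p = u.
Proof.
have sub s : {subset s <= [:: v0; a; b]} -> (<<s>> <= <<[:: v0; a; b]>>)%VS by exact: sub_span.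
have fa : free [:: a; v0; b].
  by rewrite (perm_free (Y := [:: v0; a; b])) // (perm_catCA [:: a] [:: v0] [:: b]).
have fb : free [:: b; v0; a].
  by rewrite (perm_free (Y := [:: v0; a; b])) // (perm_catC [:: b] [:: v0; a]).
have [|h1 [k1 [J1 H1 T1 n1]]] := nzero fa.
  by apply: sub => x; rewrite !inE orbCA.
have [|h2 [k2 [J2 H2 T2 n2]]] := nzero fb.
  by apply: sub => x; rewrite !inE orbC -orbA.
have v0s z : v0 \in <<[:: v0; z]>>%VS by rewrite memv_span // mem_head.
have v00 : v0 != 0 by apply: contraTneq fa => ->; rewrite free_cons free_cons span_cons !negb_and mem0v !orbT.
have bv0 : b \notin <[v0]>%VS.
  move: fb; rewrite free_cons => /andP[+ _]; apply: contra => bv.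
  by rewrite span_cons (subvP (addvSl _ _)).
have [i0 vi0] := coords_neq0 v00; have [e [x0 [l fr]]] := exists_frame vi0.
pose p1 := (to_frame (coords v0) e h1)`_0; pose p2 := (to_frame (coords v0) e h2)`_0.
have h1E : h1 = p1 \mPo l by apply: (translation_frame Kclosed fr) => x s; apply: (translation _ _ T1).
have h2E : h2 = p2 \mPo l by apply: (translation_frame Kclosed fr) => x s; apply: (translation _ _ T2).
have p10 : p1 != 0 by apply: contraNneq n1 => p10; rewrite h1E p10 comp_mpoly0 meval0.
have hp2 : p2 \is k2.-homog.
  by have [_ /(_ 0%N (leq0n _))] := bihomog_to_frame (coords v0) e H2; rewrite subn0.
pose w j := (tnth l j).@[coords b].
have bE i : coords b i = x0.@[coords b] * coords v0 i + \sum_j w j * e j i by apply: (frame_point fr).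
have p2w : p2.@[w] != 0 by rewrite h2E comp_mpoly_meval in n2.
have p1w y s : p1.@[fun j => y j + s * w j] = p1.@[y].
  rewrite !(meval_coef0_to_frame (coords v0)).
  have bs : b \in <<[:: v0; b]>>%VS by rewrite memv_span // !inE eqxx orbT.
  rewrite -[RHS](translation (u := b) _ s T1 bs).
  rewrite -[RHS](translation (u := v0) _ (- (s * x0.@[coords b])) T1 (v0s b)).
  apply: meval_eq => i; rewrite bE mulrDr mulr_sumr.
  under eq_bigr do rewrite mulrDl.
  rewrite big_split /= [\sum_j s * w j * e j i](eq_bigr (fun j => s * (w j * e j i))).
    by ring.
  by move=> j _; rewrite mulrA.
have [j0 wj0] : exists j, w j != 0.
  apply: contrapT => /forallNP h; case/negP: bv0.
  suff -> : b = x0.@[coords b] *: v0 by rewrite rpredZ // memv_line.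
  apply/eqP; rewrite -subr_eq0; apply/eqP/coords_eq0 => i.
  rewrite -scaleNr coordsD coordsZ {1}bE big1 ?addr0 => [|j _].
    by rewrite mulNr subrr.
  by have /negP/negPn/eqP -> := h j; rewrite mul0r.
have [e' [x' [l' fr']]] := exists_frame wj0.
pose c1 := (to_frame w e' p1)`_0.
have p1E : p1 = c1 \mPo l' by apply: (translation_frame Kclosed fr').
have reg al be : p2 * al = p1 * be -> exists ga, al = p1 * ga.
  move=> E2; have Dm := frame_monicP e' hp2 p2w.
  have [|z zE] := monic_regular (r := c1) (p := to_frame w e' al)
      (q := (p2.@[w])^-1%:MP%:P * to_frame w e' be) Dm.
    rewrite /frame_monic -mulrA -(rmorphM (to_frame w e')) E2 (rmorphM (to_frame w e')).
    rewrite mulrCA; congr (_ * (_ * _)); rewrite {1}p1E -(of_frameC x' l').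
    exact: of_frameK.
  exists (of_frame x' l' z); rewrite -[LHS](to_frameK fr') zE (rmorphM (of_frame x' l')).
  by rewrite p1E; congr (_ * _); apply: of_frameC.
move: J1 J2; rewrite h1E h2E => J1 J2.
exact: (integrally_closed Kclosed phiF kerphi fracphi fr Fh Fv0 p10 reg J1 J2).
Qed.

End Normality.

Lemma galois_extension_split (E : fieldType) (k L : set E) z :
  galois_extension k L -> L z -> exists (P : {poly E}) (rs : seq E),
    [/\ forall i, k P`_i, P = \prod_(x <- rs) ('X - x%:P),
        forall x, x \in rs -> L x & root P z].
Proof.
move=> [k0 [L0 [f [fL fk gal]]]]; rewrite -fL => -[a _ fa].
have /and3P [_ _ /normalFieldP nor] := gal.
have [r _ rE] := nor a (memvf a).
exists (map_poly f (minPoly 1%AS a)), (map f r); split=> [i||x /mapP [y _ ->]|].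
- have /polyOverP /(_ i) := minPolyOver 1%AS a.
  by rewrite coef_map -fk => /vlineP [c ->]; exists c.
- rewrite rE rmorph_prod big_map; apply: eq_bigr => y _.
  by rewrite rmorphB /= map_polyX map_polyC.
- by exists y.
- by rewrite -fa rootE horner_map fmorph_eq0 -rootE root_minPoly.
Qed.

Lemma size_prod_seq_XsubC (R : idomainType) (rs : seq R) :
  size (\prod_(x <- rs) ('X - x%:P)) = (size rs).+1.
Proof. exact: size_prod_XsubC. Qed.

Lemma coef_prod_scale (R : idomainType) (y : R) rs i : (i <= size rs)%N ->
  (\prod_(x <- rs) ('X - (y * x)%:P))`_i =
  y ^+ (size rs - i) * (\prod_(x <- rs) ('X - x%:P))`_i.
Proof.
elim: rs i => [|x rs IH] i; first by rewrite leqn0 => /eqP ->; rewrite !big_nil mul1r.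
rewrite !big_cons !mulrBl !coefB !coefCM !coefXM.
have big k : (size rs < k)%N -> forall s, size s = size rs ->
    (\prod_(z <- s) ('X - z%:P))`_k = 0 :> R.
  by move=> h s se; apply: nth_default; rewrite size_prod_seq_XsubC se.
case: i => [|i] /=.
  by move=> _; rewrite !sub0r IH // !subn0 exprS mulrN; congr (- _); ring.
rewrite ltnS subSS => h; rewrite IH //; move: h; rewrite leq_eqVlt => /orP [/eqP ->|h].
  rewrite subnn !expr0 (big (size rs).+1) //.
  have := big (size rs).+1 (ltnSn _) (map (fun z => y * z) rs) (size_map _ _).
  by rewrite big_map => ->; rewrite !mulr0 !mul1r.
rewrite IH // -(subnSK h) exprS; ring.
Qed.

Lemma root_prod_scale (E : fieldType) (y t : E) rs : y != 0 -> t / y \in rs ->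
  root (\prod_(x <- rs) ('X - (y * x)%:P)) t.
Proof.
move=> y0 /(map_f (fun x => y * x)); rewrite mulrCA mulfV // mulr1.
by rewrite -root_prod_XsubC big_map.
Qed.

Lemma dvdp_split (R : idomainType) (E : fieldType) (tau : {rmorphism R -> E})
    (p : {poly R}) (y : E) rs :
  (forall c, (tau c == 0) = (c == 0)) -> p != 0 ->
  map_poly tau p %| \prod_(x <- rs) ('X - (y * x)%:P) ->
  exists ts, map_poly tau p = tau (lead_coef p) *: \prod_(x <- ts) ('X - x%:P) /\
    forall x, x \in ts -> x \in map (fun x => y * x) rs.
Proof.
move=> tau0 p0 /dvdp_prod_XsubC [mk /eqpf_eq [c c0 cE]].
exists (map (fun x => y * x) (mask mk rs)); rewrite big_map; split.
  rewrite cE; congr (_ *: _).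
  have <- : lead_coef (map_poly tau p) = tau (lead_coef p).
    by rewrite lead_coef_map_eq // tau0 lead_coef_eq0.
  by rewrite cE lead_coefZ (monicP (monic_prod_XsubC _ _ _)) mulr1.
by move=> x /mapP [z /mem_mask zr ->]; apply: map_f.
Qed.

Lemma clear_denominators (R : idomainType) (E : fieldType) (tau : {rmorphism R -> E})
    (P : {poly E}) :
  (forall i, exists g h, tau h != 0 /\ P`_i = tau g / tau h) ->
  exists D (Q : {poly R}), tau D != 0 /\ map_poly tau Q = tau D *: P.
Proof.
move=> /choice [g] /choice [h hP].
pose D := \prod_(i < size P) h i.
pose Q := \poly_(i < size P) (g i * \prod_(j < size P | j != i :> nat) h j).
exists D, Q; split.
  by rewrite rmorph_prod; apply/prodf_neq0 => i _; case: (hP i).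
apply/polyP => i; rewrite coef_map coefZ coef_poly; case: ltnP => [ip|ip]; last first.
  by rewrite [P`_i]nth_default // mulr0; apply: rmorph0.
have [hi ->] := hP i.
have -> : D = h i * \prod_(j < size P | j != i :> nat) h j by rewrite /D (bigD1 (Ordinal ip)).
by rewrite !rmorphM; field; exact: hi.
Qed.

(** * The equation splits over the function field *)

Section Splitting.

Variables (K : fieldType) (V : vectType K) (X : hypersurface V).
Hypothesis Kclosed : alg_closed K.

Local Notation KV := {mpoly K[\dim {:V}]}.
Local Notation ev p v := (p : KV).@[coords v].
Local Notation F := (hpoly X).
Local Notation E := (fraction_field X).

Variable phi : {rmorphism KV -> E}.
Hypothesis phiE : forall a b, ratfun X a b = phi a / phi b.
Hypothesis phi0 : forall p, (phi p == 0) = hideal X p.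

Lemma class_ker p : phi p = 0 -> exists q, p = q * F.
Proof. by move=> /eqP; rewrite phi0 => /hidealP. Qed.

Lemma class_hpoly : phi F = 0.
Proof. by apply/eqP; rewrite phi0; apply/hidealP; exists 1; rewrite mul1r. Qed.

Lemma function_fieldP u : function_field X u <->
  exists k a b, [/\ a \is k.-homog, b \is k.-homog, phi b != 0 & u = phi a / phi b].
Proof.
by split=> -[k [a [b [ha hb b0 ->]]]]; exists k, a, b; split; rewrite ?phiE // ?phi0 // -?phi0.
Qed.

Variables (m : nat) (v : V) (e : 'I_m -> 'I_(\dim {:V}) -> K).
Variables (x0 : KV) (l : m.-tuple KV).
Hypothesis frame : dual_frame (coords v) e x0 l.

(** The coordinate ring of the target of the projection from [v], mapped to the field. *)
Definition class_const : {rmorphism {mpoly K[m]} -> E} := phi \o comp_mpoly l.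

Local Notation tau := class_const.
Local Notation hatF := (to_frame (coords v) e F).

Lemma class_frame (Q : {poly {mpoly K[m]}}) :
  (map_poly tau Q).[phi x0] = phi (of_frame x0 l Q).
Proof. by rewrite /of_frame -horner_map -map_poly_comp. Qed.

Lemma class_frame_ker Q : (map_poly tau Q).[phi x0] = 0 -> exists P, Q = P * hatF.
Proof.
rewrite class_frame => /class_ker [q qE]; exists (to_frame (coords v) e q).
by rewrite -[LHS](of_frameK frame) qE; apply: (rmorphM (to_frame (coords v) e)).
Qed.

Hypothesis sizeF : (1 < size hatF)%N.

Lemma class_const_eq0 p : (tau p == 0) = (p == 0).
Proof.
apply/eqP/eqP => [t0|->]; last exact: rmorph0.
have [|P PE] := class_frame_ker (Q := p%:P); first by rewrite map_polyC hornerC.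
apply/eqP; rewrite -(polyC_eq0 p) PE mulf_eq0; apply: contraTT sizeF.
rewrite negb_or -!size_poly_gt0 => /andP [P0 F0].
have := size_polyC_leq1 p; rewrite PE size_mul -?size_poly_gt0 //.
by case: (size P) (size hatF) P0 F0 => [|a] [|[|b]] //; rewrite !addnS.
Qed.

(** A form vanishing at [v] is invariant along [v], hence a combination of the forms [l]. So any
    tuple defining the projection can be compared with the frame. *)
Lemma pullback_class (l' : (\dim {:V}).-1.-tuple KV) u :
  (forall j, tnth l' j \is 1.-homog) -> (forall j, ev (tnth l' j) v = 0) ->
  pullback_field X l' u -> exists g h, tau h != 0 /\ u = tau g / tau h.
Proof.
move=> hl lv [k [g [h [hg hh nh ->]]]].
pose L := [tuple (to_frame (coords v) e (tnth l' j))`_0 | j < (\dim {:V}).-1].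
have lE j : tnth l' j = (tnth L j) \mPo l.
  rewrite tnth_mktuple; apply: (translation_frame Kclosed frame) => x s.
  have [w wx] := coords_surj x.
  rewrite -(meval_eq _ wx) -[RHS]addr0 -[X in _ + X](mulr0 s) -(lv j).
  rewrite -(ev_homog1Z _ _ (hl j)) -(ev_homog1D _ _ (hl j)).
  by apply: meval_eq => i; rewrite coordsD coordsZ wx.
have cE p : p \mPo l' = (p \mPo L) \mPo l.
  apply: (meval_inj Kclosed) => x; rewrite !comp_mpoly_meval.
  by apply: meval_eq => j; rewrite lE comp_mpoly_meval.
exists (g \mPo L), (h \mPo L); rewrite phiE !cE; split=> //.
by rewrite /class_const /= -cE phi0.
Qed.

(** [x0] has degree 1, so the Galois group acts on [x0 / y] instead, for a base form [y]. The
    conjugates, multiplied by [y], are fractions of degree 1, and the equation of [X] divides the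
    polynomial with these roots. *)
Lemma galois_split (l' : (\dim {:V}).-1.-tuple KV) : (0 < m)%N ->
  (forall j, tnth l' j \is 1.-homog) -> (forall j, ev (tnth l' j) v = 0) ->
  galois_extension (pullback_field X l') (function_field X) ->
  exists ts : seq E,
    map_poly tau hatF = tau (lead_coef hatF) *: \prod_(x <- ts) ('X - x%:P) /\
    forall x, x \in ts -> exists k a b,
      [/\ a \is k.+1.-homog, b \is k.-homog, phi b != 0 & x = phi a / phi b].
Proof.
move=> m0 hl lv gal; pose j0 := Ordinal m0.
case: (frame) => hx0 hl0 _ _ _.
have tauX : phi (tnth l j0) = tau 'X_j0 by rewrite /class_const /= comp_mpolyXU -tnth_nth.
have y0 : phi (tnth l j0) != 0.
  by rewrite tauX class_const_eq0 -msize_poly_eq0 msizeX.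
set y := phi (tnth l j0) in tauX y0.
have zf : function_field X (phi x0 / y).
  by apply/function_fieldP; exists 1%N, x0, (tnth l j0).
have [P [rs [kP PE rsL Pz]]] := galois_extension_split gal zf.
pose P' := \prod_(x <- rs) ('X - (y * x)%:P).
have [|D [Q [D0 QE]]] := @clear_denominators _ _ tau P'.
  move=> i; have [irs|irs] := leqP i (size rs); last first.
    exists 0, 1; rewrite rmorph1 oner_neq0 rmorph0 mul0r; split=> //.
    rewrite nth_default // /P' -(big_map (fun x => y * x) xpredT (fun x => 'X - x%:P)).
    by rewrite size_prod_seq_XsubC size_map.
  have [g [h [h0 gh]]] := pullback_class hl lv (kP i).
  exists ('X_j0 ^+ (size rs - i) * g), h; split=> //.
  by rewrite coef_prod_scale // -PE gh tauX rmorphM rmorphXn mulrA.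
have [|q qE] := class_frame_ker (Q := Q).
  have P't : P'.[phi x0] = 0.
    by apply/rootP; apply: (root_prod_scale y0); rewrite -root_prod_XsubC -PE.
  rewrite QE hornerZ P't; exact: mulr0.
have dF : map_poly tau hatF %| P'.
  by rewrite -(dvdpZr _ _ D0) -QE qE rmorphM dvdp_mull.
have Fn0 : hatF != 0 by rewrite -size_poly_gt0 ltnW.
have [ts [tsE tsr]] := dvdp_split class_const_eq0 Fn0 dF.
exists ts; split=> // x /tsr.
move=> /mapP [r /rsL /function_fieldP [k [a [b [ha hb b0 ->]]]] ->].
exists k, (tnth l j0 * a), b; split=> //; last by rewrite rmorphM mulrA.
by rewrite -add1n dhomogM.
Qed.

End Splitting.

Section MonicScaling.

Variables (R : idomainType).

Lemma coef_affine_exp (b g : R) n :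
  [/\ (size ((b%:P * 'X + g%:P) ^+ n) <= n.+1)%N,
      ((b%:P * 'X + g%:P) ^+ n)`_n = b ^+ n &
      (0 < n)%N -> ((b%:P * 'X + g%:P) ^+ n)`_n.-1 = n%:R * b ^+ n.-1 * g].
Proof.
have s1 : (size (b%:P * 'X + g%:P)%R <= 2)%N.
  by rewrite size_MXaddC; case: ifP => // _; rewrite ltnS size_polyC_leq1.
have cE (Q : {poly R}) i : ((b%:P * 'X + g%:P) * Q)`_i = b * (if i is j.+1 then Q`_j else 0) + g * Q`_i.
  by rewrite mulrDl coefD -mulrA coefCM coefXM coefCM; case: i.
elim: n => [|n [sn topn secn]].
  by rewrite expr0 size_poly1; split=> //; rewrite coef1.
rewrite exprS; split=> [||_].
- rewrite (leq_trans (size_polyMleq _ _)) //; lia.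
- by rewrite cE topn [_`_n.+1]nth_default // mulr0 addr0 exprS.
- rewrite cE topn /=; case: n sn topn secn => [|n] sn topn secn; first by rewrite mulr0 add0r expr0; ring.
  by rewrite /= secn //= -[in RHS]natr1 exprS; ring.
Qed.

Lemma coef_comp_affine (p : {poly R}) n (b g : R) : (size p <= n.+2)%N ->
  (p \Po (b%:P * 'X + g%:P))`_n.+1 = b ^+ n.+1 * p`_n.+1 /\
  (p \Po (b%:P * 'X + g%:P))`_n = b ^+ n * (p`_n + n.+1%:R * g * p`_n.+1).
Proof.
move=> sp; have pE : p \Po (b%:P * 'X + g%:P) = \sum_(i < n.+2) p`_i *: (b%:P * 'X + g%:P) ^+ i.
  rewrite comp_polyE (big_ord_widen _ (fun i => p`_i *: (b%:P * 'X + g%:P) ^+ i) sp).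
  rewrite big_mkcond; apply: eq_bigr => i _; case: ltnP => // h.
  by rewrite nth_default // scale0r.
have small k i : (i < k)%N -> ((b%:P * 'X + g%:P) ^+ i)`_k = 0.
  by move=> ik; apply: nth_default; have [h _ _] := coef_affine_exp b g i; apply: leq_trans h ik.
split; rewrite pE coef_sum.
  rewrite big_ord_recr /= big1 => [|i _]; last by rewrite coefZ small ?mulr0.
  by have [_ h _] := coef_affine_exp b g n.+1; rewrite add0r coefZ h mulrC.
rewrite big_ord_recr big_ord_recr /= big1 => [|i _]; last by rewrite coefZ small ?mulr0.
have [_ h _] := coef_affine_exp b g n; have [_ _ /(_ isT) h'] := coef_affine_exp b g n.+1.
by rewrite add0r !coefZ h h' /=; ring.
Qed.

Lemma comp_scaleX (p : {poly R}) c i : (p \Po (c%:P * 'X))`_i = c ^+ i * p`_i.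
Proof.
have -> : p \Po (c%:P * 'X) = \poly_(i < size p) (c ^+ i * p`_i).
  rewrite comp_polyE poly_def; apply: eq_bigr => j _.
  by rewrite exprMn -rmorphXn mul_polyC scalerA mulrC.
by rewrite coef_poly; case: ltnP => // h; rewrite nth_default ?mulr0.
Qed.

(* The monic polynomial with [c ^+ n.-1 p(X)] as its value at [c X], for [p]
   of degree [n] and leading coefficient [c]. *)
Definition monic_scale (c : R) n (p : {poly R}) : {poly R} :=
  \poly_(i < n.+1) (if i == n then 1 else c ^+ (n.-1 - i) * p`_i).

Lemma coef_monic_scale c n p i : (monic_scale c n p)`_i =
  if i == n then 1 else if (i < n)%N then c ^+ (n.-1 - i) * p`_i else 0.
Proof. by rewrite coef_poly ltnS leq_eqVlt; case: eqP. Qed.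

Lemma size_monic_scale c n p : size (monic_scale c n p) = n.+1.
Proof. by rewrite size_poly_eq // eqxx oner_neq0. Qed.

Lemma monic_scale_monic c n p : monic_scale c n p \is monic.
Proof. by rewrite monicE lead_coefE size_monic_scale coef_monic_scale eqxx. Qed.

Lemma monic_scale_comp c n (p : {poly R}) : size p = n.+2 -> p`_n.+1 = c ->
  monic_scale c n.+1 p \Po (c%:P * 'X) = c ^+ n *: p.
Proof.
move=> sp pc; apply/polyP => i; rewrite comp_scaleX coefZ coef_monic_scale.
have [->|ne] := eqVneq i n.+1; first by rewrite mulr1 pc exprSr.
case: ltnP => h; last by rewrite mulr0 nth_default ?mulr0 // sp ltn_neqAle eq_sym ne.
by rewrite mulrA -exprD /= subnKC.
Qed.

Lemma map_monic_scale (E : fieldType) (tau : {rmorphism R -> E}) c n (p : {poly R}) ts :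
  size ts = n -> map_poly tau p = tau c *: \prod_(x <- ts) ('X - x%:P) ->
  map_poly tau (monic_scale c n p) = \prod_(x <- ts) ('X - (tau c * x)%:P).
Proof.
move=> sz pE; apply/polyP => i; rewrite coef_map /= coef_monic_scale.
have sP (f : E -> E) : size (\prod_(x <- ts) ('X - (f x)%:P)) = n.+1.
  by rewrite -(big_map f xpredT (fun x => 'X - x%:P)) size_prod_seq_XsubC size_map sz.
have [->|ne] := eqVneq i n.
  rewrite ?eqxx [LHS]rmorph1; have /monicP := monic_prod_XsubC ts xpredT (fun x => tau c * x).
  by rewrite lead_coefE sP.
have := congr1 (fun q : {poly E} => q`_i) pE; rewrite coef_map coefZ /= => piE.
case: ltnP => h; last first.
  rewrite [RHS]nth_default; first exact: rmorph0.
  by rewrite (sP (fun x => tau c * x)) ltn_neqAle eq_sym ne.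
rewrite coef_prod_scale ?sz 1?ltnW //.
have -> : tau (c ^+ (n.-1 - i) * p`_i) = tau c ^+ (n.-1 - i) * tau p`_i.
  by rewrite -rmorphXn; apply: rmorphM.
rewrite [tau p`_i]piE mulrA -exprSr.
by congr (_ ^+ _ * _); lia.
Qed.

End MonicScaling.

(** * Centered equations whose conjugates are affine in one root *)

Section CyclicEquation.

Variables (R : idomainType) (E : fieldType) (theta : {rmorphism {poly R} -> E}).
Variables (n : nat) (G : {poly R}).
Hypotheses (n1 : (0 < n)%N) (n0 : n.+1%:R != 0 :> R).
Hypotheses (Gm : G \is monic) (sG : size G = n.+2) (thG : theta G = 0).
Hypothesis kerG : forall p, theta p = 0 -> exists q, p = q * G.
Hypothesis Gn : G`_n = 0.
(** A pair [(b, g)] stands for the conjugate [b s + g] of the root [s = theta 'X]. *)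
Variable rs : seq (R * R).

Local Notation tau := (theta \o polyC).

Hypothesis Grs : map_poly tau G =
  \prod_(z <- rs) ('X - (theta (z.1%:P * 'X + z.2%:P))%:P).

Let small (p : {poly R}) : (size p < n.+2)%N -> theta p = 0 -> p = 0.
Proof. by rewrite -sG => sp tp; apply: (quotient_small Gm kerG tp). Qed.

Let tau0 c : theta c%:P = 0 -> c = 0.
Proof.
move=> /small c0; apply/eqP; rewrite -(polyC_eq0 c) c0 //.
by rewrite (leq_ltn_trans (size_polyC_leq1 c)).
Qed.

Let Gtop : G`_n.+1 = 1.
Proof. by move/monicP: Gm; rewrite lead_coefE sG. Qed.

Let root_rs z : z \in rs -> theta (G \Po (z.1%:P * 'X + z.2%:P)) = 0.
Proof.
move=> zr; have -> (p q : {poly R}) : theta (p \Po q) = (map_poly tau p).[theta q].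
  elim/poly_ind: p => [|p c IH]; first by rewrite comp_poly0 !rmorph0 horner0.
  rewrite comp_poly_MXaddC !rmorphD !rmorphM IH /= map_polyX map_polyC.
  by rewrite hornerMXaddC.
apply/rootP; rewrite Grs -(big_map (fun z => theta (z.1%:P * 'X + z.2%:P)) xpredT (fun x => 'X - x%:P)).
by rewrite root_prod_XsubC; apply: (map_f (fun z => theta (z.1%:P * 'X + z.2%:P))).
Qed.

(** A root in [R] would factor [G] in smaller degrees, and [theta] would kill one of the factors. *)
Let no_linear_factor g : G.[g] != 0.
Proof.
apply/negP => /factor_theorem [H HE].
have H0 : H != 0 by apply: contraTneq (monic_neq0 Gm) => H0; rewrite HE H0 mul0r eqxx.
have sH : size H = n.+1.
  by apply/eqP; rewrite -eqSS -sG HE size_Mmonic ?monicXsubC // size_XsubC addn2.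
have := thG; rewrite HE rmorphM => /eqP; rewrite mulf_eq0 => /orP [] /eqP /small.
  by rewrite sH ltnSn => /(_ isT) /eqP; apply/negP.
by rewrite size_XsubC ltnS => /(_ n1) /eqP; rewrite polyXsubC_eq0.
Qed.

(** [G(b 'X + g)] is killed by [theta], so it equals [b^(n+1) G]. As the term of degree [n] is
    missing from [G], and neither [b] nor [n + 1] is 0, [g] is 0. *)
Let rs_const z : z \in rs -> z.2 = 0.
Proof.
case: z => b g zr /=; have := root_rs zr; rewrite /=; set H := G \Po _ => thH.
have [b0|b0] := eqVneq b 0.
  have := no_linear_factor g; have HE : H = (G.[g])%:P.
    by rewrite /H b0 polyC0 mul0r add0r comp_polyCr.
  by move: thH; rewrite HE => /tau0 ->; rewrite eqxx.
have [] := @coef_comp_affine R G n b g; first by rewrite sG.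
rewrite -/H Gtop Gn mulr1 add0r mulr1 => H1 H2.
have sH : (size H <= n.+2)%N.
  rewrite /H (leq_trans (size_comp_poly_leq _ _)) // sG ltnS -[X in (_ <= X)%N]muln1.
  rewrite leq_mul2l /= -ltnS; apply: (@leq_ltn_trans 1) => //.
  by have [+ _ _] := coef_affine_exp b g 1; rewrite expr1; case: (size _).
have HG : H = b ^+ n.+1 *: G.
  apply/eqP; rewrite -subr_eq0; apply/eqP/small; last first.
    by rewrite rmorphB thH -mul_polyC rmorphM thG mulr0 subrr.
  rewrite ltnNge; apply/negP => s.
  suff sE : size (H - b ^+ n.+1 *: G) = n.+2.
    have : lead_coef (H - b ^+ n.+1 *: G) == 0.
      by rewrite lead_coefE sE coefB coefZ H1 Gtop mulr1 subrr.
    by rewrite lead_coef_eq0 -size_poly_eq0 sE.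
  apply/eqP; rewrite eqn_leq s andbT (leq_trans (size_polyD _ _)) // geq_max sH.
  by rewrite size_polyN (leq_trans (size_scale_leq _ _)) // sG.
move: H2; rewrite HG coefZ Gn mulr0 => /esym/eqP.
by rewrite !mulf_eq0 expf_eq0 (negbTE b0) andbF (negbTE n0) /= => /eqP.
Qed.

(* [G] has no term of degree [n], hence the conjugates of its root [s] are
   multiples [b s]; so its coefficients are multiples of powers of [s]. *)
Lemma cyclic_equation : G = 'X^(n.+1) + (G`_0)%:P.
Proof.
have szrs : size rs = n.+1.
  apply/eqP; rewrite -eqSS -(size_map (fun z => theta (z.1%:P * 'X + z.2%:P)) rs).
  rewrite -size_prod_seq_XsubC big_map -Grs size_map_poly_id0 ?sG //.
  by rewrite (monicP Gm) rmorph1 oner_neq0.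
pose bs := map fst rs; have szbs : size bs = n.+1 by rewrite size_map.
pose B := \prod_(b <- bs) ('X - b%:P).
have GE : map_poly tau G = \prod_(x <- map tau bs) ('X - (theta 'X * x)%:P).
  rewrite Grs !big_map !big_seq; apply: eq_bigr => z zr.
  by rewrite (rs_const zr) polyC0 addr0 rmorphM /= mulrC.
have BE : map_poly tau B = \prod_(x <- map tau bs) ('X - x%:P).
  rewrite rmorph_prod big_map; apply: eq_bigr => x _.
  by rewrite rmorphB /= map_polyX map_polyC.
apply/polyP => i; rewrite coefD coefXn coefC.
case: i => [|i]; first by rewrite eqxx add0r.
rewrite addr0; have [->|ne] := eqVneq i.+1 n.+1; first exact: Gtop.
have [ni|ni] := leqP n.+1 i.+1; first by rewrite nth_default // sG ltn_neqAle eq_sym ne.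
have := congr1 (fun p : {poly E} => p`_i.+1) GE.
rewrite coef_prod_scale size_map szbs ?(ltnW ni) // -BE !coef_map /= => Gi.
(* An element of [R] equals a multiple of [s^j] with [1 <= j <= n]. Such powers are independent of 1
   over [R], so both are 0. *)
have : (G`_i.+1)%:P - (B`_i.+1)%:P * 'X^(n.+1 - i.+1) = 0.
  apply: small; last by rewrite rmorphB Gi rmorphM rmorphXn mulrC subrr.
  rewrite (leq_ltn_trans (size_polyD _ _)) // gtn_max size_polyN.
  rewrite (leq_ltn_trans (size_polyC_leq1 _)) //= mul_polyC.
  by rewrite (leq_ltn_trans (size_scale_leq _ _)) // size_polyXn ltnS; lia.
move/(congr1 (fun p : {poly R} => p`_0)); rewrite coefB coefC coefCM coefXn coef0 /=.
have -> : (0%N == (n.+1 - i.+1)%N) = false by lia.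
by rewrite mulr0 subr0.
Qed.

End CyclicEquation.

(** ['X] is prime and does not divide [B], so the factors ['X] are removed from [P] one at a
    time. *)
Lemma lowest_dvd (R : idomainType) n (A B P : {poly R}) : B.[0] != 0 ->
  'X^n * A = P * B -> exists H, A = H * B.
Proof.
move=> B0; elim: n P => [|n IH] P; first by rewrite mul1r => ->; exists P.
move=> PE; have /factor_theorem [Q QE] : root P 0.
  have := congr1 (fun p : {poly R} => p.[0]) PE.
  rewrite exprS -mulrA hornerM hornerX mul0r hornerM => /esym/eqP.
  by rewrite mulf_eq0 (negbTE B0) orbF.
have X0 : ('X : {poly R}) != 0 by rewrite polyX_eq0.
apply: (IH Q); apply: (mulfI X0).
by rewrite mulrA -exprS PE QE polyC0 subr0; ring.
Qed.

Lemma map_choice (A B C : eqType) (f : A -> C) (g : B -> C) s :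
  (forall x, x \in s -> exists z, f z = g x) -> exists r, map f r = map g s.
Proof.
elim: s => [|x s IH] h; first by exists [::].
have [|r rE] := IH; first by move=> y ys; apply: h; rewrite inE ys orbT.
by have [z zE] := h x (mem_head _ _); exists (z :: r); rewrite /= zE rE.
Qed.

Lemma root_prod_mul (R : idomainType) (y x : R) rs : x \in rs ->
  (\prod_(x <- rs) ('X - (y * x)%:P)).[y * x] = 0.
Proof.
move=> xrs; apply/rootP; rewrite -(big_map (fun x => y * x) xpredT (fun x => 'X - x%:P)).
by rewrite root_prod_XsubC; apply: (map_f (fun x => y * x)).
Qed.

Lemma homog1_factor (K : fieldType) m k (M p : {mpoly K[m]}) : alg_closed K ->
  M \is 1.-homog -> M != 0 -> p \is k.+1.-homog ->
  (forall y, M.@[y] = 0 -> p.@[y] = 0) -> exists2 q, q \is k.-homog & p = M * q.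
Proof.
move=> Kclosed hM Mn hp /(linear_form_dvd Kclosed hM Mn) [q qE].
exists (pihomog mdeg k q); first exact: pihomogP.
by rewrite -(pihomogM _ _ hM) -qE add1n pihomog_dE.
Qed.

Lemma comp_add_scale (R : comNzRingType) (a c : R) :
  ('X + a%:P) \Po (c%:P * 'X) = c%:P * 'X + a%:P.
Proof. by rewrite comp_polyD comp_polyX comp_polyC. Qed.

Lemma comp_cyclic (R : comNzRingType) n (g : R) p q : p = 'X^n + g%:P ->
  p \Po q = q ^+ n + g%:P.
Proof.
by move=> ->; rewrite comp_polyD comp_polyC (rmorphXn (comp_poly q)) /= comp_polyX.
Qed.

Lemma horner_lift (R S : comNzRingType) (f : {rmorphism {poly R} -> S}) p q :
  f (map_poly polyC p).[q] = (map_poly (f \o polyC) p).[f q].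
Proof. by rewrite -horner_map -map_poly_comp. Qed.

(** * The normal form at a Galois point *)

Section CyclicForm.

Variables (K : fieldType) (N m d n : nat) (F : {mpoly K[N]}).
Hypothesis Kclosed : alg_closed K.
Hypothesis char0 : forall n, n.+1%:R != 0 :> K.
Hypothesis Fh : F \is d.-homog.
Variables (E : fieldType) (phi : {rmorphism {mpoly K[N]} -> E}).
Hypothesis phiF : phi F = 0.
Hypothesis kerphi : forall p, phi p = 0 -> exists q, p = q * F.
Hypothesis normal : forall u, integralOver phi u -> exists p, phi p = u.
Variables (e0 : 'I_N -> K) (e : 'I_m -> 'I_N -> K).
Variables (x0 : {mpoly K[N]}) (l : m.-tuple {mpoly K[N]}).
Hypothesis frame : dual_frame e0 e x0 l.

Local Notation R := {mpoly K[m]}.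
Local Notation hF := (to_frame e0 e F).

Hypotheses (n2 : (1 < n)%N) (sF : size hF = n.+2).
Hypothesis dn : d = n.+1 \/ d = n.+2.

Variable tau : {rmorphism R -> E}.
Hypothesis tauE : forall p, tau p = phi (p \mPo l).
Hypothesis tau0 : forall p, (tau p == 0) = (p == 0).
Hypothesis horner_class : forall Q : {poly R}, (map_poly tau Q).[phi x0] = phi (of_frame x0 l Q).
Hypothesis horner_ker : forall Q : {poly R},
  (map_poly tau Q).[phi x0] = 0 -> exists P, Q = P * hF.

Variable ts : seq E.
Hypothesis tsE : map_poly tau hF = tau hF`_n.+1 *: \prod_(x <- ts) ('X - x%:P).
Hypothesis ts_frac : forall x, x \in ts -> exists k a b,
  [/\ a \is k.+1.-homog, b \is k.-homog, phi b != 0 & x = phi a / phi b].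

(** Scaling by [n + 1] makes the coefficient of degree [n] in [ms] equal to [(n + 1) a]; the shift
    by [a] then centers the roots without any division. *)
Let kk : R := n.+1%:R%:MP.
Let c : R := kk * hF`_n.+1.
Let a : R := hF`_n.
Let P0 : {poly R} := kk *: hF.
Let ms : {poly R} := monic_scale c n.+1 P0.

Let nd : (n.+1 <= d)%N. Proof. by case: dn => ->. Qed.

Let kk0 : kk != 0. Proof. by rewrite mpolyC_eq0. Qed.

Let hom i : (i <= d)%N -> hF`_i \is (d - i).-homog.
Proof. by have [_ h] := bihomog_to_frame e0 e Fh; apply: h. Qed.

Let kkZ p k : p \is k.-homog -> kk * p \is k.-homog.
Proof. by rewrite mul_mpolyC; apply: dhomogZ. Qed.

Let M0 : hF`_n.+1 != 0.
Proof. by rewrite -[n.+1]/(n.+2.-1) -sF -lead_coefE lead_coef_eq0 -size_poly_eq0 sF. Qed.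

Let c0 : c != 0. Proof. by rewrite mulf_neq0. Qed.

Let hc : c \is (d - n.+1).-homog. Proof. exact/kkZ/hom. Qed.

Let sP0 : size P0 = n.+2. Proof. by rewrite size_scale. Qed.

Let P0n : P0`_n.+1 = c. Proof. by rewrite coefZ. Qed.

Let size_ts : size ts = n.+1.
Proof.
apply/eqP; rewrite -eqSS -size_prod_seq_XsubC -(size_scale (a := tau hF`_n.+1)) ?tau0 //.
rewrite -tsE size_map_poly_id0 ?sF //.
by rewrite lead_coefE sF tau0.
Qed.

Let sms : size ms = n.+2. Proof. exact: size_monic_scale. Qed.

Let msE : map_poly tau ms = \prod_(x <- ts) ('X - (tau c * x)%:P).
Proof.
apply: map_monic_scale => //.
by rewrite map_polyZ /= tsE scalerA -rmorphM.
Qed.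

(** [tau c * x] is a root of the monic [ms], hence by normality the class of a polynomial. Since [x]
    is a fraction of degree 1, the component of degree [1 + deg c] alone represents it. *)
Let conjugate x : x \in ts ->
  exists2 q, q \is (1 + (d - n.+1)).-homog & phi q = tau c * x.
Proof.
move=> xts; have [q0 q0E] : exists q0, phi q0 = tau c * x.
  apply: normal; exists (map_poly (comp_mpoly l) ms).
    by rewrite monic_map // monic_scale_monic.
  rewrite -map_poly_comp; apply/rootP.
  have -> : map_poly (phi \o comp_mpoly l) ms = map_poly tau ms.
    by apply: eq_map_poly => p; rewrite tauE.
  by rewrite msE root_prod_mul.
have [k [p [b [hp hb b0 xE]]]] := ts_frac xts.
exists (pihomog mdeg (1 + (d - n.+1)) q0); first exact: pihomogP.
have hcl : c \mPo l \is (d - n.+1).-homog.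
  by apply: homog_comp hc; case: frame.
have cancel : phi b * (tau c * (phi p / phi b)) = tau c * phi p.
  by rewrite mulrCA [phi b * _]mulrC divfK.
have : phi (b * q0 - (c \mPo l) * p) = 0.
  rewrite rmorphB (rmorphM phi b q0) (rmorphM phi (c \mPo l) p) q0E {1}xE -tauE cancel.
  exact: subrr.
move=> /kerphi [r rE].
have [q qE] := pihomog_multiple (k + (1 + (d - n.+1))) r Fh.
have := congr1 (pihomog mdeg (k + (1 + (d - n.+1)))) rE.
rewrite pihomogB (pihomogM _ _ hb) qE [pihomog _ _ ((c \mPo l) * p)]pihomog_dE; last first.
  have -> : (k + (1 + (d - n.+1)) = (d - n.+1) + k.+1)%N by clear; lia.
  exact: dhomogM.
move=> /(congr1 phi); rewrite rmorphB (rmorphM phi b) (rmorphM phi (c \mPo l) p).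
rewrite (rmorphM phi q) phiF mulr0 => /eqP.
rewrite subr_eq0 => /eqP bq; apply: (mulfI b0).
by rewrite bq xE -tauE cancel.
Qed.

(** At an inner point [c] and the roots [x] both have degree 1, so the roots of [ms] have degree
    2. *)
Let ms_homog i : d = n.+2 -> (i <= n.+1)%N -> ms`_i \is (n.+1 - i).*2.-homog.
Proof.
move=> dE id; rewrite coef_monic_scale; have [->|ne] := eqVneq i n.+1.
  by rewrite subnn -mpolyC1; apply: homogC.
rewrite ltn_neqAle ne id /= coefZ.
have -> : (n.+1 - i).*2 = ((d - n.+1) * (n - i) + (d - i))%N by lia.
by apply: dhomogM; [apply: dhomogMn|apply/kkZ/hom; lia].
Qed.

(** This lifts [ms(tau c * x) = 0] from the field to the frame, modulo the equation of [X]. *)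
Let relation x q : x \in ts -> phi q = tau c * x ->
  exists P, (map_poly polyC ms).[to_frame e0 e q] = P * hF.
Proof.
move=> xts qx; apply: horner_ker.
pose th : {rmorphism {poly R} -> E} := horner_eval (phi x0) \o map_poly tau.
rewrite -[LHS]/(th _) horner_lift.
have -> : map_poly (th \o polyC) ms = map_poly tau ms.
  by apply: eq_map_poly => p; rewrite /th /= map_polyC /horner_eval hornerC.
have -> : th (to_frame e0 e q) = tau c * x by rewrite -qx -[LHS]/((map_poly tau _).[_]) horner_class (to_frameK frame).
by rewrite msE root_prod_mul.
Qed.

(* The relation at the point where the frame constants vanish. *)
Let conj_top x q : d = n.+2 -> x \in ts -> phi q = tau c * x ->
  q \is (1 + (d - n.+1)).-homog -> (to_frame e0 e q)`_2 = 0.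
Proof.
move=> dE xts qx; have d1 : (d - n.+1 = 1)%N by move: dE; clear; lia.
rewrite d1 => hq; have [sq hq'] := bihomog_to_frame e0 e hq.
have [P PE] := relation xts qx.
pose z : 'I_m -> K := fun=> 0.
pose psi : {rmorphism {poly R} -> K} := horner_eval 1 \o map_poly (meval z).
have msX : map_poly (psi \o polyC) ms = 'X^(n.+1).
  apply/polyP => i; rewrite coef_map /= map_polyC /horner_eval hornerC coefXn.
  have [->|ne] := eqVneq i n.+1; first by rewrite coef_monic_scale eqxx /= meval1.
  have [h|h] := leqP i n.+1; last first.
    have -> : ms`_i = 0 by apply: nth_default; rewrite sms.
    exact: meval0.
  by apply: (@homog_meval0 _ _ _ (n.+1 - i).*2) => //; [lia|apply: ms_homog].
have psiF : psi hF = 0.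
  rewrite /psi /= /horner_eval; suff -> : map_poly (meval z) hF = 0 by rewrite horner0.
  apply/polyP => i; rewrite coef_map coef0 /=.
  have [h|h] := ltnP i n.+2; last by rewrite nth_default ?meval0 // sF.
  by apply: (@homog_meval0 _ _ _ (d - i)) => //; [lia|apply: hom; lia].
have psiq : psi (to_frame e0 e q) = ((to_frame e0 e q)`_2).@[z].
  rewrite /psi /= /horner_eval (@horner_coef_wide _ 3); last exact: leq_trans (size_poly _ _) sq.
  rewrite !big_ord_recl big_ord0 !coef_map /= !expr1n !mulr1 addr0.
  rewrite (homog_meval0 (d := 2) _ (hq' 0%N _)) // (homog_meval0 (d := 1) _ (hq' 1%N _)) //.
  by rewrite !add0r.
clearbody psi; have := congr1 psi PE; rewrite horner_lift msX psiq (rmorphM psi P) psiF.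
rewrite mulr0 hornerXn => /eqP; rewrite expf_eq0 /= => /eqP.
by rewrite (homog0_const (hq' 2%N _)) // mevalC => ->; rewrite mpolyC0.
Qed.

(* The relation in lowest order, under the substitution of ['X * X_j] for [X_j]. *)
Let conj_linear_coef x q : d = n.+2 -> x \in ts -> phi q = tau c * x ->
  q \is (1 + (d - n.+1)).-homog -> exists b, (to_frame e0 e q)`_1 = b%:MP * c.
Proof.
move=> dE xts qx hq0; have d1 : (d - n.+1 = 1)%N by move: dE; clear; lia.
have top := conj_top dE xts qx hq0; move: hq0.
rewrite d1 => hq; have [sq hq'] := bihomog_to_frame e0 e hq.
have [P PE] := relation xts qx.
set be := (to_frame e0 e q)`_1; set ga := (to_frame e0 e q)`_0.
have hbe : be \is 1.-homog by apply: (hq' 1%N).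
have hM : hF`_n.+1 \is 1.-homog by rewrite -d1; apply: hom; lia.
pose psi : {rmorphism {poly R} -> {poly R}} := horner_eval 1 \o map_poly (@grade K m).
(* [B] and [A] are what is left of [hF] and of the left-hand side once powers of ['X] are taken out.
   Their values at 0 are the leading coefficient of [hF] and [be ^+ n.+1], so the former, a linear
   form, will divide [be]. *)
pose B : {poly R} := \sum_(i < n.+2) (hF`_i)%:P * 'X^(n.+1 - i).
pose A : {poly R} := \sum_(i < n.+2) (ms`_i)%:P * 'X^(n.+1 - i) * (be%:P + ga%:P * 'X) ^+ i.
have psiF : psi hF = 'X * B.
  rewrite /psi /= /horner_eval (@horner_coef_wide _ n.+2); last first.
    by apply: leq_trans (size_poly _ _) _; rewrite sF.
  rewrite mulr_sumr; apply: eq_bigr => i _; rewrite expr1n mulr1 coef_map /=.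
  have id : (i <= d)%N by move: (ltn_ord i) dE; clear; lia.
  rewrite (grade_homog (hom id)) mulrCA -exprS; congr (_ * 'X^_).
  by move: (ltn_ord i) dE; clear; lia.
have psiC p : psi p%:P = grade p by rewrite /psi /= map_polyC /horner_eval hornerC.
have psiX : psi 'X = 1 by rewrite /psi /= map_polyX /horner_eval hornerX.
have qE : to_frame e0 e q = be%:P * 'X + ga%:P.
  apply/polyP => j; rewrite coef_linear; case: j => [|[|[|j]]] //.
  by apply: nth_default; apply: leq_trans sq _.
have gga : grade ga = ga%:P * 'X^2 by apply: grade_homog; apply: (hq' 0%N).
have psiq : psi (to_frame e0 e q) = 'X * (be%:P + ga%:P * 'X).
  by rewrite qE rmorphD rmorphM psiX !psiC (grade_homog hbe) gga; ring.
have msE' : map_poly (psi \o polyC) ms = map_poly (@grade K m) ms.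
  by apply: eq_map_poly => p; apply: psiC.
clearbody psi.
have := congr1 psi PE; rewrite horner_lift psiq (rmorphM psi P) psiF msE'.
have -> : (map_poly (@grade K m) ms).['X * (be%:P + ga%:P * 'X)] = 'X^(n.+1) * A.
  rewrite (@horner_coef_wide _ n.+2); last first.
    by apply: leq_trans (size_poly _ _) _; rewrite sms.
  rewrite mulr_sumr; apply: eq_bigr => i _; rewrite coef_map /=.
  have id : (i <= n.+1)%N by rewrite -ltnS.
  rewrite (grade_homog (ms_homog dE id)) exprMn.
  have -> : 'X^((n.+1 - i).*2) = 'X^(n.+1 - i) * 'X^(n.+1 - i) :> {poly R}.
    by rewrite -exprD addnn.
  have -> : 'X^(n.+1) = 'X^(n.+1 - i) * 'X^i :> {poly R} by rewrite -exprD subnK.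
  by ring.
have B0 : B.[0] = hF`_n.+1.
  rewrite /B horner_sum big_ord_recr /= subnn expr0 mulr1 hornerC big1 ?add0r // => i _.
  by rewrite hornerM hornerXn hornerC expr0n subn_eq0 leqNgt ltn_ord mulr0.
move=> PE'; have PE2 : 'X^n * A = psi P * B.
  have X0 : ('X : {poly R}) != 0 by rewrite polyX_eq0.
  by apply: (mulfI X0); rewrite mulrA -exprS PE'; ring.
have [|H HE] := lowest_dvd _ PE2; first by rewrite B0.
have A0 : A.[0] = be ^+ n.+1.
  rewrite /A horner_sum big_ord_recr /= subnn expr0 mulr1 hornerM hornerC.
  rewrite coef_monic_scale eqxx mul1r big1 ?add0r => [|i _].
    by rewrite horner_exp !hornerE.
  by rewrite !hornerM hornerXn expr0n subn_eq0 leqNgt ltn_ord mulr0 mul0r.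
have [|k hk kE] := homog1_factor Kclosed hM M0 hbe.
  move=> y My; have := congr1 (fun p : {poly R} => p.[0].@[y]) HE.
  rewrite A0 hornerM B0 mevalM My mulr0 rmorphXn /= => /eqP.
  by rewrite expf_eq0 /= => /eqP.
exists (k@_0%MM / n.+1%:R).
have E3 : (k@_0%MM / n.+1%:R)%:MP * kk = (k@_0%MM)%:MP by rewrite -mpolyCM divfK.
by rewrite kE mulrA E3 {1}(homog0_const hk) mulrC.
Qed.

(** At an outer point [c] is a constant and [q] is linear. At an inner point [q] is quadratic, but
    its term in ['X^2] vanishes and its linear coefficient is a multiple of [c]. *)
Let conj_linear x : x \in ts -> exists b g,
  tau c * x = tau (b * c) * phi x0 + tau g.
Proof.
move=> xts; have [q hq qx] := conjugate xts.
have [b [s2 bE]] : exists b, (size (to_frame e0 e q) <= 2)%N /\ (to_frame e0 e q)`_1 = b%:MP * c.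
  have [sq hq'] := bihomog_to_frame e0 e hq.
  case: dn => dE; last first.
    have [b bE] := conj_linear_coef dE xts qx hq; exists b; split=> //.
    have top := conj_top dE xts qx hq.
    apply/leq_sizeP => j; rewrite leq_eqVlt => /orP [/eqP <- //|j2].
    by apply: nth_default; apply: leq_trans sq _; lia.
  have d0 : (d - n.+1 = 0)%N by move: dE; clear; lia.
  move: hc sq hq'; rewrite d0 addn0 => hc0 sq hq'.
  have cE := homog0_const hc0; have cn : c@_0%MM != 0.
    by apply: contraNneq c0 => h; rewrite cE h mpolyC0.
  exists ((to_frame e0 e q)`_1@_0%MM / c@_0%MM); split=> //.
  rewrite {2}cE -mpolyCM divfK //; apply: homog0_const; exact: (hq' 1%N).
exists b%:MP, (to_frame e0 e q)`_0.
rewrite -qx -[q in LHS](to_frameK frame) -horner_class.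
rewrite (@horner_coef_wide _ 2); last exact: leq_trans (size_poly _ _) s2.
by rewrite !big_ord_recl big_ord0 !coef_map /= expr0 expr1 mulr1 addr0 bE addrC.
Qed.

Let t_in : phi x0 \in ts.
Proof.
have : root (map_poly tau hF) (phi x0).
  by apply/rootP; rewrite horner_class (to_frameK frame).
by rewrite tsE rootZ ?tau0 // root_prod_XsubC.
Qed.

Let kkE : kk = n.+1%:R. Proof. exact: (rmorph_nat (@mpolyC m K)). Qed.

Let shift : {poly R} := 'X - a%:P.
Let G : {poly R} := ms \Po shift.

Let sG : size G = n.+2.
Proof. by rewrite size_comp_poly2 ?size_XsubC // sms. Qed.

Let Gcoef : G`_n.+1 = 1 /\ G`_n = 0.
Proof.
have shE : shift = 1%:P * 'X + (- a)%:P by rewrite mul1r polyCN.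
have [] := @coef_comp_affine R ms n 1 (- a); first by rewrite sms.
rewrite -shE -/G !expr1n !mul1r => -> ->.
have -> : ms`_n = kk * a by rewrite coef_monic_scale (ltn_eqF (ltnSn n)) ltnSn subnn mul1r coefZ.
have -> : ms`_n.+1 = 1 by rewrite coef_monic_scale eqxx.
by rewrite mulr1 kkE mulrN subrr.
Qed.

Let Gm : G \is monic.
Proof. by rewrite monicE lead_coefE sG; case: Gcoef => ->. Qed.

Let s : E := tau c * phi x0 + tau a.

Let theta : {rmorphism {poly R} -> E} := horner_eval s \o map_poly tau.

Let thetaC p : theta p%:P = tau p.
Proof. by rewrite /theta /= map_polyC /horner_eval hornerC. Qed.

Let thetaX : theta 'X = s.
Proof. by rewrite /theta /= map_polyX /horner_eval hornerX. Qed.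

Let theta_comp (p q : {poly R}) : theta (p \Po q) = (map_poly tau p).[theta q].
Proof. by rewrite /theta /= map_comp_poly /horner_eval horner_comp. Qed.

Let theta_shift : theta shift = tau c * phi x0.
Proof. by rewrite rmorphB thetaC thetaX /s addrK. Qed.

Let thG : theta G = 0.
Proof. by rewrite theta_comp theta_shift msE root_prod_mul. Qed.

Let lin : {poly R} := c%:P * 'X + a%:P.

Let slin : size lin = 2.
Proof. by rewrite size_MXaddC polyC_eq0 (negbTE c0) size_polyC c0. Qed.

Let theta_lin Q : theta Q = (map_poly tau (Q \Po lin)).[phi x0].
Proof.
rewrite map_comp_poly horner_comp /theta /= /horner_eval; congr _.[_].
by rewrite rmorphD rmorphM /= map_polyX !map_polyC !hornerE.
Qed.

(** Substituting [lin] preserves degrees and turns kernel elements into multiples of [hF], whose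
    degree is that of [G]; a remainder modulo [G] must then be 0. *)
Let kerG p : theta p = 0 -> exists q, p = q * G.
Proof.
move=> tp; exists (rdivp p G); rewrite [LHS](Pdiv.RingMonic.rdivp_eq Gm).
suff -> : rmodp p G = 0 by rewrite addr0.
have sr : (size (rmodp p G) < n.+2)%N by rewrite -sG ltn_rmodpN0 // monic_neq0.
have : theta (rmodp p G) = 0.
  by move: tp; rewrite {1}(Pdiv.RingMonic.rdivp_eq Gm p) rmorphD rmorphM thG mulr0 add0r.
rewrite theta_lin => /horner_ker [P PE].
have hF0 : hF != 0 by rewrite -size_poly_gt0 sF.
have sE := size_comp_poly2 (rmodp p G) slin.
have sPF := congr1 (fun q : {poly R} => size q) PE; rewrite /= sE in sPF.
have [P0'|Pn0] := eqVneq P 0.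
  by apply/eqP; rewrite -size_poly_eq0 sPF P0' mul0r size_poly0.
move: sr; rewrite sPF size_mul // sF; rewrite -size_poly_gt0 in Pn0.
by case: (size P) Pn0 => // j _; rewrite !addnS /=; clear; lia.
Qed.

Let conjugate_rs : exists rs : seq (R * R),
  map_poly tau G = \prod_(z <- rs) ('X - (theta (z.1%:P * 'X + z.2%:P))%:P).
Proof.
have [|rs rsE] := @map_choice (R * R)%type E E (fun z => theta (z.1%:P * 'X + z.2%:P))
    (fun x => tau c * x + tau a) ts.
  move=> x xts; have [b [g ->]] := conj_linear xts.
  exists (b, g + a - b * a); rewrite rmorphD rmorphM !thetaC thetaX /s /=.
  by rewrite rmorphB rmorphD !rmorphM; ring.
exists rs; rewrite -(big_map _ xpredT (fun x => 'X - x%:P)) rsE big_map.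
rewrite map_comp_poly msE rmorph_prod; apply: eq_bigr => x _.
rewrite rmorphB /= comp_polyX comp_polyC rmorphB /= map_polyX map_polyC.
by rewrite polyCD opprD addrAC addrA addrAC.
Qed.

Let equation : c ^+ n *: (kk *: hF) = lin ^+ n.+1 + (G`_0)%:P.
Proof.
have [rs rsE] := conjugate_rs.
have GE : G = 'X^(n.+1) + (G`_0)%:P.
  have n1 : (0 < n)%N by apply: ltnW.
  have kn : n.+1%:R != 0 :> R by rewrite -kkE.
  have tE : map_poly (theta \o polyC) G = map_poly tau G.
    by apply: eq_map_poly => p; apply: thetaC.
  apply: (@cyclic_equation R E theta n G n1 kn Gm sG thG kerG (proj2 Gcoef) rs).
  by rewrite tE.
have msG : ms = G \Po ('X + a%:P).
  by rewrite /G -comp_polyA comp_polyB comp_polyX comp_polyC addrK comp_polyXr.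
have linE : ('X + a%:P) \Po (c%:P * 'X) = lin by apply: comp_add_scale.
have E1 : ms \Po (c%:P * 'X) = c ^+ n *: P0 := monic_scale_comp sP0 P0n.
have E2 : ms \Po (c%:P * 'X) = G \Po lin by rewrite {1}msG -comp_polyA linE.
exact: etrans (esym E1) (etrans E2 (comp_cyclic lin GE)).
Qed.

(** At an inner point, the constant term of the derivative of [equation] makes [a ^+ n] a multiple
    of [c ^+ n.-1]. Since [1 < n], [a] vanishes wherever the linear form [c] does. *)
Let a_multiple : exists2 b, b \is 1.-homog & a = c * b.
Proof.
have ha : a \is (d - n).-homog by apply: hom; lia.
case: dn => dE.
  move: ha hc; rewrite dE subSnn subnn => ha hc0; have cE := homog0_const hc0.
  have cn : c@_0%MM != 0 by apply: contraNneq c0 => h; rewrite cE h mpolyC0.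
  exists ((c@_0%MM)^-1 *: a); first exact: dhomogZ.
  by rewrite {1}cE mul_mpolyC scalerA mulfV // scale1r.
have d1 : (d - n.+1 = 1)%N by move: dE; clear; lia.
have d2 : (d - n = 2)%N by move: dE; clear; lia.
rewrite d2 in ha; have hc1 : c \is 1.-homog by rewrite -d1.
apply: (homog1_factor Kclosed hc1 c0 ha) => y cy.
have := congr1 (fun p : {poly R} => (deriv p)`_0) equation.
rewrite !derivZ !coefZ derivD derivC addr0 deriv_exp => eq0.
have slinD : deriv lin = c%:P by rewrite derivD derivM !derivC derivX mul0r add0r addr0 mulr1.
have lin0 : (lin ^+ n)`_0 = a ^+ n.
  by rewrite -horner_coef0 horner_exp !hornerE.
move: eq0; rewrite slinD coefMn coefCM /= lin0 -mulr_natl -kkE => eq0.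
have E2 : c ^+ n.-1 * (deriv hF)`_0 = a ^+ n.
  apply: (mulfI c0); apply: (mulfI kk0); rewrite -eq0.
  have -> : c ^+ n = c * c ^+ n.-1 by rewrite -exprS prednK // ltnW.
  ring.
have := congr1 (meval y) E2; rewrite mevalM !rmorphXn /= cy expr0n.
have -> : (n.-1 == 0%N) = false by move: n2; clear; lia.
by rewrite mul0r => /esym/eqP; rewrite expf_eq0 => /andP[_ /eqP].
Qed.

(** With [a = c b], the power [c ^+ n] cancels from [equation] and leaves
    [(n + 1) hF = c ('X + b)^(n+1) + g]; differentiating gives [M = c] and [L = x0 + b]. *)
Lemma cyclic_form : exists M L : {mpoly K[N]},
  [/\ \sum_i e0 i *: F^`M(i) = M * L ^+ n, L \is 1.-homog /\ L.@[e0] = 1,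
      M \is (d - n.+1).-homog, \sum_i e0 i *: M^`M(i) = 0 & M != 0].
Proof.
have [b hb aE] := a_multiple; case: (frame) => hx0 hl [x01 _] [le0 _] _.
have cnz : c ^+ n != 0 by rewrite expf_neq0.
have linE : lin = c%:P * ('X + b%:P).
  transitivity (c%:P * 'X + c%:P * b%:P); last by rewrite mulrDr.
  by congr (_ + _); exact: etrans (congr1 polyC aE) (polyCM c b).
have [g gE] : exists g, G`_0 = c ^+ n * g.
  exists (kk * hF`_0 - c * b ^+ n.+1).
  have := congr1 (fun p : {poly R} => p`_0) equation.
  rewrite !coefZ coefD coefC /= -[(lin ^+ _)`_0]horner_coef0 linE horner_exp !hornerE.
  move=> H; have -> : c ^+ n * (kk * hF`_0 - c * b ^+ n.+1) =
      c ^+ n * (kk * hF`_0) - (c * b) ^+ n.+1 by rewrite (exprMn n.+1 c b) (exprSr c); ring.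
  have -> : c ^+ n * (kk * hF`_0) = (c * b) ^+ n.+1 + G`_0 by rewrite mulrA; exact: H.
  by rewrite addrAC subrr add0r.
have E1 : kk *: hF = c%:P * ('X + b%:P) ^+ n.+1 + g%:P.
  have cnz' : (c ^+ n)%:P != 0 :> {poly R} by rewrite polyC_eq0.
  apply: (mulfI cnz'); rewrite [LHS](_ : _ = lin ^+ n.+1 + (G`_0)%:P); last first.
    by rewrite mul_polyC; exact: equation.
  rewrite gE linE (exprMn n.+1 c%:P).
  have cnE : (c ^+ n)%:P = c%:P ^+ n :> {poly R} by exact: (rmorphXn (@polyC R)).
  by rewrite (polyCM (c ^+ n) g) cnE (exprS c%:P); ring.
have E2 : deriv hF = c%:P * ('X + b%:P) ^+ n.
  have kk0' : kk%:P != 0 :> {poly R} by rewrite polyC_eq0.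
  apply: (mulfI kk0'); have := congr1 (@deriv R) E1.
  rewrite derivZ derivD derivC addr0 derivM derivC mul0r add0r deriv_exp derivD derivX derivC.
  rewrite addr0 mul1r /= -mul_polyC -[_ *+ n.+1]mulr_natl => ->.
  by rewrite kkE rmorph_nat mulrCA.
exists (c \mPo l), (x0 + (b \mPo l)); split.
- rewrite -[LHS](to_frameK frame) -deriv_to_frame E2 (rmorphM (of_frame x0 l)).
  rewrite (rmorphXn (of_frame x0 l)) (rmorphD (of_frame x0 l)) /=.
  by congr (_ * (_ + _) ^+ _); [apply: of_frameC|apply: of_frameX|apply: of_frameC].
- split; first by rewrite rpredD //; apply: homog_comp.
  rewrite mevalD x01 comp_mpoly_meval [X in _ + X](_ : _ = 0) ?addr0 //.
  by apply: (homog_meval0 (d := 1) _ hb) => // j; apply: le0.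
- exact: homog_comp.
- rewrite -[LHS](to_frameK frame) -deriv_to_frame.
  have -> : to_frame e0 e (c \mPo l) = c%:P by rewrite -(of_frameC x0) (of_frameK frame).
  by rewrite derivC rmorph0.
- apply: contraNneq c0 => cl0; have := of_frameC x0 l c; rewrite cl0 => h.
  by have := of_frameK frame c%:P; rewrite h rmorph0 => /esym/eqP; rewrite polyC_eq0.
Qed.

End CyclicForm.

(** * The normal form gives Galois points *)

Lemma alg_closed_split (K : fieldType) (p : {poly K}) : alg_closed K ->
  p \is monic -> exists rs, p = \prod_(x <- rs) ('X - x%:P).
Proof.
move=> Kclosed; move: {2}(size p) (leqnn (size p)) => n; elim: n p => [|n IH] p sp pm.
  by move: sp; rewrite leqn0 size_poly_eq0 (negbTE (monic_neq0 pm)).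
have [s1|s1] := eqVneq (size p) 1%N.
  exists [::]; rewrite big_nil; have /size_poly1P [c _ pE] : size p == 1%N by rewrite s1.
  by move: pm; rewrite pE monicE lead_coefC => /eqP ->.
have [x /factor_theorem [q qE]] := Kclosed p s1.
have qm : q \is monic by rewrite -(monicMr _ (monicXsubC x)) -qE.
have [|rs rsE] := IH q _ qm.
  by move: sp; rewrite qE size_Mmonic ?monicXsubC ?monic_neq0 // size_XsubC addn2.
by exists (x :: rs); rewrite big_cons -rsE mulrC.
Qed.

Lemma map_poly_XnsubC (R S : nzRingType) (f : {rmorphism R -> S}) n c :
  map_poly f ('X^n - c%:P) = 'X^n - (f c)%:P.
Proof. by rewrite rmorphB /= map_polyXn map_polyC. Qed.

Lemma map_poly_prod_XsubC (R S : comNzRingType) (f : {rmorphism R -> S}) rs :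
  map_poly f (\prod_(x <- rs) ('X - x%:P)) = \prod_(x <- map f rs) ('X - x%:P).
Proof.
rewrite rmorph_prod big_map; apply: eq_bigr => x _.
by rewrite rmorphB /= map_polyX map_polyC.
Qed.

Lemma prod_roots_unity (R : idomainType) n (rs : seq R) (y : R) : (0 < n)%N ->
  'X^n - 1 = \prod_(x <- rs) ('X - x%:P) ->
  \prod_(x <- map (fun x => y * x) rs) ('X - x%:P) = 'X^n - (y ^+ n)%:P.
Proof.
move=> n0 rsE; have szrs : size rs = n.
  by apply/eqP; rewrite -eqSS -size_prod_seq_XsubC -rsE size_XnsubC.
rewrite big_map; apply/polyP => i; rewrite coefB coefXn coefC.
have [ni|ni] := leqP i n; last first.
  rewrite gtn_eqF // (gtn_eqF (leq_ltn_trans (leq0n n) ni)) subrr nth_default //.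
  rewrite -(big_map (fun w => y * w) xpredT (fun x => 'X - x%:P)).
  by rewrite size_prod_seq_XsubC size_map szrs.
rewrite coef_prod_scale szrs // -rsE coefB coefXn coef1.
have [->|ne] := eqVneq i n.
  by rewrite subnn mul1r; case: (n) n0 => // n' _; rewrite /= !subr0.
rewrite !sub0r; case: i ni ne => [|i] ni ne; last by rewrite /= oppr0 mulr0.
by rewrite /= subn0 mulrN mulr1.
Qed.

(** * Kummer extensions *)

Section Kummer.

Variables (K E : fieldType) (kap : {rmorphism K -> E}).
Hypothesis Kclosed : alg_closed K.
Hypothesis char0 : forall n, n.+1%:R != 0 :> K.
Variables (k L : set E) (z : E) (n : nat).
Hypotheses (k1 : k 1) (kB : forall x y, k x -> k y -> k (x - y)).
Hypothesis kV : forall x y, k x -> k y -> k (x / y).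
Hypothesis kkap : forall a, k (kap a).
Hypotheses (z0 : z != 0) (n0 : (0 < n)%N) (zn : k (z ^+ n)).
Hypothesis LE : forall u, L u <-> exists p q : {poly E},
  [/\ forall i, k p`_i, forall i, k q`_i, q.[z] != 0 & u = p.[z] / q.[z]].

Let inK : {pred E} := fun x => `[< k x >].

Let inK_closed : divring_closed inK.
Proof.
split=> [|x y /asboolP kx /asboolP ky|x y /asboolP kx /asboolP ky]; apply/asboolP => //.
  exact: kB.
exact: kV.
Qed.

Let k0 : fieldType := subfield_of inK_closed.
Let iota : {rmorphism k0 -> E} := (val : subfield_of inK_closed -> E).

Let iotaP c : k c -> exists a, iota a = c.
Proof. by move=> /asboolP kc; exists (SubfieldOf kc). Qed.

Let iota_k a : k (iota a).
Proof. exact/asboolP/(valP a). Qed.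

Let lift_poly (p : {poly E}) : (forall i, k p`_i) -> exists q, map_poly iota q = p.
Proof.
move=> kp; have [g gE] := choice (fun i => iotaP (kp i)).
exists (\poly_(i < size p) g i); apply/polyP => i; rewrite coef_map coef_poly /=.
case: ltnP => [_|h]; first exact: gE.
by rewrite [p`_i]nth_default //; apply: rmorph0.
Qed.

Let minimal : exists p : {poly k0}, [/\ p != 0, root (map_poly iota p) z &
  forall q, root (map_poly iota q) z -> q != 0 -> (size p <= size q)%N].
Proof.
pose Q s := exists p : {poly k0}, [/\ p != 0, root (map_poly iota p) z & size p = s].
have [|s [p [p0 pz sp]] pmin] := @nat_min Q.
  have [a aE] := iotaP zn; exists n.+1, ('X^n - a%:P); split.
  - by rewrite -size_poly_eq0 size_XnsubC.
  - by rewrite map_poly_XnsubC aE rootE !hornerE subrr.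
  - exact: size_XnsubC.
exists p; split=> // q qz q0; rewrite sp; apply: pmin; by exists q.
Qed.

(** [k(z)] is built from the minimal polynomial of [z] and embedded in [E]. It is the splitting
    field of ['X^n - z^n]: [K] supplies the roots of unity, which are distinct in characteristic
    0. *)
Lemma kummer_galois : galois_extension k L.
Proof.
have [p [p0 pz pmin]] := minimal.
have irr : irreducible_poly p by apply/(subfx_irreducibleP pz p0).
pose L0 : fieldExtType k0 := SubFieldExtType pz irr.
pose f : {rmorphism L0 -> E} := @subfx_inj k0 E iota z p.
pose zeta : L0 := subfx_root iota z p.
have fzeta : f zeta = z := subfx_inj_root pz p0.
have fA a : f a%:A = iota a := subfx_inj_base pz p0 a.
have fR (x : L0) : exists q, x = (map_poly (in_alg L0) q).[zeta].
  by have [q qE] := subfxEroot pz p0 x; exists q.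
have fq q : f (map_poly (in_alg L0) q).[zeta] = (map_poly iota q).[z].
  rewrite -horner_map -map_poly_comp fzeta; congr _.[_].
  by apply: eq_map_poly => a; apply: fA.
have finj : injective f by apply: fmorph_inj.
clearbody f zeta.
have [rs rsE] := alg_closed_split Kclosed (monicXnsubC (1 : K) n0).
have rsu : uniq rs.
  rewrite -separable_prod_XsubC -rsE; apply: separable_Xn_sub_1.
  by case: n n0 => // n' _; apply: char0.
have [zs zsE] : exists zs, map f zs = map (fun w => z * kap w) rs.
  apply: (map_choice (f := f)) => w _; have [a aE] := iotaP (kkap w).
  by exists (zeta * a%:A); rewrite rmorphM fzeta fA aE.
have [a aE] := iotaP zn.
have zetan : zeta ^+ n = a%:A by apply: finj; rewrite rmorphXn fzeta fA aE.
have zsP : 'X^n - (zeta ^+ n)%:P = \prod_(x <- zs) ('X - x%:P).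
  apply: (map_poly_inj f); rewrite map_poly_XnsubC map_poly_prod_XsubC rmorphXn fzeta zsE.
  have rsE' : 'X^n - 1 = \prod_(x <- map kap rs) ('X - x%:P).
    by rewrite -map_poly_prod_XsubC -rsE map_poly_XnsubC rmorph1.
  by rewrite -(prod_roots_unity z n0 rsE') -map_comp.
have zsu : uniq zs.
  apply: (@map_uniq _ _ f); rewrite zsE map_inj_uniq // => x y /(mulfI z0); exact: fmorph_inj.
have zin : zeta \in zs.
  rewrite -(mem_map finj) fzeta zsE; apply/mapP; exists 1; last by rewrite rmorph1 mulr1.
  by rewrite -root_prod_XsubC -rsE rootE !hornerE expr1n subrr.
have zpoly : 'X^n - (zeta ^+ n)%:P \is a polyOver (1%VS : {vspace L0}).
  by rewrite zetan rpredB ?rpredX ?polyOverX // polyOverC rpredZ // mem1v.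
have spl : splittingFieldFor 1 ('X^n - (zeta ^+ n)%:P) {:L0}.
  exists zs; first by rewrite zsP eqpxx.
  apply/eqP; rewrite eqEsubv subvf; apply/subvP => x _; have [q ->] := fR x.
  apply: rpred_horner; last exact: seqv_sub_adjoin.
  apply/polyOverP => i; rewrite coef_map; apply: memvZ; exact: mem1v.
have ax : SplittingField.axiom L0 by exists ('X^n - (zeta ^+ n)%:P).
pose L1 : splittingFieldType k0 := HB.pack L0 (FieldExt_isSplittingField.Build k0 L0 ax).
exists k0, L1, f; split.
- apply/seteqP; split=> [_ [x _ <-]|u /LE [P [Q [kP kQ Qz ->]]]].
    apply/LE; have [q ->] := fR x; exists (map_poly iota q), 1; rewrite fq.
    rewrite hornerC oner_neq0 divr1; split=> // i; first by rewrite coef_map; apply: iota_k.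
    rewrite coef1; case: (i == 0%N) => //.
    by have := kB k1 k1; rewrite subrr.
  have [P' P'E] := lift_poly kP; have [Q' Q'E] := lift_poly kQ.
  exists ((map_poly (in_alg L0) P').[zeta] / (map_poly (in_alg L0) Q').[zeta]) => //.
  by rewrite fmorph_div !fq P'E Q'E.
- apply/seteqP; split=> [_ [b _ <-]|c kc]; first by rewrite fA; apply: iota_k.
  by have [b bE] := iotaP kc; exists b => //; rewrite fA.
- apply/splitting_galoisField; exists ('X^n - (zeta ^+ n)%:P); split=> //.
  by rewrite zsP separable_prod_XsubC.
Qed.

End Kummer.

Section FractionSets.

Variables (K E : fieldType) (N : nat) (phi : {rmorphism {mpoly K[N]} -> E}).

Definition homog_fractions : set E := [set u | exists k a b,
  [/\ a \is k.-homog, b \is k.-homog, phi b != 0 & u = phi a / phi b]].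

Lemma homog_fractionsC c : homog_fractions (phi c%:MP).
Proof.
exists 0%N, c%:MP, 1; split; [exact: homogC|by rewrite -mpolyC1; apply: homogC| |].
  by rewrite rmorph1 oner_neq0.
by rewrite rmorph1 divr1.
Qed.

Lemma homog_fractions1 : homog_fractions 1.
Proof. by have := homog_fractionsC 1; rewrite mpolyC1 rmorph1. Qed.

Lemma homog_fractionsB x y :
  homog_fractions x -> homog_fractions y -> homog_fractions (x - y).
Proof.
move=> [k [a [b [ha hb b0 ->]]]] [k' [a' [b' [ha' hb' b0' ->]]]].
exists (k + k')%N, (a * b' - a' * b), (b * b'); split.
- by apply: rpredB; [|rewrite addnC]; apply: dhomogM.
- exact: dhomogM.
- by rewrite rmorphM mulf_neq0.
- by rewrite rmorphB !rmorphM -[- (phi a' / _)]mulNr addf_div // mulNr.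
Qed.

Lemma homog_fractionsV x y :
  homog_fractions x -> homog_fractions y -> homog_fractions (x / y).
Proof.
move=> [k [a [b [ha hb b0 ->]]]] [k' [a' [b' [ha' hb' b0' ->]]]].
have [a0|a0] := eqVneq (phi a') 0.
  rewrite a0 mul0r invr0 mulr0 -(subrr 1).
  by apply: homog_fractionsB; apply: homog_fractions1.
exists (k + k')%N, (a * b'), (b * a'); split; [exact: dhomogM|exact: dhomogM| |].
  by rewrite rmorphM mulf_neq0.
by rewrite !rmorphM invf_div mulf_div.
Qed.

Lemma homog_fractionsD x y :
  homog_fractions x -> homog_fractions y -> homog_fractions (x + y).
Proof.
move=> hx hy; rewrite -[y]opprK -[- y]sub0r; apply: homog_fractionsB => //.
by apply: homog_fractionsB => //; rewrite -(subrr 1); apply: homog_fractionsB; apply: homog_fractions1.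
Qed.

Lemma homog_fractionsM x y :
  homog_fractions x -> homog_fractions y -> homog_fractions (x * y).
Proof.
move=> hx hy; rewrite -[y]invrK -[y^-1]mul1r; apply: homog_fractionsV => //.
by apply: homog_fractionsV => //; apply: homog_fractions1.
Qed.

Lemma homog_fractions_horner (p : {poly E}) z : (forall i, homog_fractions p`_i) ->
  homog_fractions z -> homog_fractions p.[z].
Proof.
move=> hp hz; rewrite horner_coef; apply: big_ind => [||i _].
- by rewrite -(subrr 1); apply: homog_fractionsB; apply: homog_fractions1.
- exact: homog_fractionsD.
- apply: homog_fractionsM => //; elim: (nat_of_ord i) => [|j IH].
    by rewrite expr0; apply: homog_fractions1.
  by rewrite exprS; apply: homog_fractionsM.
Qed.

End FractionSets.

Lemma deriv_const (R : idomainType) (p q : {poly R}) :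
  (forall n, n.+1%:R != 0 :> R) -> deriv p = deriv q -> forall i, p`_i.+1 = q`_i.+1.
Proof.
move=> R0 pq i; have := congr1 (fun r : {poly R} => r`_i) pq; rewrite !coef_deriv.
rewrite -[p`_i.+1 *+ _]mulr_natr -[q`_i.+1 *+ _]mulr_natr; apply: mulIf; exact: R0.
Qed.

Section CyclicGalois.

Variables (K : fieldType) (N m d n : nat) (F : {mpoly K[N]}).
Hypothesis Kclosed : alg_closed K.
Hypothesis char0 : forall n, n.+1%:R != 0 :> K.
Hypothesis Fh : F \is d.-homog.
Variables (E : fieldType) (phi : {rmorphism {mpoly K[N]} -> E}).
Hypothesis phiF : phi F = 0.
Variables (e0 : 'I_N -> K) (e : 'I_m -> 'I_N -> K).
Variables (x0 : {mpoly K[N]}) (l : m.-tuple {mpoly K[N]}).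
Hypothesis frame : dual_frame e0 e x0 l.

Local Notation R := {mpoly K[m]}.
Local Notation hF := (to_frame e0 e F).

Hypotheses (n1 : (0 < n)%N) (dn : (n.+1 <= d)%N) (m0 : (0 < m)%N).
Variables (A B : R).
Hypotheses (hFE : hF = A%:P * 'X^(n.+1) + B%:P) (A0 : A != 0).

Variable tau : {rmorphism R -> E}.
Hypothesis tauE : forall p, tau p = phi (p \mPo l).
Hypothesis tau0 : forall p, (tau p == 0) = (p == 0).
Hypothesis horner_class : forall Q : {poly R}, (map_poly tau Q).[phi x0] = phi (of_frame x0 l Q).
Hypothesis horner_ker : forall Q : {poly R},
  (map_poly tau Q).[phi x0] = 0 -> exists P, Q = P * hF.

Let y : E := tau 'X_(Ordinal m0).

Let y0 : y != 0. Proof. by rewrite tau0 -msize_poly_eq0 msizeX. Qed.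

Let yE : y = phi (tnth l (Ordinal m0)).
Proof. by rewrite /y tauE comp_mpolyXU -tnth_nth. Qed.

Let tXn i : tau ('X_(Ordinal m0) ^+ i) = y ^+ i. Proof. exact: rmorphXn. Qed.

Let hXn i : 'X_(Ordinal m0) ^+ i \is [in K[m], i.-homog].
Proof.
rewrite -[in X in X.-homog](mul1n i); apply: dhomogMn; by rewrite dhomogX /= mdeg1.
Qed.

Let sF : size hF = n.+2.
Proof.
rewrite hFE size_polyDl size_Cmul // size_polyXn //.
by rewrite (leq_ltn_trans (size_polyC_leq1 _)).
Qed.

Let hom i : (i <= d)%N -> hF`_i \is (d - i).-homog.
Proof. by have [_ h] := bihomog_to_frame e0 e Fh; apply: h. Qed.

Let hA : A \is (d - n.+1).-homog.
Proof.
have := hom dn; rewrite hFE coefD coefCM coefXn eqxx mulr1 coefC.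
by rewrite addr0.
Qed.

Let hB : B \is d.-homog.
Proof.
have := hom (leq0n d); rewrite hFE coefD coefCM coefXn coefC /= mulr0 add0r.
by rewrite subn0.
Qed.

Let t0 : phi x0 != 0.
Proof.
apply/eqP => t0; have [|P PE] := horner_ker (Q := 'X); first by rewrite map_polyX hornerX.
have P0 : P != 0.
  by apply/eqP => P0; have := polyX_eq0 R; rewrite PE P0 mul0r eqxx.
have F0 : hF != 0 by rewrite -size_poly_gt0 sF.
have := size_polyX R; rewrite PE size_mul // sF; rewrite -size_poly_gt0 in P0.
case: (size P) P0 => // j _; rewrite addSn /= => h; move: n1 h; clear; lia.
Qed.

(** Divided by [y ^+ k], a form becomes a polynomial in [x0 / y] over the base field; hence [x0 / y]
    generates the function field. *)
Let frac_poly k p : p \is k.-homog -> exists P : {poly E},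
  (forall i, homog_fractions tau P`_i) /\ P.[phi x0 / y] = phi p / y ^+ k.
Proof.
move=> hp; have [sp hp'] := bihomog_to_frame e0 e hp; set P := to_frame e0 e p in sp hp'.
exists (\poly_(i < k.+1) (tau P`_i / y ^+ (k - i))); split=> [i|].
  rewrite coef_poly; case: ifP => ik; last first.
    by rewrite -(subrr 1); apply: homog_fractionsB; apply: homog_fractions1.
  exists (k - i)%N, P`_i, ('X_(Ordinal m0) ^+ (k - i)); rewrite tXn expf_neq0 //.
  by split=> //; apply: hp'; rewrite -ltnS.
rewrite horner_poly -[p](to_frameK frame) -horner_class -/P.
rewrite (@horner_coef_wide _ k.+1); last exact: leq_trans (size_poly _ _) sp.
rewrite mulr_suml; apply: eq_bigr => i _; rewrite coef_map /= expr_div_n.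
rewrite mulf_div -exprD subnK; last by rewrite -ltnS.
by [].
Qed.

(** For [z = x0 / y] the equation reads [z^(n+1) = - B / (A y^(n+1))], an element of the base
    field. *)
Lemma cyclic_galois : galois_extension (homog_fractions tau) (homog_fractions phi).
Proof.
have [hx0 hl _ _ _] := frame.
have tau_phi u : homog_fractions tau u -> homog_fractions phi u.
  move=> [k [a [b [ha hb b0 ->]]]]; exists k, (a \mPo l), (b \mPo l).
  by rewrite -!tauE; split=> //; apply: homog_comp.
have zf : homog_fractions phi (phi x0 / y).
  by exists 1%N, x0, (tnth l (Ordinal m0)); rewrite -yE.
pose kap : {rmorphism K -> E} := phi \o @mpolyC N K.
apply: (@kummer_galois K E kap Kclosed char0 _ _ (phi x0 / y) n.+1) => //.
- exact: homog_fractions1.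
- exact: homog_fractionsB.
- exact: homog_fractionsV.
- move=> a; have := homog_fractionsC tau a; rewrite tauE comp_mpolyC; exact.
- by rewrite mulf_neq0 // invr_neq0.
- have : tau A * phi x0 ^+ n.+1 + tau B = 0.
    have := horner_class hF; rewrite (to_frameK frame) phiF hFE => <-.
    by rewrite rmorphD rmorphM /= map_polyXn !map_polyC !hornerE.
  move/eqP; rewrite addr_eq0 => /eqP AB.
  exists d, (- B), (A * 'X_(Ordinal m0) ^+ n.+1); split.
  + by rewrite rpredN.
  + by rewrite -(subnK dn); apply: dhomogM.
  + by rewrite rmorphM mulf_neq0 ?tXn ?expf_neq0 // tau0.
  + rewrite rmorphN rmorphM tXn expr_div_n -AB -mulf_div divff ?mul1r // tau0 //.
- move=> u; split=> [[k [a [b [ha hb b0 ->]]]]|[p [q [hp hq q0 ->]]]]; last first.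
    by apply: homog_fractionsV; apply: homog_fractions_horner => // i; apply: tau_phi.
  have [P [hP PE]] := frac_poly ha; have [Q [hQ QE]] := frac_poly hb.
  have yk : y ^+ k != 0 by rewrite expf_neq0.
  exists P, Q; split=> //; first by rewrite QE mulf_neq0 // invr_eq0.
  by rewrite PE QE; field; rewrite yk b0.
Qed.

End CyclicGalois.

(** * Galois points in terms of the normal form *)

Section GaloisPoints.

Variables (K : fieldType) (V : vectType K) (X : hypersurface V).
Hypothesis Kclosed : alg_closed K.
Hypothesis char0 : forall n, n.+1%:R != 0 :> K.

Local Notation N := (\dim {:V}).
Local Notation KV := {mpoly K[N]}.
Local Notation ev p v := (p : KV).@[coords v].
Local Notation F := (hpoly X).
Local Notation d := (degree X).

(* The zeros of [jacobian F] are the singular points of [X]: such a plane exists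
   as soon as they have codimension at least 2 in [X]. *)
Definition avoiding_plane := exists v0 a b : V,
  [/\ ev F v0 != 0, free [:: v0; a; b] & no_zero [:: v0; a; b] (jacobian F)].

Lemma vanish_line (p : KV) k (v : V) : p \is k.-homog ->
  vanish p <[v]>%VS <-> ev p v = 0.
Proof.
move=> hp; split=> [|pv w /vlineP [c ->]]; first by apply; apply: memv_line.
by rewrite (ev_homogZ _ _ hp) pv mulr0.
Qed.

Lemma locus_line (v : V) : v != 0 -> locus X <[v]>%VS <-> ev F v = 0.
Proof.
move=> v0; rewrite -(vanish_line _ (hpoly_homog X)); split=> [[]//|Fv].
by split=> //; apply: points_line => //; apply: memvf.
Qed.

Lemma frame_class (phi : {rmorphism KV -> fraction_field X}) v m
    (e : 'I_m -> 'I_N -> K) x0 l : dual_frame (coords v) e x0 l ->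
  (forall p, (phi p == 0) = hideal X p) ->
  (1 < size (to_frame (coords v) e F))%N ->
  [/\ forall p, class_const phi l p = phi (p \mPo l),
      forall p, (class_const phi l p == 0) = (p == 0),
      forall Q, (map_poly (class_const phi l) Q).[phi x0] = phi (of_frame x0 l Q) &
      forall Q, (map_poly (class_const phi l) Q).[phi x0] = 0 ->
        exists P, Q = P * to_frame (coords v) e F].
Proof.
move=> frame phi0 sF; split=> //.
- by move=> p; apply: (class_const_eq0 phi0 frame sF).
- by move=> Q; apply: class_frame.
- by move=> Q; apply: (class_frame_ker phi0 frame).
Qed.

Lemma galois_projection_form v n : avoiding_plane -> v != 0 -> (1 < n)%N ->
  d = n.+1 \/ d = n.+2 ->
  (forall e x0 (l : N.-1.-tuple KV), dual_frame (coords v) e x0 l ->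
    size (to_frame (coords v) e F) = n.+2) ->
  galois_projection X <[v]>%VS -> galois_form F d n.+1 v.
Proof.
move=> [v0 [a [b [Fv0 frs NW]]]] vn0 n2 dn sizeF [l' [hl' l'v] gal].
have [phi [phiE phi0 fracphi]] := exists_class X.
have [i0 vi0] := coords_neq0 vn0; have [e [x0 [l frame]]] := exists_frame vi0.
have sF := sizeF e x0 l frame.
have sF1 : (1 < size (to_frame (coords v) e F))%N by rewrite sF.
have m0 : (0 < N.-1)%N.
  have := dimvS (subvf <<[:: v0; a; b]>>%VS); rewrite (eqP frs) /=; case: N => [|[|[|]]] //.
have lv j : ev (tnth l' j) v = 0 by apply: (proj1 (l'v v)); apply: memv_line.
have [ts [tsE tsf]] := galois_split Kclosed phiE phi0 frame sF1 m0 hl' lv gal.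
have [tauE tau0 hc hk] := frame_class frame phi0 sF1.
have normal u : integralOver phi u -> exists p, phi p = u.
  exact: (normal_hypersurface Kclosed (hpoly_homog X) Fv0 frs NW (class_hpoly phi0)
    (class_ker phi0) fracphi).
rewrite lead_coefE sF in tsE.
have [M [L [FE [hL Lv] hM DM Mn]]] := cyclic_form Kclosed char0 (hpoly_homog X)
  (class_hpoly phi0) (class_ker phi0) normal frame n2 sF dn tauE tau0 hc hk tsE tsf.
by exists M, L; split=> //; split=> //; rewrite Lv oner_neq0.
Qed.

(** With [L / L(v)] as coordinate, the derivative of [F] is a monomial in ['X]; integration in
    characteristic 0 gives [A 'X^(n+1) + B]. *)
Lemma galois_form_projection v n : (1 < N)%N -> v != 0 -> (0 < n)%N -> (n.+1 <= d)%N ->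
  galois_form F d n.+1 v -> galois_projection X <[v]>%VS.
Proof.
move=> N1 vn0 n1 dn [M [L [FE [hL Lv] hM DM Mn]]].
have hx : (ev L v)^-1 *: L \is 1.-homog by apply: dhomogZ.
have [|e [l frame]] := exists_dual_frame (w := coords v) hx; first by rewrite mevalZ mulVf.
set x0 := _ *: L in frame; have [hx0 hl _ [lv _] _] := frame.
exists l.
  split=> // w; split=> [/vlineP [c ->] j|lw].
    by rewrite (ev_homog1Z _ _ (hl j)) lv mulr0.
  suff -> : w = ev x0 w *: v by rewrite rpredZ // memv_line.
  apply/eqP; rewrite -subr_eq0; apply/eqP/coords_eq0 => i.
  rewrite -scaleNr coordsD coordsZ {1}(frame_point frame) big1 ?addr0 => [|j _].
    by rewrite mulNr subrr.
  by rewrite lw mul0r.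
have [phi [phiE phi0 fracphi]] := exists_class X.
have R0 k : k.+1%:R != 0 :> {mpoly K[N.-1]}.
  by rewrite -(rmorph_nat (@mpolyC _ K)) mpolyC_eq0.
pose hF := to_frame (coords v) e F.
pose A0 := (to_frame (coords v) e M)`_0.
have ME : to_frame (coords v) e M = A0%:P.
  apply/polyP => i; rewrite coefC; case: i => [|i] //.
  have -> : (to_frame (coords v) e M)`_i.+1 = (0 : {poly {mpoly K[N.-1]}})`_i.+1.
    apply: deriv_const => //; rewrite deriv_to_frame deriv0.
    by rewrite -[X in to_frame _ _ X]/(dderiv v M) DM rmorph0.
  exact: coef0.
have LE : to_frame (coords v) e L = (ev L v)%:MP%:P * 'X.
  rewrite -[RHS](of_frameK frame); congr (to_frame _ _ _).
  rewrite (rmorphM (of_frame x0 l)) /= of_frameC of_frameX comp_mpolyC mul_mpolyC.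
  by rewrite /x0 scalerA mulfV // scale1r.
have A00 : A0 != 0.
  apply: contraNneq Mn => A00; rewrite -[M](to_frameK frame) ME A00 polyC0.
  by pose f : {rmorphism _ -> _} := of_frame x0 l; rewrite -[of_frame x0 l]/(f : _ -> _) rmorph0.
pose A := (n.+1%:R^-1 * ev L v ^+ n)%:MP * A0.
have An : A != 0.
  by rewrite mulf_neq0 // mpolyC_eq0 mulf_neq0 ?invr_eq0 ?expf_neq0.
have hFE : hF = A%:P * 'X^(n.+1) + (hF`_0)%:P.
  apply/polyP => -[|i]; first by rewrite coefD coefCM coefXn mulr0 add0r coefC.
  apply: deriv_const => //; rewrite /hF deriv_to_frame.
  rewrite -[X in to_frame _ _ X]/(dderiv v F) FE (rmorphM (to_frame (coords v) e)).
  rewrite (rmorphXn (to_frame (coords v) e)) /= ME LE derivD derivC addr0 derivM derivC mul0r add0r.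
  rewrite derivXn /= -mulr_natr exprMn /A.
  have -> : ((ev L v)%:MP%:P : {poly {mpoly K[N.-1]}}) ^+ n =
      (n.+1%:R * (n.+1%:R^-1 * ev L v ^+ n)%:MP)%:P.
    rewrite -(rmorph_nat (@mpolyC _ K)) -mpolyCM mulrA mulfV // mul1r.
    by move: (ev L v) => z; rewrite !rmorphXn.
  by rewrite !polyCM rmorph_nat; ring.
have sF1 : (1 < size hF)%N.
  rewrite hFE size_polyDl size_Cmul // size_polyXn //.
  by rewrite (leq_ltn_trans (size_polyC_leq1 _)).
have [tauE tau0 hc hk] := frame_class frame phi0 sF1.
have m0 : (0 < N.-1)%N by case: N N1 => [|[|]].
have := cyclic_galois Kclosed char0 (hpoly_homog X) (class_hpoly phi0) frame n1 dn m0 hFE An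
  tauE tau0 hc hk.
have -> : homog_fractions phi = function_field X.
  by apply/seteqP; split=> u; rewrite (function_fieldP phiE phi0).
suff -> : homog_fractions (class_const phi l) = pullback_field X l by [].
apply/seteqP; split=> u [k [g [h [hg hh h0 ->]]]]; exists k, g, h.
  by rewrite phiE -!tauE; split=> //; rewrite -phi0 -tauE.
by rewrite phiE -!tauE; split=> //; rewrite tauE phi0.
Qed.

Lemma outer_galoisP v : avoiding_plane -> v != 0 -> (3 < d)%N ->
  outer_galois X <[v]>%VS <-> ev F v != 0 /\ galois_form F d d v.
Proof.
move=> NW v0 d3; have N1 : (1 < N)%N.
  move: NW => [v1 [a [b [_ frs _]]]].
  by have := dimvS (subvf <<[:: v1; a; b]>>%VS); rewrite (eqP frs) /=; case: N => [|[|]].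
have dE : d = d.-1.+1 by rewrite prednK // (ltn_trans _ d3).
split=> [[[_ nX] gal]|[Fv GF]].
  have Fv : ev F v != 0 by apply/eqP => /(locus_line v0).
  split=> //; rewrite [in X in galois_form _ _ X]dE.
  apply: galois_projection_form => //; first by move: d3; clear; lia.
    by left.
  by move=> e x0 l frame; rewrite (size_frame e (hpoly_homog X) Fv) -dE.
split; first split=> [|/(locus_line v0) /eqP]; first by apply: points_line => //; apply: memvf.
  exact/negP.
apply: (@galois_form_projection v d.-1) => //; rewrite -?dE //.
by move: d3; clear; lia.
Qed.

Lemma smooth_line v : v != 0 -> smooth_locus X <[v]>%VS <->
  ev F v = 0 /\ exists i, ev F^`M(i) v != 0.
Proof.
move=> v0; have [k hk] : exists k, forall i, F^`M(i) \is k.-homog.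
  have := hpoly_homog X; case: d => [|k] h; last by exists k => i; apply: mderiv_homog.
  by exists 0%N => i; rewrite (homog0_const h) mderivC dhomog0.
split=> [[Xv nS]|[Fv [i Fi]]].
  split; first exact/(locus_line v0).
  apply: contrapT => /forallNP h; apply: nS; split=> // i.
  by apply/(vanish_line _ (hk i))/eqP/negPn/negP/h.
split; first exact/(locus_line v0).
by move=> [_ /(_ i) /(vanish_line _ (hk i)) /eqP]; apply/negP.
Qed.

(** The coefficient of degree [d] is [F(v) = 0]. If that of degree [d - 1] also vanished, so would
    the derivatives of [F] at [v] along all vectors of the frame, against smoothness. *)
Lemma inner_size v m (e : 'I_m -> 'I_N -> K) x0 l k : dual_frame (coords v) e x0 l ->
  d = k.+1 -> ev F v = 0 -> (exists i, ev F^`M(i) v != 0) ->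
  size (to_frame (coords v) e F) = d.
Proof.
move=> frame dE Fv [i Fi]; have Fh := hpoly_homog X; rewrite dE in Fh *.
have [sF _] := bihomog_to_frame (coords v) e Fh.
have top := coef_top_to_frame (coords v) e Fh.
have {}sF : (size (to_frame (coords v) e F) <= k.+1)%N.
  apply/leq_sizeP => j; rewrite leq_eqVlt => /orP [/eqP <-|jk].
    by rewrite top Fv mpolyC0.
  exact: (leq_sizeP _ _ sF).
apply/eqP; rewrite eqn_leq sF ltnNge; apply/negP => sk.
have hD w : \sum_j w j *: F^`M(j) \is k.-homog.
  by apply: rpred_sum => j _; apply: dhomogZ; apply: mderiv_homog.
have z w : (\sum_j w j *: F^`M(j)).@[coords v] = 0 -> \sum_j w j * F^`M(j).@[coords v] = 0.
  move=> h; rewrite -[RHS]h (raddf_sum (meval _)).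
  by apply: eq_bigr => j _; rewrite /= mevalZ.
have ev0 p : (p%:MP : {mpoly K[m]}) = 0 -> p = 0 by move/eqP; rewrite mpolyC_eq0 => /eqP.
have zv : \sum_j coords v j * F^`M(j).@[coords v] = 0.
  apply: z; apply: ev0; rewrite -(coef_top_to_frame (coords v) e (hD _)) -deriv_to_frame.
  by rewrite coef_deriv top Fv mpolyC0 mul0rn.
have ze s : \sum_j e s j * F^`M(j).@[coords v] = 0.
  apply: z; apply: ev0; rewrite -(coef_top_to_frame (coords v) e (hD _)) -mderiv_to_frame.
  by rewrite [_`_k]nth_default ?linear0.
case/eqP: Fi; pose x j : K := (j == i)%:R.
transitivity (\sum_j x j * F^`M(j).@[coords v]).
  rewrite (bigD1 i) //= /x eqxx mul1r big1 ?addr0 // => j ji.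
  by rewrite (negbTE ji) mul0r.
under eq_bigr do rewrite (frame_point frame x) mulrDl.
rewrite big_split /= -[RHS]addr0; congr (_ + _).
  under eq_bigr do rewrite -mulrA.
  by rewrite -mulr_sumr zv mulr0.
under eq_bigr do rewrite mulr_suml.
rewrite exchange_big big1 // => s _; under eq_bigr do rewrite -mulrA.
by rewrite -mulr_sumr ze mulr0.
Qed.

Lemma inner_galoisP v : avoiding_plane -> v != 0 -> (3 < d)%N ->
  inner_galois X <[v]>%VS <->
  [/\ ev F v = 0, exists i, ev F^`M(i) v != 0 & galois_form F d d.-1 v].
Proof.
move=> NW v0 d3; have N1 : (1 < N)%N.
  move: NW => [v1 [a [b [_ frs _]]]].
  by have := dimvS (subvf <<[:: v1; a; b]>>%VS); rewrite (eqP frs) /=; case: N => [|[|]].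
have dE : d = d.-2.+2 by move: d3; clear; lia.
have dE1 : d.-1 = d.-2.+1 by rewrite [in LHS]dE.
split=> [[/(smooth_line v0) [Fv sm] gal]|[Fv sm GF]].
  split=> //; rewrite dE1.
  apply: galois_projection_form => //; first by move: d3; clear; lia.
    by right.
  by move=> e x0 l frame; rewrite (inner_size frame dE Fv sm) {1}dE.
split; first exact/(smooth_line v0).
apply: (@galois_form_projection v d.-2) => //; rewrite -?dE1 //.
- by move: d3; clear; lia.
- by move: d3; clear; lia.
Qed.

End GaloisPoints.

(** * Cones *)

Section Pullback.

Variables (K : fieldType) (U V : vectType K) (f : 'Hom(U, V)).

Local Notation KU := {mpoly K[\dim {:U}]}.
Local Notation KV := {mpoly K[\dim {:V}]}.

Definition pull_tuple : (\dim {:V}).-tuple KU :=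
  [tuple \sum_(j < \dim {:U}) coords (f (vbasis {:U})`_j) i *: 'X_j | i < \dim {:V}].

Definition pull (p : KV) : KU := p \mPo pull_tuple.

HB.instance Definition _ := GRing.RMorphism.copy pull (comp_mpoly pull_tuple).

Lemma coords_lfun u i : coords (f u) i =
  \sum_(j < \dim {:U}) coords u j * coords (f (vbasis {:U})`_j) i.
Proof.
rewrite {1}(coord_vbasis (memvf u)) /coords !linear_sum /=.
by apply: eq_bigr => j _; rewrite !linearZ.
Qed.

Lemma pull_tuple_homog i : tnth pull_tuple i \is 1.-homog.
Proof.
by rewrite tnth_mktuple; apply: rpred_sum => j _; apply: dhomogZ; rewrite dhomogX /= mdeg1.
Qed.

Lemma ev_pull_tuple i u : (tnth pull_tuple i).@[coords u] = coords (f u) i.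
Proof.
rewrite tnth_mktuple coords_lfun (raddf_sum (meval _)).
by apply: eq_bigr => j _; rewrite /= mevalZ mevalXU mulrC.
Qed.

Lemma ev_pull p u : (pull p).@[coords u] = p.@[coords (f u)].
Proof.
by rewrite comp_mpoly_meval; apply: meval_eq => i; apply: ev_pull_tuple.
Qed.

Lemma pull_homog p k : p \is k.-homog -> pull p \is k.-homog.
Proof. exact/homog_comp/pull_tuple_homog. Qed.

Lemma dderiv_pull u p : dderiv u (pull p) = pull (dderiv (f u) p).
Proof.
pose g : {rmorphism KV -> KU} := comp_mpoly pull_tuple.
rewrite -[pull p]/(g p) (chain_rule (f := g)).
- rewrite /dderiv [pull _](rmorph_sum g); apply: eq_bigr => i _.
  have gX : g 'X_i = tnth pull_tuple i by rewrite /g /= comp_mpolyXU -tnth_nth.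
  rewrite -[X in _ * X]/(dderiv u (g 'X_i)).
  have -> : dderiv u (g 'X_i) = (coords (f u) i)%:MP.
    by rewrite gX -ev_pull_tuple; apply: dderiv_form; apply: pull_tuple_homog.
  by rewrite /= comp_mpolyZ mulrC mul_mpolyC.
- exact: dderivD.
- exact: dderivM.
- by move=> c; rewrite /g /= comp_mpolyC dderivC.
Qed.

End Pullback.

Section Translations.

Variables (K : fieldType) (V : vectType K).
Hypothesis Kclosed : alg_closed K.
Hypothesis char0 : forall n, n.+1%:R != 0 :> K.

Local Notation KV := {mpoly K[\dim {:V}]}.
Local Notation ev p v := (p : KV).@[coords v].

Lemma mpoly_char0 n k : k.+1%:R != 0 :> {mpoly K[n]}.
Proof. by rewrite -(rmorph_nat (@mpolyC _ K)) mpolyC_eq0. Qed.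

(** In characteristic 0 a zero derivative along [m] leaves no dependence on the coordinate along
    [m]. *)
Lemma dderiv_translation (p : KV) m w : dderiv m p = 0 -> ev p (w + m) = ev p w.
Proof.
move=> dp; have [->|m0] := eqVneq m 0; first by rewrite addr0.
have [i0 mi0] := coords_neq0 m0; have [e [x0 [l frame]]] := exists_frame mi0.
have [_ hl _ [lm _] _] := frame.
have pE : to_frame (coords m) e p = ((to_frame (coords m) e p)`_0)%:P.
  apply/polyP => -[|i]; rewrite coefC //=.
  transitivity ((0 : {poly {mpoly K[(\dim {:V}).-1]}})`_i.+1); last exact: coef0.
  apply: deriv_const; first exact: mpoly_char0.
  rewrite deriv_to_frame deriv0 -[X in to_frame _ _ X]/(dderiv m p) dp.
  by pose g : {rmorphism _ -> _} := to_frame (coords m) e; apply: (rmorph0 g).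
rewrite -(to_frameK frame p) pE of_frameC !comp_mpoly_meval.
by apply: meval_eq => j; rewrite (ev_homog1D _ _ (hl j)) lm addr0.
Qed.

Lemma dderiv_line (p : KV) m w : m != 0 -> (forall s, ev p (w + s *: m) = 0) ->
  ev (dderiv m p) w = 0.
Proof.
move=> m0 pw; have [i0 mi0] := coords_neq0 m0; have [e [x0 [l frame]]] := exists_frame mi0.
pose y j := (tnth l j).@[coords w].
pose P : {poly K} := map_poly (meval y) (to_frame (coords m) e p).
have PE q s : (map_poly (meval y) (to_frame (coords m) e q)).[s] = ev q (w + (s - ev x0 w) *: m).
  rewrite meval_to_frame; apply: meval_eq => i.
  by rewrite coordsD coordsZ (frame_point frame (coords w) i) -/y; ring.
have P0 : P = 0.
  by apply: (poly_eq0_eval Kclosed) => s; rewrite PE pw.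
have := PE (dderiv m p) (ev x0 w); rewrite subrr scale0r addr0 => <-.
by rewrite /dderiv -deriv_to_frame -deriv_map -/P P0 deriv0 horner0.
Qed.

Lemma jacobian_zeros (F : KV) x :
  (forall f, jacobian F f -> ev f x = 0) <->
  ev F x = 0 /\ forall w : V, ev (dderiv w F) x = 0.
Proof.
split=> [J|[Fx Dx] f [a [a0 ->]]].
  split=> [|w]; apply: J.
    by exists (fun=> 0), 1; rewrite mul1r big1 ?add0r // => i _; rewrite mul0r.
  exists (fun i => (coords w i)%:MP), 0; rewrite mul0r addr0.
  by apply: eq_bigr => i _; rewrite mul_mpolyC.
rewrite mevalD mevalM Fx mulr0 addr0 (raddf_sum (meval _)) big1 // => i _ /=.
have [w wE] := coords_surj (fun j => (j == i)%:R : K).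
rewrite mevalM; have := Dx w; rewrite /dderiv (bigD1 i) //= big1 => [|j ji].
  by rewrite addr0 wE eqxx scale1r => ->; rewrite mulr0.
by rewrite wE (negbTE ji) scale0r.
Qed.

Lemma smooth_dderiv (F : KV) x :
  (exists i, ev F^`M(i) x != 0) <-> exists w : V, ev (dderiv w F) x != 0.
Proof.
split=> [[i Fi]|[w]].
  have [w wE] := coords_surj (fun j => (j == i)%:R : K); exists w.
  rewrite /dderiv (bigD1 i) //= big1 => [|j ji].
    by rewrite addr0 wE eqxx scale1r.
  by rewrite wE (negbTE ji) scale0r.
move=> /negP Fw; apply: contrapT => /forallNP h; apply: Fw.
rewrite /dderiv (raddf_sum (meval _)) big1 // => i _ /=.
by have /negP/negPn/eqP Fi := h i; rewrite mevalZ Fi mulr0.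
Qed.

End Translations.

(** * The Nullstellensatz for a hypersurface *)

Section Nullstellensatz.

Variables (K : fieldType) (V : vectType K) (X : hypersurface V).
Hypothesis Kclosed : alg_closed K.

Local Notation KV := {mpoly K[\dim {:V}]}.
Local Notation ev p v := (p : KV).@[coords v].
Local Notation F := (hpoly X).

Lemma hypersurface_degree : (0 < degree X)%N.
Proof.
rewrite lt0n; apply/eqP => d0; have := hpoly_homog X; rewrite d0 => /homog0_const FE.
have := hpoly_nunit X; have := hpoly_neq0 X; rewrite FE mpolyC_eq0 => c0 /negP; apply.
by apply: rmorph_unit; rewrite unitfE.
Qed.

Lemma exists_off_locus : exists v : V, ev F v != 0.
Proof.
apply: contrapT => /forallNP h; have /eqP := hpoly_neq0 X; apply.
apply: (meval_eq0 Kclosed) => x; have [v vx] := coords_surj x.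
by rewrite -(meval_eq _ vx); apply/eqP/negPn/negP.
Qed.

(** Otherwise some multiple of [h] is, modulo [F], a nonzero base polynomial [D]. Every base point
    lifts to a zero of [F], where [h] vanishes, so [D] would vanish everywhere. *)
Lemma vanish_on_locus (h : KV) : (forall x : V, ev F x = 0 -> ev h x = 0) ->
  exists q, h = q * F.
Proof.
move=> hF; have [phi [_ phi0 _]] := exists_class X.
have [v Fv] := exists_off_locus.
have [ph|ph] := eqVneq (phi h) 0; first exact: (class_ker phi0).
exfalso; have Fh := hpoly_homog X.
have v0 : v != 0.
  apply: contraNneq Fv => ->; rewrite (homog_meval0 hypersurface_degree Fh) // => i.
  exact: coords0.
have [i0 vi0] := coords_neq0 v0; have [e [x0 [l frame]]] := exists_frame vi0.
pose theta : {rmorphism {poly {mpoly K[(\dim {:V}).-1]}} -> fraction_field X} :=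
  phi \o of_frame x0 l.
have thE p : theta (to_frame (coords v) e p) = phi p by rewrite /theta /= (to_frameK frame).
have thh : theta (to_frame (coords v) e h) != 0 by rewrite thE.
have Fm := frame_monicP e Fh Fv.
have th0 : theta (frame_monic F (coords v) e) = 0 := frame_monic0 (class_hpoly phi0) frame.
have [D D0 [c cE]] := norm_elt Fm th0 thh.
case/eqP: D0; apply: (meval_eq0 Kclosed) => y.
have [q qE] : exists q, of_frame x0 l D%:P - h * of_frame x0 l c = q * F.
  apply: (class_ker phi0); rewrite rmorphB rmorphM.
  by move: cE; rewrite thE /theta /= => ->; rewrite subrr.
have [s Fs] := fiber_point Kclosed e y Fh hypersurface_degree Fv.
have [x xE] := coords_surj (fun i => s * coords v i + \sum_j y j * e j i).
have evE p : (map_poly (meval y) (to_frame (coords v) e p)).[s] = ev p x.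
  by rewrite meval_to_frame; apply/esym/meval_eq.
have Fx : ev F x = 0 by rewrite -evE meval_to_frame.
have -> : D.@[y] = ev (of_frame x0 l D%:P) x.
  by rewrite -evE (of_frameK frame) map_polyC hornerC.
have := congr1 (meval (coords x)) qE.
by rewrite mevalB !mevalM Fx (hF x Fx) mul0r mulr0 subr0.
Qed.

End Nullstellensatz.

(** * A cone and its base *)

Section ConeBase.

Variables (K : fieldType) (V W : vectType K) (iota : 'Hom(W, V)) (pi : 'Hom(V, W)).
Variable M2 : {vspace V}.
Hypothesis Kclosed : alg_closed K.
Hypothesis char0 : forall n, n.+1%:R != 0 :> K.
Hypothesis piK : forall w, pi (iota w) = w.
Hypothesis piM2 : forall v, v - iota (pi v) \in M2.
Hypothesis pi0 : forall m, m \in M2 -> pi m = 0.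

Local Notation KV := {mpoly K[\dim {:V}]}.
Local Notation KW := {mpoly K[\dim {:W}]}.
Local Notation ev p v := (p : KV).@[coords v].
Local Notation evW p v := (p : KW).@[coords v].

Lemma pull_iotaK : cancel (pull pi) (pull iota).
Proof. by move=> p; apply: (form_ext Kclosed) => w; rewrite !ev_pull piK. Qed.

Lemma pull_piK (p : KV) : (forall m, m \in M2 -> dderiv m p = 0) ->
  pull pi (pull iota p) = p.
Proof.
move=> pM; apply: (form_ext Kclosed) => v; rewrite !ev_pull.
rewrite -[v in RHS](subrK (iota (pi v))) addrC.
by rewrite (dderiv_translation char0) // pM.
Qed.

Lemma pi_eq0 v : (pi v == 0) = (v \in M2).
Proof.
apply/eqP/idP => [pv|/pi0 //]; have := piM2 v.
by rewrite pv linear0 subr0.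
Qed.

Variable F : KV.
Hypothesis FM2 : forall m, m \in M2 -> dderiv m F = 0.

Local Notation G := (pull iota F).

Let FE : F = pull pi G. Proof. by rewrite pull_piK. Qed.

Lemma ev_base v : ev F v = evW G (pi v).
Proof. by rewrite [in LHS]FE ev_pull. Qed.

Lemma dderiv_base v : dderiv v F = pull pi (dderiv (pi v) G).
Proof. by rewrite [in LHS]FE dderiv_pull. Qed.

Lemma dderiv_iota w : dderiv w G = pull iota (dderiv (iota w) F).
Proof. exact: dderiv_pull. Qed.

Lemma ev_dderiv_base v x : ev (dderiv v F) x = evW (dderiv (pi v) G) (pi x).
Proof. by rewrite dderiv_base ev_pull. Qed.

Lemma noncone_base : (forall m, dderiv m F = 0 -> m \in M2) ->
  forall w, dderiv w G = 0 -> w = 0.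
Proof.
move=> maxM w; have := dderiv_base (iota w); rewrite piK => + dw; rewrite dw.
rewrite [X in _ = X](rmorph0 (pull pi : {rmorphism _ -> _})) => /maxM.
by rewrite -pi_eq0 piK => /eqP.
Qed.

Lemma smooth_base x : (exists i, ev F^`M(i) x != 0) <-> (exists i, evW G^`M(i) (pi x) != 0).
Proof.
rewrite !smooth_dderiv; split=> [[v]|[w]].
  by rewrite ev_dderiv_base => h; exists (pi v).
by rewrite -[w]piK -ev_dderiv_base => h; exists (iota w).
Qed.

(** Descent requires [M] and [L] to be invariant along [M2]. For [m] in [M2], [D_m D_x F = 0] gives
    [L D_m M + (e-1) L(m) M = 0]; applying [D_x], which kills [M], gives [D_m M = 0], and then
    [L(m) = 0]. *)
Lemma galois_form_base d e x : (1 < e)%N ->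
  galois_form F d e x <-> galois_form G d e (pi x).
Proof.
move=> e1; split=> [[M [L [D [hL Lx] hM DM Mn]]]|[M [L [D [hL Lx] hM DM Mn]]]]; last first.
  exists (pull pi M), (pull pi L); split.
  - by rewrite dderiv_base D rmorphM rmorphXn.
  - by split; [apply: pull_homog|rewrite ev_pull].
  - exact: pull_homog.
  - by rewrite dderiv_pull DM (rmorph0 (pull pi : {rmorphism _ -> _})).
  - apply: contraNneq Mn => M0; rewrite -[M]pull_iotaK M0.
    by rewrite (rmorph0 (pull iota : {rmorphism _ -> _})).
have Ln : L != 0 by apply: contraNneq Lx => ->; rewrite meval0.
have DML m : m \in M2 -> dderiv m M = 0 /\ ev L m = 0.
  move=> mM; have h1 : L * dderiv m M + (e.-1%:R * ev L m)%:MP * M = 0.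
    have := dderiv_comm m x F; rewrite (FM2 mM) D.
    rewrite {2}/dderiv; under [RHS]eq_bigr do rewrite mderiv0 scaler0.
    rewrite big1 // dderivM dderivXn (dderiv_form m hL).
    case: (e) e1 => [|[|k]] // _ /= h.
    apply: (mulfI (expf_neq0 k Ln)); rewrite mulr0 -[RHS]h mpolyCM.
    by rewrite -mul_mpolyC exprS; ring.
  have h2 : ev L x *: dderiv m M = 0.
    have := congr1 (dderiv x) h1; rewrite dderivD !dderivM dderivC mul0r add0r DM mulr0 addr0.
    rewrite dderiv_comm DM -mpolyC0 dderivC mulr0 addr0 dderivC (dderiv_form x hL).
    by rewrite mul_mpolyC.
  have DmM : dderiv m M = 0.
    by move/eqP: h2; rewrite scaler_eq0 (negbTE Lx) => /eqP.
  split=> //; move/eqP: h1; rewrite DmM mulr0 add0r mulf_eq0 (negbTE Mn) orbF mpolyC_eq0.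
  by case: (e) e1 => [|[|k]] // _; rewrite mulf_eq0 (negbTE (char0 _)) => /eqP.
have Lpi v : evW (pull iota L) (pi v) = ev L v.
  rewrite ev_pull -[v in RHS](subrK (iota (pi v))) ev_homog1D //.
  by case: (DML _ (piM2 v)) => _ ->; rewrite add0r.
exists (pull iota M), (pull iota L); split.
- rewrite dderiv_iota -rmorphXn -rmorphM -D; congr (pull iota _).
  rewrite -[x in RHS](subrK (iota (pi x))) dderivDl.
  by rewrite (FM2 (piM2 x)) add0r.
- by split; [apply: pull_homog|rewrite Lpi].
- exact: pull_homog.
- rewrite dderiv_pull -[RHS](rmorph0 (pull iota : {rmorphism _ -> _})); congr (pull iota _).
  rewrite -DM -[x in RHS](subrK (iota (pi x))) dderivDl.
  by case: (DML _ (piM2 x)) => -> _; rewrite add0r.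
- apply: contraNneq Mn => M0; rewrite -[M]pull_piK => [|m /DML [] //].
  by rewrite M0 (rmorph0 (pull pi : {rmorphism _ -> _})).
Qed.

(** The projection is injective on the plane: in degree at least 2, a nonzero vector of [M2] is a
    zero of the Jacobian ideal, and the plane contains none. *)
Lemma avoiding_base d v0 a b : F \is d.-homog -> (1 < d)%N ->
  ev F v0 != 0 -> free [:: v0; a; b] -> no_zero [:: v0; a; b] (jacobian F) ->
  exists w0 c e, [/\ evW G w0 != 0, free [:: w0; c; e] &
    no_zero [:: w0; c; e] (jacobian G)].
Proof.
move=> Fh d1 Fv0 frs NW; exists (pi v0), (pi a), (pi b).
have nz x : x \in <<[:: v0; a; b]>>%VS -> x != 0 ->
    ~ (evW G (pi x) = 0 /\ forall w, evW (dderiv w G) (pi x) = 0).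
  move=> xs x0 [Gx DGx]; have [f Jf] := NW x xs x0; apply/negP/negPn/eqP.
  move: f Jf; apply/(jacobian_zeros F x); split=> [|w]; first by rewrite ev_base.
  by rewrite ev_dderiv_base.
have d0 : (0 < d)%N by apply: ltnW.
have z0 k (p : KW) : (0 < k)%N -> p \is k.-homog -> evW p 0 = 0.
  by move=> k0 hp; apply: (homog_meval0 k0 hp) => i; apply: coords0.
have piinj x : x \in <<[:: v0; a; b]>>%VS -> pi x = 0 -> x = 0.
  move=> xs px; apply/eqP; apply: contrapT => /negP /(nz x xs); apply.
  rewrite px; split=> [|w]; first exact: (z0 d G d0 (pull_homog iota Fh)).
  apply: (z0 d.-1); first by case: (d) d1 => [|[]].
  by apply: dderiv_homog; rewrite prednK //; apply: pull_homog.
have imE : [:: pi v0; pi a; pi b] = map pi [:: v0; a; b] by [].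
split; first by rewrite -ev_base.
  rewrite /free imE -limg_span limg_dim_eq ?size_map //.
  apply/eqP; rewrite -subv0; apply/subvP => x; rewrite memv_cap memv_ker memv0.
  by move=> /andP [xs /eqP /(piinj _ xs) ->].
rewrite /no_zero imE -limg_span => y /memv_imgP [x xs ->] px.
have x0 : x != 0 by apply: contraNneq px => ->; rewrite linear0.
apply: contrapT => h; apply: (nz x xs x0); apply/jacobian_zeros => f Jf.
by apply/eqP; apply: contrapT => /negP fx; apply: h; exists f.
Qed.

End ConeBase.

Lemma galois_points_finite (K : fieldType) (V : vectType K) (X : hypersurface V) :
  alg_closed K -> (forall n, n.+1%:R != 0 :> K) -> avoiding_plane X ->
  (forall v, dderiv v (hpoly X) = 0 -> v = 0) -> (4 <= degree X)%N ->
  finite_set (inner_galois X `|` outer_galois X).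
Proof.
move=> Kclosed char0 NW noncone d4; rewrite finite_setU; split.
  have Z := finite_galois_forms Kclosed char0 noncone d4 (or_intror erefl).
  apply: (sub_finite_set _ Z).
  move=> P iP; have [y [y0 _ PE]] := pointsP (proj1 (proj1 (proj1 iP))).
  exists y; split=> //; rewrite PE in iP.
  by case/(inner_galoisP Kclosed char0 NW y0 d4): iP.
have Z := finite_galois_forms Kclosed char0 noncone d4 (or_introl erefl).
apply: (sub_finite_set _ Z).
move=> P oP; have [y [y0 _ PE]] := pointsP (proj1 (proj1 oP)).
exists y; split=> //; rewrite PE in oP.
by case/(outer_galoisP Kclosed char0 NW y0 d4): oP.
Qed.

Section BaseHypersurface.

Variables (K : fieldType) (V : vectType K) (X : hypersurface V).
Hypothesis Kclosed : alg_closed K.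
Hypothesis char0 : forall n, n.+1%:R != 0 :> K.
Hypothesis d3 : (3 < degree X)%N.
Hypothesis NW : avoiding_plane X.
Variable M2 : {vspace V}.
Hypothesis M2P : forall m, m \in M2 <-> dderiv m (hpoly X) = 0.

Local Notation F := (hpoly X).
Local Notation d := (degree X).
Local Notation M1 := (M2^C)%VS.
Local Notation W := (subvs_of M1).
Local Notation iota := (linfun (@vsval K V M1)).

Let pi : 'Hom(V, W) := (linfun (@vsproj K V M1) \o daddv_pi M1 M2)%VF.

Let iotaE w : iota w = vsval w. Proof. by rewrite lfunE. Qed.

Let disj : (M1 :&: M2 = 0)%VS. Proof. by rewrite capvC capv_compl. Qed.

Let iota_pi v : iota (pi v) = daddv_pi M1 M2 v.
Proof. by rewrite iotaE lfunE /= lfunE /= vsprojK // memv_pi. Qed.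

Let piK w : pi (iota w) = w.
Proof.
apply: val_inj; rewrite -[val _]iotaE iota_pi iotaE; apply: daddv_pi_id; first exact: disj.
exact: subvsP.
Qed.

Let piM2 v : v - iota (pi v) \in M2.
Proof.
have vE : daddv_pi M1 M2 v + daddv_pi M2 M1 v = v.
  by apply: daddv_pi_add; rewrite ?disj // addvC addv_complf memvf.
by rewrite iota_pi -[X in X - _]vE addrC addKr memv_pi.
Qed.

Let pi0 m : m \in M2 -> pi m = 0.
Proof.
move=> mM; apply: val_inj; rewrite -[val _]iotaE iota_pi linear0.
have := daddv_pi_add disj (w := m); rewrite addvC addv_complf memvf => /(_ isT).
have -> : daddv_pi M2 M1 m = m by apply: daddv_pi_id; rewrite // capvC disj.
by move=> h; apply: (addIr m); rewrite h add0r.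
Qed.

Let FM2 m : m \in M2 -> dderiv m F = 0. Proof. by move/M2P. Qed.

Let pi_eq0 v : (pi v == 0) = (v \in M2). Proof. exact: pi_eq0 piM2 pi0 v. Qed.

(** The two pullbacks exchange divisibility by [F] and by its restriction, so primality descends. *)
Lemma exists_base : exists Y : hypersurface W,
  hpoly Y = pull iota F /\ degree Y = degree X.
Proof.
have iotaK := pull_iotaK Kclosed piK.
have FE : pull pi (pull iota F) = F by apply: (pull_piK Kclosed char0 piM2).
have Gn0 : pull iota F != 0.
  apply: contraNneq (hpoly_neq0 X) => G0; rewrite -FE G0.
  by rewrite (rmorph0 (pull pi : {rmorphism _ -> _})).
have Gu : pull iota F \isn't a GRing.unit.
  apply: contraNN (hpoly_nunit X) => Gu; rewrite -FE.
  exact: (rmorph_unit (pull pi : {rmorphism _ -> _})).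
have Gp : prime_idealr_closed (pideal (pull iota F)).
  move=> u v /asboolP [q qE]; have := @hpoly_prime _ _ X (pull pi u) (pull pi v).
  have -> : pull pi u * pull pi v \in pideal F.
    apply/asboolP; exists (pull pi q).
    by rewrite -[pull pi u * _](rmorphM (pull pi)) qE (rmorphM (pull pi)) /= FE.
  move=> /(_ isT) /orP [] /asboolP [r rE]; apply/orP; [left|right]; apply/asboolP;
    exists (pull iota r).
    by rewrite -[u]iotaK rE rmorphM.
  by rewrite -[v]iotaK rE rmorphM.
by exists (Hypersurface (pull_homog iota (hpoly_homog X)) Gn0 Gu Gp).
Qed.

Variable Y : hypersurface W.
Hypotheses (YF : hpoly Y = pull iota F) (Yd : degree Y = degree X).

Local Notation ev p v := (p : {mpoly K[\dim {:V}]}).@[coords v].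
Local Notation evW p v := (p : {mpoly K[\dim {:W}]}).@[coords v].

Let d0 : (0 < d)%N. Proof. exact: leq_ltn_trans d3. Qed.

Let evY v : ev F v = evW (hpoly Y) (pi v).
Proof. by rewrite YF; apply: (ev_base Kclosed char0 piM2 FM2). Qed.

Lemma base_plane : avoiding_plane Y.
Proof.
have [v0 [a [b [Fv0 frs nz]]]] := NW; rewrite /avoiding_plane YF.
have d1 : (1 < d)%N by apply: leq_ltn_trans d3.
exact: (avoiding_base Kclosed char0 piM2 FM2 (hpoly_homog X) d1 Fv0 frs nz).
Qed.

Lemma locus_base x : pi x != 0 -> locus X <[x]>%VS <-> locus Y <[pi x]>%VS.
Proof.
move=> px; have x0 : x != 0 by apply: contraNneq px => ->; rewrite linear0.
by rewrite !locus_line // evY.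
Qed.

Lemma outer_base x : pi x != 0 -> outer_galois X <[x]>%VS <-> outer_galois Y <[pi x]>%VS.
Proof.
move=> px; have x0 : x != 0 by apply: contraNneq px => ->; rewrite linear0.
have e1 : (1 < d)%N by apply: leq_ltn_trans d3.
have h := galois_form_base Kclosed char0 piK piM2 FM2 d x e1.
rewrite (outer_galoisP Kclosed char0 NW x0 d3).
rewrite (outer_galoisP Kclosed char0 base_plane px) ?Yd // evY YF.
by split=> -[-> /h].
Qed.

Lemma inner_base x : pi x != 0 -> inner_galois X <[x]>%VS <-> inner_galois Y <[pi x]>%VS.
Proof.
move=> px; have x0 : x != 0 by apply: contraNneq px => ->; rewrite linear0.
have e1 : (1 < d.-1)%N by move: d3; clear; lia.
have h := galois_form_base Kclosed char0 piK piM2 FM2 d x e1.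
have h' := smooth_base Kclosed char0 piK piM2 FM2 x.
rewrite (inner_galoisP Kclosed char0 NW x0 d3).
rewrite (inner_galoisP Kclosed char0 base_plane px) ?Yd // evY YF.
by split=> -[-> /h' ? /h].
Qed.

Let F_M2 x : x \in M2 -> ev F x = 0.
Proof.
move=> xM; rewrite evY pi0 // (homog_meval0 _ (hpoly_homog Y)) ?Yd // => i.
exact: coords0.
Qed.

(** Common to inner and outer points: off [M2], a point lies in the join exactly when its projection
    lies in [B]. *)
Lemma base_outside_M2 (A : set {vspace V}) (B : set {vspace W}) :
  A `<=` points fullv -> B `<=` points fullv ->
  (forall x, x \in M2 -> ~ A <[x]>%VS) ->
  (forall x, pi x != 0 -> A <[x]>%VS <-> B <[pi x]>%VS) ->
  A = linear_join (in_ambient B) M2 `\` points M2.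
Proof.
move=> Ap Bp AM AB; apply/seteqP; split=> [P AP|Q [[P [P' BP' <-]] PQ] nQ].
  have [x [x0 _ PE]] := pointsP (Ap P AP); rewrite PE in AP *.
  have px : pi x != 0 by rewrite pi_eq0; apply/negP => /AM.
  split; last by move=> [_]; rewrite -memvE -pi_eq0 (negbTE px).
  exists (iota @: <[pi x]>)%VS; first by exists <[pi x]>%VS => //; apply/AB.
  have xE : x = iota (pi x) + (x - iota (pi x)) by rewrite addrC subrK.
  apply: points_line => //; rewrite {1}xE.
  by apply: memv_add => //; apply: memv_img; apply: memv_line.
have [x [x0 xPM QE]] := pointsP PQ; rewrite QE in nQ *.
have px : pi x != 0.
  by rewrite pi_eq0; apply/negP => xM; apply: nQ; apply: points_line.
apply/AB => //; move: xPM => /memv_addP [_ /memv_imgP [w wP ->] [m mM xE]].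
have [w' [w'0 _ P'E]] := pointsP (Bp P' BP').
have pxE : pi x = w by rewrite xE linearD /= piK (pi0 mM) addr0.
move: wP; rewrite pxE in px *; rewrite P'E => /vlineP [c cE].
suff -> : <[w]>%VS = P' by [].
have c0 : c != 0 by apply: contraNneq px => c0; rewrite cE c0 scale0r.
apply/eqP; rewrite P'E eqEsubv -!memvE cE rpredZ ?memv_line //=.
by rewrite -[w' in w' \in _](scalerK c0) rpredZ // memv_line.
Qed.

Lemma inner_join :
  inner_galois X = linear_join (in_ambient (inner_galois Y)) M2 `\` points M2.
Proof.
apply: base_outside_M2 => [P [[[]] //]|P [[[]] //]|x xM|]; last exact: inner_base.
have [->|x0] := eqVneq x 0.
  by move=> [[[[]]]]; rewrite dim_vline eqxx.
move=> /(inner_galoisP Kclosed char0 NW x0 d3) [_ _ [M [L [D [_ Lx] _ _ Mn]]]].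
have Ln : L != 0 by apply: contraNneq Lx => ->; rewrite meval0.
(* On [M2] the derivative of [F] is 0, while a product of nonzero forms is not. *)
by move/eqP: D; rewrite (FM2 xM) eq_sym mulf_eq0 (negbTE Mn) expf_eq0 (negbTE Ln) andbF.
Qed.

Lemma outer_join :
  outer_galois X = linear_join (in_ambient (outer_galois Y)) M2 `\` points M2.
Proof.
apply: base_outside_M2 => [P [[]] //|P [[]] //|x xM|]; last exact: outer_base.
have [->|x0] := eqVneq x 0.
  by move=> [[[]]]; rewrite dim_vline eqxx.
by move=> /(outer_galoisP Kclosed char0 NW x0 d3) [/eqP []]; apply: F_M2.
Qed.

(** Over an empty [Y] the join would be empty and lose the points of [M2]. The line through [a] with
    direction [w] meets [Y], because [w] is off [Y]. *)
Lemma locus_base_nonempty : locus Y !=set0.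
Proof.
have [w [a [b [Gw frs _]]]] := base_plane.
have Yh := hpoly_homog Y; have d0' : (0 < degree Y)%N by rewrite Yd.
have w0 : w != 0.
  apply: contraNneq Gw => ->; rewrite (homog_meval0 d0' Yh) // => i; exact: coords0.
have [i0 wi0] := coords_neq0 w0; have [e [x0 [l frame]]] := exists_frame wi0.
pose y j := (tnth l j).@[coords a].
have [s Ys] := fiber_point Kclosed e y Yh d0' Gw.
pose z := a + (s - x0.@[coords a]) *: w.
have aw : a \notin <<[:: w; b]>>%VS.
  suff : free [:: a; w; b] by rewrite free_cons => /andP[].
  by rewrite (perm_free (Y := [:: w; a; b])) // (perm_catCA [:: a] [:: w] [:: b]).
have z0 : z != 0.
  apply: contraNneq aw => /eqP; rewrite addr_eq0 => /eqP ->.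
  by rewrite rpredN rpredZ // memv_span // mem_head.
exists <[z]>%VS; apply/locus_line => //; rewrite -[RHS]Ys; apply: meval_eq => i.
by rewrite coordsD coordsZ (frame_point frame (coords a) i) -/y; ring.
Qed.

Lemma locus_join : locus X = linear_join (in_ambient (locus Y)) M2.
Proof.
have [R0 YR0] := locus_base_nonempty.
apply/seteqP; split=> [P XP|Q [_ [P' YP' <-] PQ]].
  have [x [x0 _ PE]] := pointsP (proj1 XP); rewrite PE in XP *.
  have xE : x = iota (pi x) + (x - iota (pi x)) by rewrite addrC subrK.
  have [px|px] := eqVneq (pi x) 0.
    exists (iota @: R0)%VS; first by exists R0.
    apply: points_line => //; rewrite (subvP (addvSr _ _)) //.
    by rewrite -pi_eq0 px.
  exists (iota @: <[pi x]>)%VS; first by exists <[pi x]>%VS => //; apply/locus_base.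
  apply: points_line => //; rewrite {1}xE.
  by apply: memv_add => //; apply: memv_img; apply: memv_line.
have [x [x0 xPM ->]] := pointsP PQ; apply/locus_line => //.
move: xPM => /memv_addP [_ /memv_imgP [w wP ->] [m mM xE]].
have pxE : pi x = w by rewrite xE linearD /= piK (pi0 mM) addr0.
rewrite evY pxE; exact: (proj2 YP').
Qed.

Lemma base_noncone w : dderiv w (hpoly Y) = 0 -> w = 0.
Proof.
rewrite YF; apply: (noncone_base Kclosed char0 piK piM2 pi0 FM2) => m.
by move/M2P.
Qed.

End BaseHypersurface.

(** * Vertices of a cone *)

Section Vertices.

Variables (K : fieldType) (V : vectType K) (X : hypersurface V).
Hypothesis Kclosed : alg_closed K.
Hypothesis char0 : forall n, n.+1%:R != 0 :> K.

Local Notation F := (hpoly X).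
Local Notation ev p v := (p : {mpoly K[\dim {:V}]}).@[coords v].

Variable M2 : {vspace V}.
Hypothesis M2P : forall m, m \in M2 <-> dderiv m (hpoly X) = 0.

Lemma base_vertex : M2 != 0%VS -> is_vertex (locus X) M2.
Proof.
move=> /eqP M20; have Fh := hpoly_homog X.
have F0 : ev F 0 = 0.
  by rewrite (homog_meval0 (hypersurface_degree X) Fh) // => i; apply: coords0.
split=> // [P /pointsP [m [m0 /M2P mM ->]]|P Q /pointsP [m [m0 /M2P mM ->]] XQ _ R PQR].
  by apply/(locus_line _ m0); rewrite -[m]add0r (dderiv_translation char0 0 mM).
have [x [x0 _ QE]] := pointsP (proj1 XQ); rewrite QE in XQ PQR.
have [y [y0 yPQ ->]] := pointsP PQR; apply/(locus_line _ y0).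
move: yPQ => /memv_addP [_ /vlineP [s ->] [_ /vlineP [t ->] ->]].
have mM' : dderiv (s *: m) F = 0 by rewrite dderivZl mM scaler0.
rewrite addrC (dderiv_translation char0 _ mM') (ev_homogZ _ _ Fh).
by move/(locus_line _ x0): XQ => ->; rewrite mulr0.
Qed.

(** Lines from a point [m] of a vertex to points of [X] stay in [X], so [D_m F] vanishes on [X] and
    is a multiple of [F]; its degree being smaller, it is 0. Thus [M2] contains every vertex. *)
Lemma base_vertex_maximal M : is_vertex (locus X) M -> (\dim M <= \dim M2)%N.
Proof.
move=> [_ MX cone]; apply: dimvS; apply/subvP => m mM.
have [->|m0] := eqVneq m 0; first exact: mem0v.
have Fh := hpoly_homog X; have Xm : locus X <[m]>%VS by apply/MX/points_line.
have Fm : ev F m = 0 by apply/locus_line.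
apply/M2P; have [q qE] : exists q, dderiv m F = q * F.
  apply: (vanish_on_locus Kclosed) => x Fx; apply: (dderiv_line Kclosed m0) => s.
  have [xm|xm] := boolP (x \in <[m]>%VS).
    have /vlineP [c ->] := xm.
    by rewrite -scalerDl (ev_homogZ _ _ Fh) Fm mulr0.
  have x0 : x != 0 by apply: contraNneq xm => ->; apply: mem0v.
  have Xx : locus X <[x]>%VS by apply/locus_line.
  have neq : <[x]>%VS <> <[m]>%VS by move=> E; rewrite -E memv_line in xm.
  have y0 : x + s *: m != 0.
    apply: contraNneq xm => /eqP; rewrite addr_eq0 => /eqP ->.
    by rewrite rpredN rpredZ // memv_line.
  apply/(locus_line X y0); apply: (cone _ _ (points_line m0 mM) Xx neq).
  apply: points_line => //; rewrite addrC; apply: memv_add; last exact: memv_line.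
  by rewrite rpredZ // memv_line.
have [k dk] : exists k, degree X = k.+1.
  by exists (degree X).-1; rewrite prednK // hypersurface_degree.
have hD : dderiv m F \is k.-homog by apply: dderiv_homog; rewrite -dk.
have [r rE] := pihomog_multiple k q Fh.
have [q0|q0] := eqVneq q 0; first by rewrite qE q0 mul0r.
rewrite -[LHS](pihomog_dE hD) qE mulrC -coef_grade rmorphM /= (grade_homog Fh) -mulrA coefCM.
by rewrite coefXnM dk ltnSn mulr0.
Qed.

End Vertices.

Lemma sing_zeros (K : fieldType) (V : vectType K) (X : hypersurface V) :
  sing X = zeros (jacobian (hpoly X)).
Proof.
apply/seteqP; split=> P.
  move=> [[PV FP] DP]; split=> // f [a [a0 ->]] v vP.
  rewrite mevalD mevalM (FP v vP) mulr0 addr0 (raddf_sum (meval _)) big1 // => i _ /=.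
  by rewrite mevalM (DP i v vP) mulr0.
move=> [PV JP]; split=> [|i].
  split=> //; apply: JP; exists (fun=> 0), 1; rewrite mul1r big1 ?add0r // => i _.
  by rewrite mul0r.
apply: JP; exists (fun j => (j == i)%:R), 0; rewrite mul0r addr0 (bigD1 i) //= eqxx mul1r.
by rewrite big1 ?addr0 // => j ji; rewrite (negbTE ji) mul0r.
Qed.

(** For a space of dimension [n + 2] and the bound [n - 2], [exists_avoiding] gives at least two
    vectors besides [v0]; the first two are kept. *)
Lemma exists_avoiding_plane (K : fieldType) (V : vectType K) (X : hypersurface V) n :
  alg_closed K -> (\dim {:V} = n.+2)%N -> zdim_le (sing X) (n%:Z - 2) -> avoiding_plane X.
Proof.
move=> Kclosed dimV; rewrite sing_zeros => zd.
have Jh := jacobian_homog_ideal (hpoly_homog X).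
have [v0 Fv0] := exists_off_locus X Kclosed.
have JF : jacobian (hpoly X) (hpoly X).
  by exists (fun=> 0), 1; rewrite mul1r big1 ?add0r // => i _; rewrite mul0r.
have v00 : v0 != 0.
  apply: contraNneq Fv0 => ->; rewrite (homog_meval0 (hypersurface_degree X) (hpoly_homog X)) //.
  exact: coords0.
have [|b [frb nz]] := exists_avoiding Kclosed Jh _ v00 zd; first by exists (hpoly X).
case: b frb nz => [|a [|b s]] frb nz; rewrite dimV /=; try lia.
move=> _; have sub : (<<[:: v0; a; b]>> <= <<[:: v0, a, b & s]>>)%VS.
  by apply: sub_span => x; rewrite !inE => /or3P [] ->; rewrite ?orbT.
exists v0, a, b; split=> //.
  by apply: (@catl_free _ _ s [:: v0; a; b]).
by move=> x xs; apply: nz; apply: (subvP sub).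
Qed.

Theorem theorem3 (K : closedFieldType) (charK : [pchar K] =i pred0)
    (n : nat) (n_ge1 : (1 <= n)%N)
    (V : vectType K) (dimV : \dim {:V} = n.+2)
    (X : hypersurface V) (degX : (4 <= degree X)%N)
    (singX : zdim_le (sing X) (n%:Z - 2))
    (infX : infinite_set (inner_galois X `|` outer_galois X)) :
  is_cone (locus X) /\
  exists (M1 M2 : {vspace V}) (Y : hypersurface (subvs_of M1)),
    (M1 :&: M2)%VS = 0%VS /\
    [/\ locus X = linear_join (in_ambient (locus Y)) M2,
        is_vertex (locus X) M2 /\
          (forall M, is_vertex (locus X) M -> (\dim M <= \dim M2)%N),
        finite_set (inner_galois Y `|` outer_galois Y) &
        inner_galois X =
          linear_join (in_ambient (inner_galois Y)) M2 `\` points M2 /\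
        outer_galois X =
          linear_join (in_ambient (outer_galois Y)) M2 `\` points M2].
Proof.
have char0 k : k.+1%:R != 0 :> K.
  by have /pcharf0P -> := charK.
have Kclosed : alg_closed K by move=> p /closed_rootP.
have NW : avoiding_plane X := exists_avoiding_plane Kclosed dimV singX.
have [M2 M2P] : exists M2 : {vspace V}, forall m, m \in M2 <-> dderiv m (hpoly X) = 0.
  apply: exists_subspace => [|c v w Dv Dw].
    by rewrite -(scale0r (0 : V)) dderivZl scale0r.
  by rewrite dderivDl dderivZl Dv Dw scaler0 addr0.
have M20 : M2 != 0%VS.
  apply/eqP => M20; apply: infX.
  have noncone v : dderiv v (hpoly X) = 0 -> v = 0.
    by move/M2P; rewrite M20 memv0 => /eqP.
  exact: galois_points_finite Kclosed char0 NW noncone degX.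
have vtx := base_vertex char0 M2P M20.
split; first by exists M2.
have [Y [YF Yd]] := exists_base Kclosed char0 M2P.
exists (M2^C)%VS, M2, Y; split; first by rewrite capvC capv_compl.
split.
- exact: (locus_join Kclosed char0 degX NW M2P YF Yd).
- by split=> // M; apply: (base_vertex_maximal Kclosed M2P).
- have dY : (4 <= degree Y)%N by rewrite Yd.
  exact: (galois_points_finite Kclosed char0 (base_plane Kclosed char0 degX NW M2P YF)
    (base_noncone Kclosed char0 M2P YF) dY).
- split; first exact: (inner_join Kclosed char0 degX NW M2P YF Yd).
  exact: (outer_join Kclosed char0 degX NW M2P YF Yd).
Qed.
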